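(* Let $(M^n,g,f)$, $n\ge 3$, be a compact $V$-static manifold with connected boundary $\partial M$, with constant $\kappa\neq 0$, and with nonnegative scalar curvature $R$. Let $H$ be the mean curvature of $\partial M$ and let $q_1$ be the first eigenvalue of the fourth-order Steklov problem $$\Delta^2u=0\ \text{ in } M,\qquad u=0\ \text{ on }\partial M,\qquad \Delta u=q\,\frac{\partial u}{\partial\nu}\ \text{ on }\partial M.$$ Then $$q_1\ \ge\ \frac{n}{n-1}H.$$ Equality holds if and only if $R=0$. Moreover, in the equality case, every first eigenfunction (that is, every eigenfunction associated with $q_1$) is a nonzero constant multiple of the $V$-static potential $f$.
   Context: A compact $V$-static manifold $(M^n,g,f)$ (with constant $\kappa$) is a compact connected $n$-dimensional Riemannian manifold $(M^n,g)$ with nonempty smooth boundary $\partial M$, together with a nonconstant smooth function $f:M\to\mathbb{R}$ (the $V$-static potential) and a constant $\kappa\in\mathbb{R}$ such that $-(\Delta f)g+\nabla^2 f-f\,Ric=\kappa g$ in $M$, $f>0$ on $int(M)$, and $f=0$ on $\partial M$. Here $Ric$ is the Ricci tensor, $\nabla^2$ the Hessian, and $\Delta=\operatorname{tr}_g\nabla^2$. It is known that the scalar curvature $R$ is then constant, and that $|\nabla f|$ is a nonzero constant on each connected component of $\partial M$. The outward unit normal along $\partial M$ is $\nu=-\nabla f/|\nabla f|$; the second fundamental form is $\mathbb{II}(X,Y)=\langle\nabla_X\nu,Y\rangle$ and the mean curvature is its trace $H=\operatorname{tr}\mathbb{II}$ (not divided by $n-1$). On a $V$-static manifold $H$ is constant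 on each connected component of $\partial M$ and $H=\kappa/|\nabla f|$. An eigenvalue of the fourth-order Steklov problem is a number $q\in\mathbb{R}$ for which the problem has a nontrivial solution $u\in C^\infty(M)$ (smooth up to the boundary), called an eigenfunction; $q_1$ is the smallest eigenvalue. *)

(* Defs.v *)
From mathcomp Require Import all_boot all_order all_algebra.
From mathcomp Require Import all_classical all_reals all_analysis.

Set Implicit Arguments.
Unset Strict Implicit.
Unset Printing Implicit Defensive.

Import Order.TTheory GRing.Theory Num.Theory.
Import numFieldNormedType.Exports.

Local Open Scope classical_set_scope.
Local Open Scope ring_scope.

(** * Calculus on the half-space of R^n (first coordinate nonnegative) *)

Section HalfSpace.
Context {R : realType} {n : nat}.
Implicit Types (x : 'rV[R]_n) (F : 'rV[R]_n -> R) (a : 'I_n).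

Definition half_space : set 'rV[R]_n :=
  [set x | forall a : 'I_n, a = 0%N :> nat -> 0 <= x ord0 a].

Definition wall : set 'rV[R]_n :=
  [set x | half_space x /\ exists2 a : 'I_n, a = 0%N :> nat & x ord0 a = 0].

Definition basis_vec a : 'rV[R]_n := delta_mx ord0 a.

Fixpoint Ck (k : nat) (V : set 'rV[R]_n) F : Prop :=
  if k is k'.+1 then
    forall a, (forall x, V x -> derivable F x (basis_vec a)) /\
              Ck k' V (fun x => 'D_(basis_vec a) F x)
  else forall x, V x -> {for x, continuous F}.

(* Used for A relatively open in [half_space]: smooth up to the wall means
   locally the restriction of a function that is smooth on an open subset of
   R^n. *)
Definition smooth_within (A : set 'rV[R]_n) F : Prop :=
  forall x, A x -> exists V G,
    [/\ open V, V x, forall k, Ck k V G & forall y, V y -> A y -> F y = G y].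

(* One-sided derivative along the increasing direction of the a-th coordinate.
   Starting from a point of a relatively open subset of [half_space], small
   such increments stay in that subset, so [pd a F] depends only on the values
   of F there, also at wall points; if F is smooth in the sense of
   [smooth_within], it is the usual partial derivative (at wall points, that
   of any smooth extension). *)
Definition pd a F x : R :=
  lim (h^-1 * (F (x + h *: basis_vec a) - F x) @[h --> 0^'+]).

End HalfSpace.

(** * Riemannian geometry in coordinates *)

Section Coordinates.
Context {R : realType} {n : nat}.
(* G is the matrix (g_ab) of the metric as a function of the coordinates. *)
Variable G : 'rV[R]_n -> 'M[R]_n.
Implicit Types (x : 'rV[R]_n) (F : 'rV[R]_n -> R) (a b c d : 'I_n).

(* Gamma^c_ab *)
Definition christoffel c a b x : R :=
  2^-1 * \sum_d invmx (G x) c d *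
    (pd a (fun y => G y b d) x + pd b (fun y => G y a d) x
     - pd d (fun y => G y a b) x).

Definition coord_hessian F x : 'M[R]_n :=
  \matrix_(a, b) (pd a (pd b F) x - \sum_c christoffel c a b x * pd c F x).

(* Sign convention: positive on round spheres. *)
Definition coord_ricci x : 'M[R]_n :=
  \matrix_(a, b) \sum_c
    (pd c (christoffel c a b) x - pd b (christoffel c a c) x
     + \sum_d (christoffel c c d x * christoffel d a b x
               - christoffel c b d x * christoffel d a c x)).

Definition metric_trace (T : 'M[R]_n) x : R := \tr (invmx (G x) *m T).

Definition coord_laplacian F x : R := metric_trace (coord_hessian F x) x.

(* The conormal dx^0 of the wall. *)
Definition conormal : 'rV[R]_n := \row_a (a == 0%N :> nat)%:R.

(* nu^a = - g^{a0} / sqrt (g^{00}): on the wall, the outward unit normal. *)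
Definition coord_normal x : 'rV[R]_n :=
  - (Num.sqrt ((conormal *m invmx (G x) *m conormal^T) ord0 ord0))^-1
    *: (conormal *m invmx (G x)).

(* The a-b entry is < nabla_{d_a} nu, d_b >; on the wall, its restriction to
   vectors tangent to the wall is the second fundamental form. *)
Definition coord_second_form x : 'M[R]_n :=
  \matrix_(a, b) \sum_c
    (pd a (fun y => coord_normal y ord0 c) x
     + \sum_d christoffel c a d x * coord_normal x ord0 d) * G x c b.

(* Trace of the second fundamental form over the tangent space of the wall:
   g^{ab} - nu^a nu^b is the inverse of the induced metric. *)
Definition coord_mean_curvature x : R :=
  \sum_a \sum_b
    (invmx (G x) a b - coord_normal x ord0 a * coord_normal x ord0 b)
    * coord_second_form x a b.

Definition coord_normal_derivative F x : R :=
  \sum_a coord_normal x ord0 a * pd a F x.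

End Coordinates.

(** * Smooth manifolds with boundary *)

Record chart (R : realType) (n : nat) (M : topologicalType) := Chart {
  domain : set M;
  coord : M -> 'rV[R]_n;
  param : 'rV[R]_n -> M;
  open_domain : open domain;
  coord_range : exists2 V, open V & coord @` domain = V `&` half_space;
  paramK : forall x, domain x -> param (coord x) = x;
  coord_continuous : {within domain, continuous coord};
  param_continuous : {within coord @` domain, continuous param} }.

Record manifold (R : realType) (n : nat) := Manifold {
  point :> topologicalType;
  index : Type;
  chart_of : index -> chart R n point;
  chart_at : point -> index;
  domain_chart_at : forall x, domain (chart_of (chart_at x)) x;
  point_hausdorff : hausdorff_space point;
  point_second_countable : @second_countable point;
  smooth_transition : forall i j (a : 'I_n),
    smooth_within
      (coord (chart_of i) @`
         (domain (chart_of i) `&` domain (chart_of j)))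
      (fun y => coord (chart_of j) (param (chart_of i) y) ord0 a) }.

Arguments index {R n} m.
Arguments chart_of {R n m} i.
Arguments chart_at {R n m} x.

Section ManifoldDefs.
Context {R : realType} {n : nat} (M : manifold R n).

Definition boundary : set M :=
  [set x | exists i : index M,
     domain (chart_of i) x /\ wall (coord (chart_of i) x)].

Definition smooth (u : M -> R) : Prop := forall i : index M,
  smooth_within (coord (chart_of i) @` domain (chart_of i))
                (u \o param (chart_of i)).

(* d y^b / d x^a, where x and y are the coordinates of the charts i and j. *)
Definition jacobian_at (i j : index M) (p : M) : 'M[R]_n :=
  \matrix_(a, b)
    pd a (fun x => coord (chart_of j) (param (chart_of i) x) ord0 b)
       (coord (chart_of i) p).

End ManifoldDefs.

Arguments boundary {R n} M _.

(** * Riemannian manifolds *)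

Record riemannian (R : realType) (n : nat) := Riemannian {
  base :> manifold R n;
  (* [metric i] is the matrix of the metric in the coordinates of chart i *)
  metric : index base -> 'rV[R]_n -> 'M[R]_n;
  metric_smooth : forall i a b,
    smooth_within (coord (chart_of i) @` domain (chart_of i))
                  (fun x => metric i x a b);
  metric_sym : forall i p, domain (chart_of i) p ->
    (metric i (coord (chart_of i) p))^T = metric i (coord (chart_of i) p);
  metric_pos : forall i p (v : 'rV[R]_n), domain (chart_of i) p -> v != 0 ->
    0 < (v *m metric i (coord (chart_of i) p) *m v^T) ord0 ord0;
  metric_change : forall i j p,
    domain (chart_of i) p -> domain (chart_of j) p ->
    metric i (coord (chart_of i) p) =
      jacobian_at i j p *m metric j (coord (chart_of j) p)
        *m (jacobian_at i j p)^T }.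

Arguments metric {R n} r i.

(* The components of a tensor depend on a chart i. Scalars do not, and are
   computed in the chart [chart_at p]. *)
Section Riemannian.
Context {R : realType} {n : nat} (M : riemannian R n).
Implicit Types (u : M -> R) (p : M) (i : index M).

Definition hessian u i p : 'M[R]_n :=
  coord_hessian (metric M i) (u \o param (chart_of i)) (coord (chart_of i) p).

Definition ricci i p : 'M[R]_n :=
  coord_ricci (metric M i) (coord (chart_of i) p).

Definition laplacian u p : R :=
  let i := chart_at p in
  coord_laplacian (metric M i) (u \o param (chart_of i))
    (coord (chart_of i) p).

Definition scalar_curvature p : R :=
  let i := chart_at p in
  metric_trace (metric M i) (ricci i p) (coord (chart_of i) p).

(* The next two are meaningful at boundary points p only. *)
Definition mean_curvature p : R :=
  let i := chart_at p in
  coord_mean_curvature (metric M i) (coord (chart_of i) p).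

Definition normal_derivative u p : R :=
  let i := chart_at p in
  coord_normal_derivative (metric M i) (u \o param (chart_of i))
    (coord (chart_of i) p).

(** * V-static manifolds and the fourth-order Steklov problem *)

Record compact_v_static (f : M -> R) (kappa : R) : Prop := {
  v_static_compact : compact [set: M];
  v_static_connected : connected [set: M];
  v_static_boundary : boundary M !=set0;
  v_static_smooth : smooth f;
  v_static_nonconstant : exists p q, f p != f q;
  v_static_equation : forall i p, domain (chart_of i) p ->
    let g := metric M i (coord (chart_of i) p) in
    - laplacian f p *: g + hessian f i p - f p *: ricci i p = kappa *: g;
  v_static_pos : forall p, ~ boundary M p -> 0 < f p;
  v_static_zero : forall p, boundary M p -> f p = 0 }.

Record steklov_eigenfunction (q : R) (u : M -> R) : Prop := {
  steklov_smooth : smooth u;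
  steklov_nontrivial : exists p, u p != 0;
  steklov_biharmonic : forall p, laplacian (laplacian u) p = 0;
  steklov_dirichlet : forall p, boundary M p -> u p = 0;
  steklov_boundary : forall p, boundary M p ->
    laplacian u p = q * normal_derivative u p }.

Definition steklov_eigenvalue (q : R) : Prop :=
  exists u, steklov_eigenfunction q u.

Definition first_steklov_eigenvalue (q1 : R) : Prop :=
  steklov_eigenvalue q1 /\ forall q, steklov_eigenvalue q -> q1 <= q.

End Riemannian.

(* Main.v *)
(* Let a = |grad f| on the boundary, a constant, and c = n kappa / (n - 1). On the
   boundary f = 0, so Hess f = - kappa / (n - 1) g there, whence H = kappa / a and
   the claimed bound is c / a; in the interior the trace of the V-static equation
   gives - Lap f - c = f R / (n - 1).

   The only global tool is: a field X = sum_k phi_k grad psi_k with nonnegative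
   divergence, whose product with grad f is nonnegative on the boundary (so that
   the outward flux is nonpositive), is divergence free. For an eigenfunction u and
   h = Lap u it is applied to h grad u - u grad h, which gives q > 0, and, assuming
   q <= c / a, to

     - h^2 grad f + 2 f h grad h - c h grad u + c u grad h,

   whose divergence is h^2 f R / (n - 1) + 2 f |grad h|^2. Hence h is a nonzero
   constant and R = 0, so that u is a multiple of f and q = c / a. Conversely, if
   R = 0, then Lap f = - c and f is an eigenfunction with eigenvalue c / a. *)

Require Import Defs.
From mathcomp Require Import all_boot all_order all_algebra.
From mathcomp Require Import all_classical all_reals all_analysis.
From mathcomp Require Import finmap ring lra zify.

Import Order.TTheory GRing.Theory Num.Theory.
Import numFieldNormedType.Exports.

Set Implicit Arguments.
Unset Strict Implicit.
Unset Printing Implicit Defensive.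

Local Open Scope classical_set_scope.
Local Open Scope ring_scope.


(** * A translation-invariant integral on R^n *)

(** The second field is the sum of two Green pairs: f grad(h^2) - h^2 grad f, with divergence 2 f
    |grad h|^2 - h^2 Lap f since h is harmonic, and c (u grad h - h grad u), with divergence - c
    h^2. Together they produce the combination - Lap f - c, whose sign the traced equation controls.
    No sign of kappa is assumed: q > 0 alone turns q <= c / a into c / q >= a, which is the sign
    wanted on the boundary. The obstacle is that all global analysis has to come from a linear
    functional on compactly supported continuous functions of R^n. Only functions supported off the
    boundary are integrated; the boundary enters through C^1 cutoffs that are increasing functions
    of f, so that the sign of the product with grad f replaces a surface integral. The volume
    density is the reciprocal mass of a bump on the metric ellipsoid, which gives its derivative and
    its behaviour under coordinate changes without determinants. Chart independence of the Laplacian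
    is then deduced from Green's formula in single charts. *)

Section Invariant_integral.
Context {R : realType} {n : nat}.
Implicit Types (F : 'rV[R]_n -> R) (x v : 'rV[R]_n) (N k : nat).

Lemma coord_le_norm x a : `|x ord0 a| <= `|x|.
Proof.
have /mapP[j Hj ->] : `|x ord0 a| \in [seq `|x y.1 y.2| | y : 'I_1 * 'I_n].
  by apply/mapP; exists (ord0, a) => //=; rewrite mem_enum.
by rewrite [leRHS]/Num.norm /= mx_normrE; apply/bigmax_geP; right => /=; exists j.
Qed.

Lemma norm_le_coord x (r : R) :
  0 <= r -> (forall a, `|x ord0 a| <= r) -> `|x| <= r.
Proof.
move=> r0 h; rewrite [leLHS]/Num.norm /= mx_normrE.
by apply/bigmax_leP; split => //= -[i j] _ /=; rewrite ord1.
Qed.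

Definition supp_le F N := forall x, N%:R < `|x| -> F x = 0.

Definition lat k (z : 'rV[int]_n) : 'rV[R]_n := (2 ^+ k)^-1 *: map_mx intr z.

Lemma latD k z w : lat k (z + w) = lat k z + lat k w.
Proof. by rewrite /lat map_mxD scalerDr. Qed.

Definition latbox N k := [set z : 'rV[int]_n | `|lat k z| <= N%:R].

Lemma finite_latbox N k : finite_set (latbox N k).
Proof.
pose m := (N * 2 ^ k)%N.
pose h (w : 'rV['I_(2 * m).+1]_n) : 'rV[int]_n :=
  \row_a ((w ord0 a : nat)%:Z - m%:Z).
apply: (@sub_finite_set _ _ (h @` setT)); last exact: finite_image.
move=> z; rewrite /latbox /= => hz.
have hza a : `|z ord0 a| <= m%:Z.
  have := le_trans (coord_le_norm (lat k z) a) hz.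
  rewrite !mxE normrM ger0_norm ?invr_ge0 ?exprn_ge0//.
  rewrite mulrC ler_pdivrMr ?exprn_gt0// -intr_norm.
  by rewrite -natrX -natrM -[_%:R]/((m%:Z)%:~R) ler_int.
exists (\row_a inord (absz (z ord0 a + m%:Z))) => //.
apply/rowP => a; have := hza a; rewrite !mxE; move: (z ord0 a) => w; clearbody m.
by rewrite ler_norml => /andP[h1 h2]; rewrite inordK; lia.
Qed.

(** Summing over the whole lattice makes invariance under lattice translations a mere reindexing.
    The finite-support sum defaults to 0 when F is nonzero at infinitely many lattice points. *)
Definition latsum k F : R := \sum_(z \in [set: 'rV[int]_n]) F (lat k z).

Lemma latsumE N k F : supp_le F N ->
  latsum k F = \sum_(z <- fset_set (latbox N k)) F (lat k z).
Proof.
move=> FN; rewrite /latsum -(fsbig_finite _ _ (finite_latbox N k)).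
apply/esym/fsbig_widen => // z [_ /negP]; rewrite -ltNge => h /=.
exact: FN.
Qed.

Lemma supp_le_leq F N N' : (N <= N')%N -> supp_le F N -> supp_le F N'.
Proof.
by move=> NN' FN x h; apply: FN; apply: le_lt_trans h; rewrite ler_nat.
Qed.

Lemma latsumD N k F G : supp_le F N -> supp_le G N ->
  latsum k (fun x => F x + G x) = latsum k F + latsum k G.
Proof.
move=> FN GN; have sN : supp_le (fun x => F x + G x) N.
  by move=> x h; rewrite FN// GN// addr0.
by rewrite (latsumE k FN) (latsumE k GN) (latsumE k sN) big_split.
Qed.

Lemma latsumZ k c F : latsum k (fun x => c * F x) = c * latsum k F.
Proof. by rewrite /latsum mulr_fsumr. Qed.

Lemma latsum_sum (I : finType) N k (G : I -> 'rV[R]_n -> R) :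
  (forall i, supp_le (G i) N) ->
  latsum k (fun x => \sum_i G i x) = \sum_i latsum k (G i).
Proof.
move=> GN.
have sN : supp_le (fun x => \sum_i G i x) N.
  by move=> x h; apply: big1 => i _; exact: GN.
rewrite (latsumE k sN) exchange_big.
by apply: eq_bigr => i _; rewrite (latsumE k (GN i)).
Qed.

Lemma latsum_le N k F G : supp_le F N -> supp_le G N ->
  (forall x, F x <= G x) -> latsum k F <= latsum k G.
Proof.
by move=> FN GN FG; rewrite (latsumE k FN) (latsumE k GN); apply: ler_sum.
Qed.

Lemma latsum_shift k F z : latsum k (fun x => F (x + lat k z)) = latsum k F.
Proof.
rewrite /latsum [RHS](reindex_fsbigT (fun w => w + z)).
  by apply: eq_fsbigr => w _; rewrite latD.
by exists (fun w => w - z) => w; rewrite ?addrK ?subrK.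
Qed.

(** It is at least 1 on the unit ball, so its integer translates dominate bounded functions of
    bounded support, and it is positive at the lattice point 0, so it can serve as a normalisation
    at every scale. *)
Definition unit_bump x : R := Num.max 0 (2 - `|x|).

Lemma unit_bump_ge0 x : 0 <= unit_bump x.
Proof. by rewrite /unit_bump le_max lexx. Qed.

Lemma unit_bump_supp : supp_le unit_bump 2.
Proof. by move=> x h; rewrite /unit_bump max_l// subr_le0 ltW. Qed.

Lemma unit_bump_continuous : continuous unit_bump.
Proof.
move=> x; apply: (@continuous_max R _ (cst 0) (fun y => 2 - `|y|)).
  exact: cst_continuous.
have c2 : {for x, continuous (cst 2 : 'rV[R]_n -> R)} by exact: cst_continuous.
exact: (continuousB c2 (@norm_continuous _ _ x)).
Qed.

Lemma latsum_bump_gt0 k : 0 < latsum k unit_bump.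
Proof.
rewrite (latsumE _ unit_bump_supp).
have z0 : (0 : 'rV[int]_n) \in fset_set (latbox 2 k).
  rewrite in_fset_set; last exact: finite_latbox.
  by apply/mem_set; rewrite /latbox /= /lat map_mx0 scaler0 normr0.
rewrite (big_fsetD1 (0 : 'rV[int]_n) z0) /=; apply: ltr_pwDl.
  by rewrite /lat map_mx0 scaler0 /unit_bump normr0 subr0 lt_max ltr0n orbT.
by apply: sumr_ge0 => z _; exact: unit_bump_ge0.
Qed.

Definition grid N (t : 'rV['I_(2 * N).+1]_n) : 'rV[R]_n :=
  \row_a ((t ord0 a : nat)%:R - N%:R).

Lemma grid_cover (r : R) N x : 0 < r -> `|x| <= N%:R * r ->
  exists t : 'rV['I_(2 * N).+1]_n, `|x - r *: grid t| <= r.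
Proof.
move=> r0 xN.
pose m a : int := Num.floor (x ord0 a / r).
have hm a : (- N%:Z <= m a) && (m a <= N%:Z).
  have := le_trans (coord_le_norm x a) xN; rewrite ler_norml => /andP[h1 h2].
  apply/andP; split; last first.
    rewrite -(ler_int R) (le_trans (floor_le _))// ler_pdivrMr//.
  by rewrite floor_ge_int ler_pdivlMr// intrN mulNr.
exists (\row_a inord (absz (m a + N%:Z))); apply: norm_le_coord; first exact: ltW.
move=> a; rewrite !mxE inordK; last by have := hm a; lia.
have -> : (absz (m a + N%:Z))%:R - N%:R = (m a)%:~R :> R.
  rewrite -[(absz _)%:R]/((absz (m a + N%:Z))%:Z)%:~R.
  have -> : (absz (m a + N%:Z))%:Z = m a + N%:Z :> int by have := hm a; lia.
  by rewrite rmorphD /= addrK.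
have /andP[h1 h2] := floor_itv (x ord0 a / r).
have xr : x ord0 a = (x ord0 a / r) * r by rewrite divfK// gt_eqF.
rewrite xr mulrC -mulrBr normrM gtr0_norm// ger_pMr// ler_norml.
move: h2; rewrite intrD -/(m a) => h2; move: h1; rewrite -/(m a) => h1.
lra.
Qed.

Lemma grid_norm N (t : 'rV['I_(2 * N).+1]_n) : `|grid t| <= N%:R.
Proof.
apply: norm_le_coord => // a; rewrite !mxE ler_norml.
have : ((t ord0 a : nat)%:R <= (2 * N)%:R :> R) by rewrite ler_nat -ltnS.
have : 0 <= (t ord0 a : nat)%:R :> R by [].
rewrite natrM; lra.
Qed.

(** Integer points belong to all the dyadic lattices, so one family of translated bumps has the same
    lattice sums at every scale k. *)
Lemma grid_lat k N (t : 'rV['I_(2 * N).+1]_n) : exists z, - grid t = lat k z.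
Proof.
exists (\row_a (- (((t ord0 a : nat)%:Z - N%:Z) * 2 ^+ k))).
apply/rowP => a; rewrite !mxE rmorphN /= rmorphM rmorphB /= rmorphXn /=.
by rewrite mulrN mulrC mulfK// expf_neq0.
Qed.

Lemma supp_le_shift F N M v : supp_le F N -> `|v| <= M%:R ->
  supp_le (fun x => F (x + v)) (N + M).
Proof.
move=> FN vM x xN; apply: FN; rewrite -(ltrD2r M%:R) -natrD.
apply: (lt_le_trans xN); rewrite -[in leLHS](addrK v x).
by apply: (le_trans (ler_normB _ _)); rewrite lerD2l.
Qed.

Definition grid_card N : R := #|{: 'rV['I_(2 * N).+1]_n}|%:R.

(** F is dominated by M times the sum of the translates of [unit_bump] to the points of [grid], each
    of which has the lattice sum of [unit_bump] itself. The factor [grid_card N] does not depend on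
    k. *)
Lemma latsum_bound N k F (M : R) : supp_le F N -> (forall x, `|F x| <= M) ->
  `|latsum k F| <= M * grid_card N * latsum k unit_bump.
Proof.
move=> FN FM; have M0 : 0 <= M by exact: le_trans (FM 0).
pose B (t : 'rV['I_(2 * N).+1]_n) x := M * unit_bump (x - grid t).
have BN t : supp_le (B t) (2 + N).
  move=> x h; rewrite /B (_ : unit_bump _ = 0) ?mulr0//.
  by apply: (supp_le_shift unit_bump_supp _ h); rewrite normrN grid_norm.
have sB : latsum k (fun x => \sum_t B t x) =
    M * grid_card N * latsum k unit_bump.
  rewrite (latsum_sum k BN) (eq_bigr (fun=> M * latsum k unit_bump)).
    by rewrite sumr_const -[LHS]mulr_natr mulrAC.
  move=> t _; rewrite /B latsumZ; congr (_ * _).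
  by have [z ->] := grid_lat k t; rewrite latsum_shift.
have B0 t x : 0 <= B t x by rewrite mulr_ge0// unit_bump_ge0.
have FB x : `|F x| <= \sum_t B t x.
  have [xN|xN] := leP `|x| N%:R; last first.
    by rewrite FN// normr0; apply: sumr_ge0.
  have [|t tx] := @grid_cover 1 N x ltr01; first by rewrite mulr1.
  rewrite (bigD1 t)//=; apply: ler_wpDr; first exact: sumr_ge0.
  apply: (le_trans (FM x)); rewrite ler_peMr// /unit_bump le_max.
  by rewrite scale1r in tx; apply/orP; right; lra.
have sBN : supp_le (fun x => \sum_t B t x) (2 + N).
  by move=> x h; apply: big1 => t _; exact: BN.
have FN' : supp_le F (2 + N) by apply: supp_le_leq FN; rewrite leq_addl.
rewrite ler_norml -sB; apply/andP; split.
  rewrite -mulN1r -latsumZ; apply: (@latsum_le (2 + N)) => // x.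
    by move=> h; rewrite sBN// mulr0.
  by have := FB x; rewrite ler_norml mulN1r => /andP[].
apply: (@latsum_le (2 + N)) => // x.
by have := FB x; rewrite ler_norml => /andP[].
Qed.

Definition riem F k : R := latsum k F / latsum k unit_bump.

Lemma riem_bound N k F (M : R) : supp_le F N -> (forall x, `|F x| <= M) ->
  `|riem F k| <= M * grid_card N.
Proof.
move=> FN FM; rewrite /riem normrM normfV (gtr0_norm (latsum_bump_gt0 k)).
by rewrite ler_pdivrMr ?latsum_bump_gt0//; exact: latsum_bound.
Qed.

End Invariant_integral.

(** * Limits along an ultrafilter, and uniform convergence on compact sets *)

Definition nat_ultra : set_system nat :=
  sval (cid (ultraFilterLemma (F := \oo) _)).

Lemma nat_ultra_ultra : UltraFilter nat_ultra.
Proof. by rewrite /nat_ultra; case: cid => x []. Qed.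

Lemma nat_ultra_eventually : \oo `<=` nat_ultra.
Proof. by rewrite /nat_ultra; case: cid => x []. Qed.

#[global] Instance nat_ultra_proper : ProperFilter nat_ultra.
Proof. exact: (@ultra_proper _ _ nat_ultra_ultra). Qed.

Lemma fmap_ultra (S T : Type) (f : S -> T) (F : set_system S) :
  UltraFilter F -> UltraFilter (f @ F).
Proof.
move=> UF; split; first exact: fmap_proper_filter.
move=> G PG FG; apply/seteqP; split => // A GA.
have [//|nA] := in_ultra_setVsetC (f @^-1` A) UF.
have [x [Ax nAx]] := filter_ex (filterI GA (FG (~` A) nA)).
by case: nAx.
Qed.

Lemma cvg_nat_ultra (R : realType) (u : nat -> R) (B : R) :
  (forall k, `|u k| <= B) -> cvg (u k @[k --> nat_ultra]).
Proof.
move=> uB; have := @segment_compact R (- B) B; rewrite compact_ultra => cB.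
have FU : UltraFilter (u k @[k --> nat_ultra]).
  exact/fmap_ultra/nat_ultra_ultra.
have FB : nat_ultra [set k | `[- B, B]%classic (u k)].
  apply: filterE => k /=; rewrite in_itv/=.
  by have := uB k; rewrite ler_norml.
by have [p [_ up]] := cB _ FU FB; apply/cvg_ex; exists p.
Qed.

(** Joint convergence in parameter and point gives, around each point of K, a neighbourhood and a
    set of the filter on which the estimate holds; compactness leaves a single set of the filter.
    Joint limits are convenient as a hypothesis because limit rules apply to them directly. *)
Lemma unif_cvg (R : realType) (X : topologicalType) (T : Type)
    (FT : set_system T) (K : set X) (P : T -> X -> R) (P0 : X -> R) :
  forall FF : Filter FT,
  compact K -> (forall x, K x -> {for x, continuous P0}) ->
  (forall x, K x -> P z.1 z.2 @[z --> (FT, nbhs x)] --> P0 x) ->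
  forall e : R, 0 < e -> \forall p \near FT, forall x, K x -> `|P p x - P0 x| < e.
Proof.
move=> FF /compact_near_coveringP cK P0c Pc e e0.
apply: (cK T FT (fun p x => `|P p x - P0 x| < e)) => x Kx.
have e2 : 0 < e / 2 by rewrite divr_gt0.
have /cvgrPdist_lt/(_ _ e2)[[A B] /= [FA xB] AB] := Pc x Kx.
have /cvgrPdist_lt/(_ _ e2) xC := P0c x Kx.
exists (B `&` [set y | `|P0 x - P0 y| < e / 2], A) => /=.
  by split => //; apply: filterI.
move=> [y p] /= [[By Cy] Ap].
have := AB (p, y) (conj Ap By); rewrite /= => h.
rewrite (splitr e) -(subrK (P0 x) (P p y)) -addrA.
by apply: (le_lt_trans (ler_normD _ _)); rewrite ltrD// distrC.
Qed.

Arguments unif_cvg {R X T FT K P P0 FF}.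

Lemma continuous_pairl (X Y : topologicalType) (x : X) :
  continuous (fun y : Y => (x, y)).
Proof.
move=> y A [[B C] /= [xB yC] BC]; apply: filterS yC => z Cz.
by apply: BC; split => //; exact: nbhs_singleton.
Qed.

Lemma continuous_pairr (X Y : topologicalType) (y : Y) :
  continuous (fun x : X => (x, y)).
Proof.
move=> x A [[B C] /= [xB yC] BC]; apply: filterS xB => z Cz.
by apply: BC; split => //; exact: nbhs_singleton.
Qed.

Section Integral.
Context {R : realType} {n : nat}.
Implicit Types (F G : 'rV[R]_n -> R) (x v : 'rV[R]_n) (N k : nat).

(* A translation-invariant integral: the limit of Riemann sums over the lattices
   2^-k Z^n, normalised so that [unit_bump] has integral 1. Taking the limit along
   an ultrafilter makes it exist for every bounded sequence of sums. *)
Definition J F : R := lim (riem F k @[k --> nat_ultra]).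

Definition Cc F := continuous F /\ exists N, supp_le F N.

Definition cball N : set 'rV[R]_n := [set x | `|x| <= N%:R].

Lemma compact_cball N : compact (cball N).
Proof.
apply: bounded_closed_compact.
  by exists N%:R; split; [exact: num_real|] => r /ltW Nr x /le_trans; apply.
rewrite (_ : cball N = (fun x => `|x|) @^-1` [set r | r <= N%:R])//.
apply: closed_comp; last exact: closed_le.
by move=> x _; exact: norm_continuous.
Qed.

Lemma Cc_bounded F : Cc F -> exists M, forall x, `|F x| <= M.
Proof.
move=> [cF [N FN]].
have : compact (F @` cball N).
  apply: continuous_compact; last exact: compact_cball.
  exact: continuous_subspaceT.
move=> /compact_bounded [M [_ hM]]; exists (`|M| + 1) => x.
have [xN|xN] := leP `|x| N%:R; last by rewrite FN// normr0 addr_ge0.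
apply: hM; last by exists x.
by apply: (le_lt_trans (ler_norm M)); rewrite ltrDl.
Qed.

Lemma riem_cvg F : Cc F -> riem F k @[k --> nat_ultra] --> J F.
Proof.
move=> CF; have [M FM] := Cc_bounded CF; have [_ [N FN]] := CF.
have : cvg (riem F k @[k --> nat_ultra]); last by [].
by apply: (@cvg_nat_ultra _ _ (M * @grid_card R n N)) => k; exact: riem_bound.
Qed.

Lemma CcD F G : Cc F -> Cc G -> Cc (fun x => F x + G x).
Proof.
move=> [cF [N FN]] [cG [N' GN]]; split.
  by move=> x; exact: (@continuousD R R^o _ F G x (cF x) (cG x)).
exists (maxn N N') => x h.
by rewrite (supp_le_leq (leq_maxl N N') FN)// (supp_le_leq (leq_maxr N N') GN)// addr0.
Qed.

Lemma CcMl F G : continuous F -> Cc G -> Cc (fun x => F x * G x).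
Proof.
move=> cF [cG [N GN]]; split; first by move=> x; exact: (continuousM (cF x) (cG x)).
by exists N => x h; rewrite GN// mulr0.
Qed.

Lemma CcZ c F : Cc F -> Cc (fun x => c * F x).
Proof. by move=> ?; apply: (@CcMl (cst c)) => //; exact: cst_continuous. Qed.

Lemma Cc0 : Cc (fun=> 0).
Proof. by split; [exact: cst_continuous|exists 0]. Qed.

Lemma J_eq F G : F =1 G -> J F = J G.
Proof. by move=> /funext ->. Qed.

Lemma JD F G : Cc F -> Cc G -> J (fun x => F x + G x) = J F + J G.
Proof.
move=> CF CG; apply: cvg_lim => //.
have -> : riem (fun x => F x + G x) = (fun k => riem F k + riem G k).
  apply/funext => k; have [_ [N FN]] := CF; have [_ [N' GN]] := CG.
  rewrite /riem (@latsumD _ _ (maxn N N')) ?mulrDl//.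
    by apply: supp_le_leq FN; rewrite leq_maxl.
  by apply: supp_le_leq GN; rewrite leq_maxr.
by apply: cvgD; exact: riem_cvg.
Qed.

Lemma JZ c F : Cc F -> J (fun x => c * F x) = c * J F.
Proof.
move=> CF; apply: cvg_lim => //.
have -> : riem (fun x => c * F x) = (fun k => c * riem F k).
  by apply/funext => k; rewrite /riem latsumZ mulrA.
by apply: cvgMr; exact: riem_cvg.
Qed.

Lemma J0 : J (fun=> 0) = 0.
Proof. by rewrite -[RHS](mul0r (J (fun=> 0))) -JZ//; [apply: J_eq => x; rewrite mul0r|exact: Cc0]. Qed.

Lemma J_sum I (r : seq I) (H : I -> 'rV[R]_n -> R) : (forall i, Cc (H i)) ->
  J (fun x => \sum_(i <- r) H i x) = \sum_(i <- r) J (H i)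
  /\ Cc (fun x => \sum_(i <- r) H i x).
Proof.
move=> CH; elim: r => [|i r [IH1 IH2]].
  split; first by rewrite big_nil -[RHS]J0; apply: J_eq => x; rewrite big_nil.
  by under eq_fun do rewrite big_nil; exact: Cc0.
rewrite big_cons -IH1 -JD//; split.
  by apply: J_eq => x; rewrite big_cons.
by under eq_fun do rewrite big_cons; exact: CcD.
Qed.

Lemma J_le F G : Cc F -> Cc G -> (forall x, F x <= G x) -> J F <= J G.
Proof.
move=> CF CG FG; have [_ [N FN]] := CF; have [_ [N' GN]] := CG.
apply: (ler_cvg_to (riem_cvg CF) (riem_cvg CG)); apply: nearW => k.
rewrite /riem ler_pM2r ?invr_gt0 ?latsum_bump_gt0//.
apply: (@latsum_le _ _ (maxn N N')) => //.
  by apply: supp_le_leq FN; rewrite leq_maxl.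
by apply: supp_le_leq GN; rewrite leq_maxr.
Qed.

Lemma J_ge0 F : Cc F -> (forall x, 0 <= F x) -> 0 <= J F.
Proof. by move=> CF F0; rewrite -J0; apply: J_le => //; exact: Cc0. Qed.

Lemma J_bound N F (M : R) : continuous F -> supp_le F N ->
  (forall x, `|F x| <= M) -> `|J F| <= M * @grid_card R n N.
Proof.
move=> cF FN FM; have CF : Cc F by split => //; exists N.
apply: (ler_cvg_to (cvg_norm (riem_cvg CF)) (cvg_cst _)).
by apply: nearW => k; exact: riem_bound.
Qed.

Lemma J_unit_bump : J unit_bump = 1.
Proof.
apply: cvg_lim => //; rewrite /riem.
under eq_fun do rewrite divff ?gt_eqF ?latsum_bump_gt0//.
exact: cvg_cst.
Qed.

Lemma Cc_unit_bump : Cc unit_bump.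
Proof.
by split; [exact: unit_bump_continuous|exists 2%N; exact: unit_bump_supp].
Qed.

Lemma CcB F G : Cc F -> Cc G -> Cc (fun x => F x - G x).
Proof.
move=> CF CG; have := CcD CF (CcZ (-1) CG).
by under eq_fun do rewrite mulN1r.
Qed.

Lemma JB F G : Cc F -> Cc G -> J (fun x => F x - G x) = J F - J G.
Proof.
move=> CF CG; rewrite -[- J G]mulN1r -JZ// -JD//; last exact: CcZ.
by apply: J_eq => x; rewrite mulN1r.
Qed.

(* The integral passes to limits under continuous convergence with uniformly
   bounded supports. *)
Lemma J_cvg (T : Type) (FT : set_system T) (P : T -> 'rV[R]_n -> R) P0 N :
  Filter FT -> continuous P0 -> supp_le P0 N ->
  (\forall p \near FT, continuous (P p) /\ supp_le (P p) N) ->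
  (forall x, P z.1 z.2 @[z --> (FT, nbhs x)] --> P0 x) ->
  J (P p) @[p --> FT] --> J P0.
Proof.
move=> FF cP0 P0N PN Pc; apply/cvgrPdist_le => e e0.
have C0 : 0 < @grid_card R n N + 1 by rewrite ltr_wpDl.
have eC : 0 < e / (@grid_card R n N + 1) by rewrite divr_gt0.
have := @unif_cvg _ _ _ _ _ _ _ FF (@compact_cball N) (fun x _ => cP0 x) (fun x _ => Pc x) _ eC.
apply: filterS2 PN => p [cp pN] hp.
have CP0 : Cc P0 by split => //; exists N.
have CPp : Cc (P p) by split => //; exists N.
have [cB _] := CcB CP0 CPp.
rewrite -JB//; apply: (le_trans (@J_bound N _ (e / (@grid_card R n N + 1)) _ _ _)) => //.
- by move=> x xN; rewrite P0N// pN// subrr.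
- move=> x; rewrite distrC; have [xN|xN] := leP `|x| N%:R.
    by rewrite ltW// hp.
  by rewrite P0N// pN// subrr normr0 ltW.
- rewrite mulrAC ler_pdivrMr// ler_pM2l// lerDl//.
Qed.

End Integral.

(** * Translation invariance, Fubini, scaling and strict positivity of the integral *)

Section Integral_properties.
Context {R : realType} {n : nat}.
Implicit Types (F G : 'rV[R]_n -> R) (x v : 'rV[R]_n) (N k : nat).

Lemma Cc_comp (F : 'rV[R]_n -> R) (g : 'rV[R]_n -> 'rV[R]_n) :
  Cc F -> continuous g -> (forall N, exists N', forall x, N'%:R < `|x| -> N%:R < `|g x|) ->
  Cc (F \o g).
Proof.
move=> [cF [N FN]] cg gN; split.
  by move=> x; apply: continuous_comp; [exact: cg|exact: cF].
by have [N' h] := gN N; exists N' => x /h; exact: FN.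
Qed.

Lemma nat_ge (r : R) : exists N : nat, r <= N%:R.
Proof. by exists (Num.truncn r).+1; rewrite ltW// truncnS_gt. Qed.

Lemma Cc_shift F v : Cc F -> Cc (fun x => F (x + v)).
Proof.
move=> CF; apply: (@Cc_comp F (fun x => x + v)) => //.
  by move=> x; exact: (cvgD cvg_id (cvg_cst v)).
move=> N; have [N' hN'] := nat_ge `|v|.
exists (N + N')%N => x; rewrite natrD => h.
have := ler_normB (x + v) v; rewrite addrK; lra.
Qed.

Definition latfloor k v : 'rV[int]_n := \row_a Num.floor (2 ^+ k * v ord0 a).

Lemma latfloor_cvg v : lat k (latfloor k v) @[k --> nat_ultra] --> v.
Proof.
apply: (@cvg_trans _ (lat k (latfloor k v) @[k --> \oo])).
  by apply: cvg_app; exact: nat_ultra_eventually.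
apply/cvgrPdist_le => e e0.
have lt21 : `|2^-1 : R| < 1 by rewrite gtr0_norm// invf_lt1// ltr1n.
have /cvgrPdist_le/(_ _ e0) := cvg_geometric 1 lt21.
apply: filterS => k; rewrite /geometric /= sub0r normrN mul1r => h.
apply: norm_le_coord => [|a]; first exact: ltW.
rewrite !mxE; set y := v ord0 a.
have /andP[h1 h2] := floor_itv (2 ^+ k * y).
have p2 : 0 < 2 ^+ k :> R by rewrite exprn_gt0.
have -> : y - (2 ^+ k)^-1 * (Num.floor (2 ^+ k * y))%:~R =
    (2 ^+ k)^-1 * (2 ^+ k * y - (Num.floor (2 ^+ k * y))%:~R).
  by rewrite mulrBr mulKf// gt_eqF.
have h' : (2 ^+ k)^-1 <= e.
  by move: h; rewrite exprVn ger0_norm// invr_ge0 ltW.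
rewrite normrM gtr0_norm ?invr_gt0//.
apply: le_trans h'; rewrite ger_pMr ?invr_gt0// ler_norml.
by move: h2; rewrite intrD; lra.
Qed.

Lemma latfloor_near v : \forall k \near nat_ultra, `|v - lat k (latfloor k v)| <= 1.
Proof. by have /cvgrPdist_le := @latfloor_cvg v; apply. Qed.

(** At scale k the vector v is replaced by the lattice vector [lat k (latfloor k v)]; these vectors
    tend to v, so the resulting change of the integrand tends to 0 uniformly. *)
Lemma J_shift F v : Cc F -> J (fun x => F (x + v)) = J F.
Proof.
move=> CF; have CFv := Cc_shift v CF.
have Hj x : F (z.2 + lat z.1 (latfloor z.1 v)) @[z --> (nat_ultra, nbhs x)]
    --> F (x + v).
  have Hz : z.2 + lat z.1 (latfloor z.1 v) @[z --> (nat_ultra, nbhs x)] --> x + v.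
    exact: (cvgD cvg_snd (cvg_comp _ _ cvg_fst (@latfloor_cvg v))).
  by have [cF _] := CF; exact: (cvg_comp _ _ Hz (cF (x + v))).
have H1 : riem (fun x => F (x + v)) k - riem F k @[k --> nat_ultra] --> J (fun x => F (x+v)) - J F.
  by apply: cvgB; exact: riem_cvg.
(* riem is exactly invariant under lattice translations *)
have H2 : riem (fun x => F (x + v)) k - riem F k @[k --> nat_ultra] --> (0 : R).
  have [cF [N FN]] := CF; have [N' hN'] := nat_ge (`|v| + 1).
  pose C := @grid_card R n (N + N') + 1.
  have C0 : 0 < C by rewrite ltr_wpDl.
  apply/cvgrPdist_le => e e0; have eC : 0 < e / C by rewrite divr_gt0.
  have := @unif_cvg R _ _ nat_ultra (@cball R n (N + N'))
    (fun k x => F (x + lat k (latfloor k v))) (fun x => F (x + v))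
    (@filter_filter _ _ nat_ultra_proper) (@compact_cball R n _) (fun x _ => proj1 CFv x) (fun x _ => Hj x) _ eC.
  have := latfloor_near v; apply: filterS2 => k hk hu.
  have sv : supp_le (fun x => F (x + v)) (N + N') by apply: supp_le_shift => //; lra.
  have sl : supp_le (fun x => F (x + lat k (latfloor k v))) (N + N').
    apply: supp_le_shift => //; rewrite -[lat _ _](subrK v).
    by rewrite distrC in hk; apply: (le_trans (ler_normD _ _)); lra.
  rewrite sub0r normrN.
  have -> : riem (fun x => F (x + v)) k - riem F k =
     riem (fun x => F (x + v) + (-1) * F (x + lat k (latfloor k v))) k.
    rewrite /riem (@latsumD _ _ (N + N'))//; last by move=> x h; rewrite sl// mulr0.
    by rewrite latsumZ latsum_shift mulN1r mulrBl.
  apply: (@le_trans _ _ (e / C * @grid_card R n (N + N'))).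
    apply: riem_bound => x; first by move=> h; rewrite sv// sl// mulr0 addr0.
    rewrite mulN1r distrC; have [xN|xN] := leP `|x| (N + N')%:R.
      by rewrite ltW// hu.
    by rewrite sv// sl// subrr normr0 ltW.
  by rewrite mulrAC ler_pdivrMr// ler_pM2l// lerDl.
by apply/eqP; rewrite -subr_eq0; apply/eqP; exact: (cvg_unique _ H1 H2).
Qed.

Lemma Cc_param (H : 'rV[R]_n -> 'rV[R]_n -> R) N :
  continuous (fun z => H z.1 z.2) ->
  (forall x y, N%:R < `|x| \/ N%:R < `|y| -> H x y = 0) ->
  [/\ forall x, Cc (H x), forall y, Cc (H^~ y),
      Cc (fun x => J (H x)) & Cc (fun y => J (H^~ y))].
Proof.
move=> cH HN.
have cH1 x : continuous (H x).
  move=> y; apply: (cvg_comp (fun y => (x, y)) _ _ (cH (x, y))).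
  exact: continuous_pairl.
have cH2 y : continuous (H^~ y).
  move=> x; apply: (cvg_comp (fun x => (x, y)) _ _ (cH (x, y))).
  exact: continuous_pairr.
have s1 x : supp_le (H x) N by move=> y h; apply: HN; right.
have s2 y : supp_le (H^~ y) N by move=> x h; apply: HN; left.
split.
- by move=> x; split => //; exists N.
- by move=> y; split => //; exists N.
- split; last first.
    by exists N => x h; rewrite -[RHS](@J0 R n); apply: J_eq => y; apply: HN; left.
  move=> x; apply: (@J_cvg R n _ (nbhs x) H (H x) N (nbhs_filter x)) => //;
    first by apply: nearW => z; split.
  by move=> y; exact: (cH (x, y)).
- split; last first.
    by exists N => y h; rewrite -[RHS](@J0 R n); apply: J_eq => x; apply: HN; right.
  move=> y; apply: (@J_cvg R n _ (nbhs y) (fun y => H^~ y) (H^~ y) N (nbhs_filter y)) => //;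
    first by apply: nearW => z; split.
  move=> x; apply: (cvg_comp (fun z => (z.2, z.1)) _ _ (cH (x, y))).
  exact: (cvg_pair cvg_snd cvg_fst).
Qed.

(** A Riemann sum in x is a finite sum and commutes with [J] in y. The sums converge to the integral
    in x jointly in k and y, so [J_cvg] lets k tend to its limit under the outer integral. *)
Lemma J_Fubini (H : 'rV[R]_n -> 'rV[R]_n -> R) N :
  continuous (fun z => H z.1 z.2) ->
  (forall x y, N%:R < `|x| \/ N%:R < `|y| -> H x y = 0) ->
  J (fun x => J (H x)) = J (fun y => J (H^~ y)).
Proof.
move=> cH HN; have [C1 C2 C3 C4] := Cc_param cH HN.
have s2 y : supp_le (H^~ y) N by move=> x h; apply: HN; left.
have s3 : supp_le (fun x => J (H x)) N.
  by move=> x h; rewrite -[RHS](@J0 R n); apply: J_eq => y; apply: HN; left.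
have s4 : supp_le (fun y => J (H^~ y)) N.
  by move=> y h; rewrite -[RHS](@J0 R n); apply: J_eq => x; apply: HN; right.
have E k : riem (fun x => J (H x)) k = J (fun y => riem (H^~ y) k) /\
    Cc (fun y => riem (H^~ y) k).
  have eq_r : (fun y => riem (H^~ y) k) = (fun y => (latsum k (@unit_bump R n))^-1 *
       \sum_(z <- fset_set (@latbox R n N k)) H (lat k z) y).
    by apply/funext => y; rewrite /riem (latsumE k (s2 y)) mulrC.
  have [S1 S2] := J_sum (fset_set (@latbox R n N k)) (fun z => C1 (lat k z)).
  rewrite eq_r; split; last exact: CcZ.
  by rewrite JZ// S1 /riem (latsumE k s3) mulrC.
have h1 : J (fun y => riem (H^~ y) k) @[k --> nat_ultra] --> J (fun x => J (H x)).
  under eq_fun do rewrite -(proj1 (E _)).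
  exact: riem_cvg.
have h2 : J (fun y => riem (H^~ y) k) @[k --> nat_ultra] --> J (fun y => J (H^~ y)).
  apply: (@J_cvg R n _ _ _ _ N) => //; first by have [] := C4.
    apply: nearW => k; split; first by have [_ []] := E k.
    move=> y h; rewrite /riem (_ : latsum _ _ = 0) ?mul0r//.
    rewrite (latsumE k (s2 y)); apply: big1 => z _; apply: HN; by right.
  move=> y; apply/cvgrPdist_le => e e0.
  pose C := @grid_card R n N + 1.
  have C0 : 0 < C by rewrite ltr_wpDl.
  have eC : 0 < e / 2 / C by rewrite !divr_gt0.
  have := @unif_cvg R _ _ (nbhs y) (@cball R n N) (fun y x => H x y) (H^~ y)
    (nbhs_filter y) (@compact_cball R n N) (fun x _ => proj1 (C2 y) x) _ _ eC.
  have Hy x : cball N x -> H z.2 z.1 @[z --> (nbhs y, nbhs x)] --> H x y.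
    move=> _; apply: (cvg_comp (fun z => (z.2, z.1)) _ _ (cH (x, y))).
    exact: (cvg_pair cvg_snd cvg_fst).
  move=> /(_ Hy) ny.
  have nk : \forall k \near nat_ultra, `|J (H^~ y) - riem (H^~ y) k| <= e / 2.
    by have /cvgrPdist_le := riem_cvg (C2 y); apply; rewrite divr_gt0.
  exists ([set k | `|J (H^~ y) - riem (H^~ y) k| <= e / 2],
    [set y' | forall x, cball N x -> `|H x y' - H x y| < e / 2 / C]) => //.
  move=> [k y'] /= [hk hy]; rewrite (splitr e) -(subrK (riem (H^~ y) k) (J _)).
  rewrite -addrA; apply: (le_trans (ler_normD _ _)); apply: lerD => //.
  have -> : riem (H^~ y) k - riem (H^~ y') k =
     riem (fun x => H x y + (-1) * H x y') k.
    rewrite /riem (@latsumD _ _ N)//; last by move=> x h; rewrite s2// mulr0.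
    by rewrite latsumZ mulN1r mulrBl.
  apply: (@le_trans _ _ (e / 2 / C * @grid_card R n N)).
    apply: riem_bound => x; first by move=> h; rewrite !s2// mulr0 addr0.
    rewrite mulN1r distrC; have [xN|xN] := leP `|x| N%:R.
      by rewrite ltW// hy.
    by rewrite !s2// subrr normr0 ltW.
  by rewrite mulrAC ler_pdivrMr// ler_pM2l ?divr_gt0// lerDl.
exact: (cvg_unique _ h1 h2).
Qed.

Lemma Cc_scale F (e : R) : e != 0 -> Cc F -> Cc (fun x => F (e *: x)).
Proof.
move=> e0 CF; apply: (@Cc_comp F (fun x => e *: x)) => //.
  exact: scaler_continuous.
move=> N; have [N' hN'] := nat_ge (N%:R / `|e|).
exists N' => x h; rewrite normrZ -ltr_pdivrMl ?normr_gt0// mulrC.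
exact: le_lt_trans h.
Qed.

(** This is the uniqueness argument for invariant integrals: the double integral of F (e x)
    [unit_bump] (y - e x) is evaluated in both orders. The scaling factor is thereby identified by
    its value on [unit_bump]. *)
Lemma J_scale F (e : R) : e != 0 -> Cc F ->
  J (fun x => F (e *: x)) = J (fun x : 'rV[R]_n => unit_bump (e *: x)) * J F.
Proof.
move=> e0 CF; have Cu := @Cc_unit_bump R n.
have e_unit x y : e *: (x + e^-1 *: y) = e *: x + y.
  by rewrite scalerDr scalerA divff// scale1r.
have cF : continuous F by case: CF.
have cU : continuous (@unit_bump R n) := @unit_bump_continuous R n.
have [N FN] := proj2 CF; have [N' hN'] := nat_ge ((2 + N%:R) / `|e|).
have e_gt0 : 0 < `|e| by rewrite normr_gt0.
pose H1 x y := F (e *: x) * unit_bump (y - e *: x).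
pose H2 x y := F (e *: x + y) * unit_bump (e *: x).
have cex : continuous (fun z : 'rV[R]_n * 'rV[R]_n => e *: z.1).
  by move=> z; exact: (cvg_comp fst (fun x => e *: x) cvg_fst (scaler_continuous (x := z.1))).
have cH1 : continuous (fun z => H1 z.1 z.2).
  move=> z; apply: cvgM; first exact: (cvg_comp _ _ (cex z) (cF _)).
  exact: (cvg_comp _ _ (cvgB cvg_snd (cex z)) (cU _)).
have cH2 : continuous (fun z => H2 z.1 z.2).
  move=> z; apply: cvgM; last exact: (cvg_comp _ _ (cex z) (cU _)).
  exact: (cvg_comp _ _ (cvgD (cex z) cvg_snd) (cF _)).
have hx (x : 'rV[R]_n) : N'%:R < `|x| -> 2 + N%:R < `|e *: x|.
  by move=> h; rewrite normrZ mulrC -ltr_pdivrMr//; exact: le_lt_trans h.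
have N0 : 0 <= N%:R :> R by [].
have H1N x y : (N' + (2 + N))%:R < `|x| \/ (N' + (2 + N))%:R < `|y| -> H1 x y = 0.
  rewrite natrD (natrD _ 2) => h; rewrite /H1.
  have [h1|h1] := leP `|e *: x| N%:R; last by rewrite FN// mul0r.
  rewrite [unit_bump _]unit_bump_supp ?mulr0//.
  case: h => h; last by have := ler_distD 0 y (e *: x); rewrite subr0 sub0r normrN;
    have := ler_normD (y - e *: x) (e *: x); rewrite subrK; have : 0 <= N'%:R :> R by []; lra.
  suff: N'%:R < `|x| by move/hx; lra.
  lra.
have H2N x y : (N' + (2 + N))%:R < `|x| \/ (N' + (2 + N))%:R < `|y| -> H2 x y = 0.
  rewrite natrD (natrD _ 2) => h; rewrite /H2.
  have [h1|h1] := leP `|e *: x| 2; last by rewrite [unit_bump _]unit_bump_supp ?mulr0.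
  rewrite FN ?mul0r//.
  case: h => h; last by have := ler_normB (e *: x + y) (e *: x);
    rewrite addrAC subrr add0r; have : 0 <= N'%:R :> R by []; lra.
  suff: N'%:R < `|x| by move/hx; lra.
  lra.
have [_ C1 C1' C1''] := Cc_param cH1 H1N; have [_ C2 C2' C2''] := Cc_param cH2 H2N.
transitivity (J (fun x => J (H1 x))).
  apply: J_eq => x; rewrite /H1 JZ; last exact: Cc_shift.
  by rewrite J_shift// J_unit_bump mulr1.
rewrite (J_Fubini cH1 H1N) mulrC -(JZ (J F)); last exact: Cc_scale.
transitivity (J (fun x => J (H2 x))); last first.
  apply: J_eq => x; rewrite /H2; under eq_fun do rewrite addrC mulrC.
  by rewrite (JZ _ (Cc_shift (e *: x) CF)) (J_shift _ CF) mulrC.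
rewrite (J_Fubini cH2 H2N); apply: J_eq => y.
(* Translating x by e^-1 y turns e x into e x + y and moves y from the bump to F; [unit_bump] is
   even. *)
rewrite -(J_shift (e^-1 *: y) (C1 y)); apply: J_eq => x; rewrite /H1 /H2 e_unit.
have -> : y - (e *: x + y) = - (e *: x) by rewrite opprD addrCA subrr addr0.
by rewrite /unit_bump normrN.
Qed.

(** Scaling by e^-1 and then by e gives back [unit_bump], of integral 1, so the factor cannot be
    0. *)
Lemma J_scale_gt0 (e : R) : e != 0 -> 0 < J (fun x : 'rV[R]_n => unit_bump (e *: x)).
Proof.
move=> e0; have Cu := @Cc_unit_bump R n.
have Ce := Cc_scale e0 Cu.
rewrite lt_neqAle J_ge0 ?andbT//; last by move=> x; exact: unit_bump_ge0.
apply/eqP => E; have e0' : e^-1 != 0 by rewrite invr_eq0.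
have := J_scale e0 (Cc_scale e0' Cu).
rewrite -E mul0r; under eq_fun do rewrite scalerA mulVf// scale1r.
by rewrite J_unit_bump => /eqP; rewrite oner_eq0.
Qed.

(** Finitely many translates of a multiple of F dominate [unit_bump], whose integral is 1, and all
    translates have the same integral. *)
Lemma J_gt0 F x : Cc F -> (forall y, 0 <= F y) -> 0 < F x -> 0 < J F.
Proof.
move=> CF F0 Fx; have cF : continuous F by case: CF.
have : \forall y \near x, F x / 2 < F y.
  have /cvgrPdist_lt := cF x; move=> /(_ (F x / 2)); rewrite divr_gt0// => /(_ isT).
  by apply: filterS => y; rewrite ltr_norml => /andP[_]; lra.
move=> /nbhs_ballP [r /= r0 hr]; have [N hN] := nat_ge (2 / (r / 2)).
have r2 : 0 < r / 2 by rewrite divr_gt0.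
have hb y : `|y| <= r / 2 -> F x / 2 < F (x + y).
  move=> h; apply: hr; rewrite -ball_normE /= opprD addrA subrr sub0r normrN; lra.
(* [unit_bump] is at most 2 and F exceeds F x / 2 on the ball of radius r / 2 around x, whence the
   factor 4 / F x. *)
pose G (t : 'rV['I_(2 * N).+1]_n) y := 4 / F x * F (y + (x - (r / 2) *: grid t)).
have CG t : Cc (G t) by apply: CcZ; exact: Cc_shift.
have [S1 S2] := J_sum (index_enum _) CG.
have G0 t y : 0 <= G t y by rewrite mulr_ge0// divr_ge0// ltW.
have : J (@unit_bump R n) <= J (fun y => \sum_t G t y).
  apply: J_le => //; first exact: Cc_unit_bump.
  move=> y; have [hy|hy] := leP `|y| 2; last first.
    by rewrite unit_bump_supp//; exact: sumr_ge0.
  have [|t ht] := @grid_cover R n (r / 2) N y r2; first by apply: (le_trans hy); rewrite -ler_pdivrMr.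
  rewrite (bigD1 t)//=; apply: ler_wpDr; first exact: sumr_ge0.
  apply: (@le_trans _ _ 2); first by rewrite /unit_bump ge_max; have := normr_ge0 y; lra.
  have := hb _ ht; rewrite /G addrCA => h.
  rewrite mulrAC ler_pdivlMr//; lra.
rewrite J_unit_bump S1 (eq_bigr (fun=> 4 / F x * J F)); last first.
  by move=> t _; rewrite /G (JZ _ (Cc_shift _ CF)) (J_shift _ CF).
rewrite sumr_const; have [J0|] := leP (J F) 0; last by [].
rewrite (_ : J F = 0) ?mulr0 ?mul0rn ?ler10//.
by apply/eqP; rewrite eq_le J0 J_ge0.
Qed.

End Integral_properties.

(** * Differential calculus *)

Lemma cvg_sumR (R : realType) (I T : Type) (FT : set_system T) (r : seq I)
    (f : I -> T -> R) (l : I -> R) : Filter FT ->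
  (forall i, f i t @[t --> FT] --> l i) ->
  \sum_(i <- r) f i t @[t --> FT] --> \sum_(i <- r) l i.
Proof.
move=> FF fl; elim: r => [|i r IH].
  by rewrite big_nil; under eq_fun do rewrite big_nil; exact: cvg_cst.
rewrite big_cons; under eq_fun do rewrite big_cons.
exact: (cvgD (fl i) IH).
Qed.

Section Differential_calculus.
Context {R : realType} {n : nat}.
Implicit Types (F G : 'rV[R]_n -> R) (x y v : 'rV[R]_n) (V : set 'rV[R]_n).

Lemma is_derive_line F y v (t : R) : derivable F (y + t *: v) v ->
  is_derive t 1 (fun s : R => F (y + s *: v)) ('D_v F (y + t *: v)).
Proof.
have E : (fun h : R => h^-1 *: (((fun s : R => F (y + s *: v)) \o shift t) (h *: 1)
            - F (y + t *: v))) =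
         (fun h => h^-1 *: ((F \o shift (y + t *: v)) (h *: v) - F (y + t *: v))).
  apply/funext => h /=; congr (_ *: (F _ - _)).
  by rewrite [h *: 1]mulr1 scalerDl addrCA.
by move=> d; split; rewrite /derivable /derive E.
Qed.

Lemma MVT_line F y v (h : R) :
  (forall t, `|t| <= `|h| -> derivable F (y + t *: v) v) ->
  exists2 c, `|c| <= `|h| & F (y + h *: v) - F y = 'D_v F (y + c *: v) * h.
Proof.
move=> dF; pose g s := F (y + s *: v).
have dg (t : R) : `|t| <= `|h| -> is_derive t 1 g ('D_v F (y + t *: v)).
  by move=> th; apply: is_derive_line; exact: dF.
have [h0|h0] := leP 0 h.
  have hh t : t \in `[0, h] -> `|t| <= `|h|.
    by rewrite in_itv /= => /andP[t0 th]; rewrite !ger0_norm.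
  have cg : {within `[0, h], continuous g}.
    by apply: derivable_within_continuous => t /hh /dg [].
  have dgo (t : R) : t \in `]0, h[ -> is_derive t 1 g ('D_v F (y + t *: v)).
    by move=> th; apply: dg; apply: hh; exact: subset_itv_oo_cc.
  have [c ch] := MVT_segment h0 dgo cg.
  by rewrite /g subr0 scale0r addr0 => ->; exists c => //; exact: hh.
have hh t : t \in `[h, 0] -> `|t| <= `|h|.
  by rewrite in_itv /= => /andP[t0 th]; rewrite !ler0_norm ?lerN2// ltW.
have cg : {within `[h, 0], continuous g}.
  by apply: derivable_within_continuous => t /hh /dg [].
have dgo (t : R) : t \in `]h, 0[ -> is_derive t 1 g ('D_v F (y + t *: v)).
  by move=> th; apply: dg; apply: hh; exact: subset_itv_oo_cc.
have [c ch] := MVT_segment (ltW h0) dgo cg.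
rewrite /g sub0r scale0r addr0 => E; exists c; first exact: hh.
by rewrite -opprB E mulrN opprK.
Qed.

(** The base point moves together with the increment because [J_cvg] asks for a joint limit; the
    mean value theorem supplies it. *)
Lemma cvg_quotient F x v : (\forall y \near x, derivable F y v) ->
  {for x, continuous ('D_v F)} ->
  z.1^-1 * (F (z.2 + z.1 *: v) - F z.2) @[z --> ((0 : R)^', nbhs x)] --> 'D_v F x.
Proof.
move=> dF cF; apply/cvgrPdist_le => e e0.
have /cvgrPdist_le/(_ _ e0) cFe := cF.
have [r /= r0 hr] := (nbhs_ballP _ _).1 (filterI dF cFe).
pose d := r / 2 / (`|v| + 1).
have v1 : 0 < `|v| + 1 by rewrite ltr_wpDl.
have d0 : 0 < d by rewrite !divr_gt0.
exists ([set h | h != 0 /\ `|h| < d], ball x (r / 2)) => /=.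
  split; last by apply: nbhsx_ballx; rewrite divr_gt0.
  by exists d => // h /=; rewrite sub0r normrN => hd hn; split.
move=> [h y] /= [[hn hd] yx].
have inb t : `|t| <= `|h| -> ball x r (y + t *: v).
  move=> th; rewrite (splitr r); apply: (ball_triangle yx).
  rewrite -ball_normE /= opprD addrA subrr sub0r normrN normrZ.
  apply: (@le_lt_trans _ _ (`|h| * (`|v| + 1))).
    by apply: ler_pM => //; rewrite lerDl.
  by rewrite -ltr_pdivlMr.
have [|c ch ->] := @MVT_line F y v h; first by move=> t /inb /hr [].
by rewrite mulrC mulfK//; have [] := hr _ (inb c ch).
Qed.

Definition partials_near F x := (\forall y \near x, forall a, derivable F y (basis_vec a)) /\
  forall a, {for x, continuous ('D_(basis_vec a) F)}.

Definition hybrid x y (k : nat) : 'rV[R]_n :=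
  \row_a (if (a < k)%N then y ord0 a else x ord0 a).

(** The points [hybrid x y k] lead from x to y by changing one coordinate at a time, and the mean
    value theorem applies on each piece. Both ends are free to move, as the chain rule below and the
    Lipschitz bounds require. *)
Lemma strict_differentiable F p : partials_near F p ->
  forall e : R, 0 < e -> \forall z \near (p, p),
    `|F z.2 - F z.1 - \sum_a 'D_(basis_vec a) F p * (z.2 - z.1) ord0 a|
      <= e * `|z.2 - z.1|.
Proof.
move=> [dF cF] e e0; pose e' := e / n.+1%:R.
have e'0 : 0 < e' by rewrite divr_gt0.
have cFe : \forall y \near p, forall a : 'I_n,
    `|'D_(basis_vec a) F p - 'D_(basis_vec a) F y| <= e'.
  apply: (@filter_forall _ _ (fun a y =>
    `|'D_(basis_vec a) F p - 'D_(basis_vec a) F y| <= e') _ (nbhs_filter p)) => a.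
  by have /cvgrPdist_le/(_ _ e'0) := cF a.
have [r /= r0 hr] := (nbhs_ballP _ _).1 (filterI dF cFe).
have r3 : 0 < r / 4 by rewrite divr_gt0.
exists (ball p (r / 4), ball p (r / 4)) => /=; first by split; exact: nbhsx_ballx.
move=> [x y] /= [px py].
have xy : `|y - x| < r / 2.
  have := ball_triangle (ball_sym px) py; rewrite -ball_normE /= distrC.
  by rewrite (_ : r / 4 + r / 4 = r / 2)//; lra.
have inb (k : 'I_n) t : `|t| <= `|y ord0 k - x ord0 k| ->
    ball p r (hybrid x y k + t *: basis_vec k).
  move=> ht; rewrite -ball_normE /=; apply: (@le_lt_trans _ _ (r / 4 + r / 2)); last by lra.
  apply: norm_le_coord => [|a]; first by lra.
  have yxa := coord_le_norm (y - x) a; rewrite !mxE in yxa.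
  have pxa := coord_le_norm (p - x) a; rewrite !mxE in pxa.
  have pya := coord_le_norm (p - y) a; rewrite !mxE in pya.
  rewrite -ball_normE /= in px py.
  rewrite !mxE eqxx /=; have [->|ak] := eqVneq a k.
    rewrite ltnn mulr1; have yxk := coord_le_norm (y - x) k; rewrite !mxE in yxk.
    have pxk := coord_le_norm (p - x) k; rewrite !mxE in pxk.
    by rewrite opprD addrA; apply: (le_trans (ler_normB _ _)); lra.
  rewrite mulr0 addr0; case: ifP => _; lra.
have E (k : 'I_n) : hybrid x y k.+1 = hybrid x y k + (y ord0 k - x ord0 k) *: basis_vec k.
  apply/rowP => a; rewrite !mxE eqxx /= ltnS leq_eqVlt.
  have [->|ak] := eqVneq a k; first by rewrite eqxx ltnn mulr1 addrC subrK.
  by rewrite (_ : (a == k :> nat) = false) ?mulr0 ?addr0//; exact: negbTE.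
have FE : F y - F x = \sum_(k < n) (F (hybrid x y k.+1) - F (hybrid x y k)).
  rewrite -(big_mkord xpredT (fun k => F (hybrid x y k.+1) - F (hybrid x y k))).
  rewrite telescope_sumr//; congr (F _ - F _); apply/rowP => a; rewrite !mxE//.
  by rewrite ltn_ord.
rewrite FE -sumrB; apply: (le_trans (ler_norm_sum _ _ _)).
apply: (@le_trans _ _ (\sum_(k < n) e' * `|y - x|)).
  apply: ler_sum => k _; rewrite E.
  have [t ht|c ch ->] := @MVT_line F (hybrid x y k) (basis_vec k) (y ord0 k - x ord0 k).
    by have [h _] := hr _ (inb k t ht); exact: h.
  rewrite !mxE -mulrBl normrM distrC.
  have [_ h] := hr _ (inb k c ch); apply: ler_pM => //.
  by have := coord_le_norm (y - x) k; rewrite !mxE.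
rewrite sumr_const card_ord -mulr_natr mulrAC ler_wpM2r//.
by rewrite /e' -mulrA ler_piMr ?(ltW e0)// mulrC ler_pdivrMr// mul1r ler_nat.
Qed.

(** The filter, the scale h and both curves are arbitrary, so that one chain rule serves one-sided
    derivatives along transition maps, directional derivatives and the blow-up of the mollifying
    kernel. *)
Lemma cvg_chain F p (T : Type) (FT : set_system T) (h : T -> R)
    (c1 c2 : T -> 'rV[R]_n) (d : 'I_n -> R) :
  forall FF : Filter FT, partials_near F p ->
  c1 @ FT --> p -> c2 @ FT --> p ->
  (forall a, (h t)^-1 * (c2 t ord0 a - c1 t ord0 a) @[t --> FT] --> d a) ->
  (h t)^-1 * (F (c2 t) - F (c1 t)) @[t --> FT] -->
    \sum_a 'D_(basis_vec a) F p * d a.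
Proof.
move=> FF pF c1p c2p cd.
pose L (w : 'rV[R]_n) := \sum_a 'D_(basis_vec a) F p * w ord0 a.
pose S t := \sum_a 'D_(basis_vec a) F p * ((h t)^-1 * (c2 t ord0 a - c1 t ord0 a)).
have cS : S t @[t --> FT] --> \sum_a 'D_(basis_vec a) F p * d a.
  by apply: cvg_sumR => a; apply: cvgMr.
pose C := \sum_a `|d a| + 1.
have C1 : 0 < C by rewrite ltr_wpDl// sumr_ge0.
have nC : \forall t \near FT, forall a, `|(h t)^-1 * (c2 t ord0 a - c1 t ord0 a)| <= C.
  apply: (@filter_forall _ _ (fun a t =>
    `|(h t)^-1 * (c2 t ord0 a - c1 t ord0 a)| <= C)) => a.
  have /cvgrPdist_le/(_ 1 ltr01) := cd a; apply: filterS => t ht.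
  apply: (@le_trans _ _ (`|d a| + 1)).
    rewrite -[X in `|X|](subrK (d a)) addrC; apply: (le_trans (ler_normD _ _)).
    by rewrite lerD2l distrC.
  by rewrite /C lerD2r (bigD1 a)//= lerDl sumr_ge0.
apply/cvgrPdist_le => e e0.
have eC : 0 < e / 2 / C by rewrite !divr_gt0.
have SD := strict_differentiable pF eC.
have n1 : \forall t \near FT, `|F (c2 t) - F (c1 t) -
    \sum_a 'D_(basis_vec a) F p * (c2 t - c1 t) ord0 a| <= e / 2 / C * `|c2 t - c1 t|.
  exact: (cvg_pair c1p c2p SD).
have /cvgrPdist_le/(_ (e / 2)) := cS; rewrite divr_gt0// => /(_ isT) n2.
apply: filterS3 nC n1 n2 => t h1 h2 h3.
rewrite (splitr e) -(subrK (S t) (\sum_a _)) -addrA.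
apply: (le_trans (ler_normD _ _)); apply: lerD => //.
have -> : S t = (h t)^-1 * \sum_a 'D_(basis_vec a) F p * (c2 t - c1 t) ord0 a.
  by rewrite mulr_sumr; apply: eq_bigr => a _; rewrite !mxE mulrCA.
rewrite -mulrBr normrM distrC; apply: (le_trans (ler_wpM2l _ h2)) => //.
rewrite mulrCA -normrZ -[X in _ <= X](divfK (lt0r_neq0 C1)) ler_wpM2l ?(ltW eC)//.
by apply: norm_le_coord => [|a]; [exact: ltW C1|have := h1 a; rewrite !mxE].
Qed.

Lemma is_derive_quotient F x v (l : R) :
  h^-1 * (F (x + h *: v) - F x) @[h --> (0 : R)^'] --> l ->
  derivable F x v /\ 'D_v F x = l.
Proof.
move=> H.
have E : (fun h : R => h^-1 *: ((F \o shift x) (h *: v) - F x)) =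
    (fun h => h^-1 * (F (x + h *: v) - F x)).
  by apply/funext => h /=; congr (_ * (F _ - _)); rewrite addrC.
split; first by rewrite /derivable E; apply/cvg_ex; exists l.
by rewrite /derive E; apply: cvg_lim.
Qed.

Lemma derive_quotient F x v : derivable F x v ->
  h^-1 * (F (x + h *: v) - F x) @[h --> (0 : R)^'] --> 'D_v F x.
Proof.
rewrite /derivable /derive.
have -> : (fun h : R => h^-1 *: ((F \o shift x) (h *: v) - F x)) =
    (fun h => h^-1 * (F (x + h *: v) - F x)).
  by apply/funext => h /=; congr (_ * (F _ - _)); rewrite addrC.
by [].
Qed.

Lemma partials_continuous F x : partials_near F x -> {for x, continuous F}.
Proof.
move=> pF; pose C := \sum_a `|'D_(basis_vec a) F x| + 1.
have C1 : 0 < C by rewrite ltr_wpDl// sumr_ge0.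
apply/(@cvgrPdist_le _ _ _ (nbhs x) (nbhs_filter x)) => e e0.
have [[A B] /= [xA xB] AB] := strict_differentiable pF ltr01.
have eC : 0 < e / (C + 1) by rewrite divr_gt0// ltr_wpDl// ltW.
apply: filterS2 xB (nbhsx_ballx x _ eC) => y By xy.
have := AB (x, y) (conj (nbhs_singleton xA) By); rewrite /= mul1r => H.
rewrite distrC -(subrK (\sum_a 'D_(basis_vec a) F x * (y - x) ord0 a) (F y - F x)).
apply: (le_trans (ler_normD _ _)); apply: (@le_trans _ _ (`|y - x| + (C - 1) * `|y - x|)).
  apply: lerD => //; apply: (le_trans (ler_norm_sum _ _ _)).
  rewrite /C addrK mulr_suml; apply: ler_sum => a _; rewrite normrM ler_wpM2l//.
  exact: coord_le_norm.
rewrite -ball_normE /= distrC in xy.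
have : `|y - x| * (C + 1) < e by rewrite -ltr_pdivlMr// ltr_wpDl// ltW.
have := normr_ge0 (y - x); nra.
Qed.

End Differential_calculus.

(** * Functions of class C^k on open sets, and smooth functions up to the wall *)

Section Smooth_functions.
Context {R : realType} {n : nat}.
Implicit Types (F G : 'rV[R]_n -> R) (x y v : 'rV[R]_n) (V A : set 'rV[R]_n).
Implicit Types (a b : 'I_n) (k : nat).
Local Notation E := (@basis_vec R n).

Lemma Ck_sub k V V' F : V' `<=` V -> Ck k V F -> Ck k V' F.
Proof.
elim: k F => [|k IH] F VV' /=; first by move=> cF x /VV'; exact: cF.
by move=> cF a; have [dF CF] := cF a; split; [move=> x /VV'; exact: dF|exact: IH].
Qed.

Lemma Ck_local k V F :
  (forall x, V x -> exists2 V', V' x & Ck k V' F) -> Ck k V F.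
Proof.
elim: k F => [|k IH] F h /=; first by move=> x /h[V' V'x]; exact.
move=> a; split; first by move=> x /h[V' V'x] /(_ a)[+ _]; exact.
by apply: IH => x /h[V' V'x] /(_ a)[_ CF]; exists V'.
Qed.

Lemma Ck_ext k V F G : open V -> (forall x, V x -> F x = G x) ->
  Ck k V F -> Ck k V G.
Proof.
move=> oV; elim: k F G => [|k IH] F G FG /=.
  move=> cF x Vx; change (G y @[y --> x] --> G x); rewrite -(FG x Vx).
  move=> B /(cF x Vx) hB; have nV := open_nbhs_nbhs (conj oV Vx).
  apply: (@filterS2 _ (nbhs x) (nbhs_filter x) _ _ _ _ hB nV) => y By Vy.
  by rewrite /preimage /= -(FG y Vy).
move=> cF a; have [dF CF] := cF a.
have nFG x : V x -> {near x, F =1 G}.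
  by move=> Vx; have := open_nbhs_nbhs (conj oV Vx); apply: filterS => y /FG.
split; first by move=> x Vx; apply: near_eq_derivable (nFG x Vx) (dF x Vx).
by apply: IH CF => x Vx; apply: near_eq_derive (nFG x Vx).
Qed.

Lemma Ck1_partials V F x : open V -> Ck 1 V F -> V x -> partials_near F x.
Proof.
move=> oV cF Vx; split; last by move=> a; have [_ ] := cF a; exact.
have := open_nbhs_nbhs (conj oV Vx); apply: filterS => y Vy a.
by have [dF _] := cF a; exact: dF.
Qed.

(** For k = 0 this has content: [Ck 1] speaks only of the partial derivatives, and the continuity of
    F comes from [strict_differentiable]. *)
Lemma CkS k V F : open V -> Ck k.+1 V F -> Ck k V F.
Proof.
move=> oV; elim: k F => [|k IH] F.
  by move=> cF x Vx; exact/partials_continuous/(Ck1_partials oV cF Vx).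
by move=> cF a; have [dF CF] := cF a; split => //; exact: IH.
Qed.

Lemma Ck_cst k V (c : R) : open V -> Ck k V (fun=> c).
Proof.
move=> oV; elim: k c => [|k IH] c /=; first by move=> x _; exact: cst_continuous.
move=> a; split; first by move=> x _; exact: derivable_cst.
by apply: (Ck_ext oV _ (IH 0)) => x _; rewrite derive_cst.
Qed.

Lemma CkD k V F G : open V -> Ck k V F -> Ck k V G -> Ck k V (fun x => F x + G x).
Proof.
move=> oV; elim: k F G => [|k IH] F G /=.
  by move=> cF cG x Vx; exact: (@continuousD R R^o _ F G x (cF x Vx) (cG x Vx)).
move=> cF cG a; have [dF CF] := cF a; have [dG CG] := cG a.
split; first by move=> x Vx; exact: derivableD (dF x Vx) (dG x Vx).
apply: (Ck_ext oV _ (IH _ _ CF CG)) => x Vx.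
exact: (esym (deriveD (dF x Vx) (dG x Vx))).
Qed.

Lemma derive_mulE F G x v : derivable F x v -> derivable G x v ->
  derivable (fun y => F y * G y) x v /\
  'D_v (fun y => F y * G y) x = F x * 'D_v G x + 'D_v F x * G x.
Proof.
move=> dF dG; split; first exact: derivableM dF dG.
by rewrite (_ : (fun _ => _) = F * G)// deriveM// [X in _ + X]mulrC.
Qed.

Lemma CkM k V F G : open V -> Ck k V F -> Ck k V G -> Ck k V (fun x => F x * G x).
Proof.
move=> oV; elim: k F G => [|k IH] F G.
  by move=> cF cG x Vx; exact: (continuousM (cF x Vx) (cG x Vx)).
move=> cF cG a; have [dF CF] := cF a; have [dG CG] := cG a.
have cF' := CkS oV cF; have cG' := CkS oV cG.
split; first by move=> x Vx; exact: (derive_mulE (dF x Vx) (dG x Vx)).1.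
apply: (Ck_ext oV _ (CkD oV (IH _ _ cF' CG) (IH _ _ CF cG'))) => x Vx.
by rewrite (derive_mulE (dF x Vx) (dG x Vx)).2.
Qed.

Lemma CkN k V F : open V -> Ck k V F -> Ck k V (fun x => - F x).
Proof.
move=> oV cF; apply: (Ck_ext oV _ (CkM oV (Ck_cst k (-1) oV) cF)) => x _.
by rewrite mulN1r.
Qed.

Lemma CkB k V F G : open V -> Ck k V F -> Ck k V G -> Ck k V (fun x => F x - G x).
Proof. by move=> oV cF cG; exact: (CkD oV cF (CkN oV cG)). Qed.

Lemma CkV k V F : open V -> (forall x, V x -> F x != 0) -> Ck k V F ->
  Ck k V (fun x => (F x)^-1).
Proof.
move=> oV F0; elim: k => [|k IH].
  by move=> cF x Vx; exact: (cvgV (F0 x Vx) (cF x Vx)).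
move=> cF a; have [dF CF] := cF a; have cV := IH (CkS oV cF).
split; first by move=> x Vx; apply: derivableV; [exact: F0|exact: dF].
apply: (Ck_ext oV _ (CkN oV (CkM oV (CkM oV cV cV) CF))) => x Vx.
by rewrite (deriveV (F0 x Vx) (dF x Vx)) -invfM -expr2 -mulNr.
Qed.

Lemma Ck_sum k V (I : Type) (r : seq I) (H : I -> 'rV[R]_n -> R) : open V ->
  (forall i, Ck k V (H i)) -> Ck k V (fun x => \sum_(i <- r) H i x).
Proof.
move=> oV CH; elim: r => [|i r IH].
  by apply: (Ck_ext oV _ (Ck_cst k 0 oV)) => x _; rewrite big_nil.
by apply: (Ck_ext oV _ (CkD oV (CH i) IH)) => x _; rewrite big_cons.
Qed.

Lemma derive_coord a b x : derivable (fun y : 'rV[R]_n => y ord0 b) x (E a) /\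
  'D_(E a) (fun y : 'rV[R]_n => y ord0 b) x = (a == b)%:R.
Proof.
apply: is_derive_quotient.
apply: (@cvg_trans _ ((fun=> (a == b)%:R : R) @ (0 : R)^')); last exact: cvg_cst.
apply: near_eq_cvg; apply: filterS (nbhs_dnbhs_neq (0 : R)) => h h0.
by rewrite !mxE eqxx /= addrAC subrr add0r eq_sym mulKf.
Qed.

Lemma Ck_coord k V b : open V -> Ck k V (fun y : 'rV[R]_n => y ord0 b).
Proof.
move=> oV; elim: k => [|k _]; first by move=> x _; exact: coord_continuous.
move=> a; split; first by move=> x _; exact: (derive_coord a b x).1.
apply: (Ck_ext oV _ (Ck_cst k ((a == b)%:R) oV)) => x _.
by rewrite (derive_coord a b x).2.
Qed.

(** [pd] is a bare [lim] that says nothing about existence; the rules of calculus are proved for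
    this relation and read back with [has_pdE]. *)
Definition has_pd a F x (l : R) :=
  h^-1 * (F (x + h *: E a) - F x) @[h --> 0^'+] --> l.

Lemma has_pdE a F x l : has_pd a F x l -> pd a F x = l.
Proof. by move=> h; apply: cvg_lim. Qed.

Lemma derivable_has_pd a F x : derivable F x (E a) -> has_pd a F x ('D_(E a) F x).
Proof. by move=> /derive_quotient /cvg_dnbhs_at_right. Qed.

Lemma has_pd_ext a F G x l : F x = G x ->
  (\forall h \near 0^'+, F (x + h *: E a) = G (x + h *: E a)) ->
  has_pd a F x l -> has_pd a G x l.
Proof.
move=> Fx FG; apply: cvg_trans; apply: near_eq_cvg; apply: filterS FG => h.
by rewrite Fx => ->.
Qed.

Lemma has_pd_cst a c x : has_pd a (fun=> c) x 0.
Proof.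
rewrite /has_pd; under eq_fun do rewrite subrr mulr0; exact: cvg_cst.
Qed.

Lemma has_pdD a F G x l m : has_pd a F x l -> has_pd a G x m ->
  has_pd a (fun y => F y + G y) x (l + m).
Proof.
move=> hF hG; rewrite /has_pd.
under eq_fun do rewrite opprD addrACA mulrDr; exact: (cvgD hF hG).
Qed.

Lemma has_pd_right_continuous a F x l : has_pd a F x l ->
  F (x + h *: E a) @[h --> 0^'+] --> F x.
Proof.
move=> hF; have h0 : (h : R) @[h --> 0^'+] --> (0 : R).
  by apply: cvg_dnbhs_at_right; exact: cvg_within.
rewrite -[X in _ --> X]add0r -[X in _ --> X + _](mul0r l).
apply: (@cvg_trans _ (h * (h^-1 * (F (x + h *: E a) - F x)) + F x @[h --> 0^'+])).
  apply: near_eq_cvg; apply: filterS (nbhs_right_gt (0 : R)) => h h_gt0.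
  by rewrite mulrA mulfV ?gt_eqF// mul1r subrK.
exact: (cvgD (cvgM h0 hF) (cvg_cst _)).
Qed.

Lemma has_pdM a F G x l m : has_pd a F x l -> has_pd a G x m ->
  has_pd a (fun y => F y * G y) x (F x * m + l * G x).
Proof.
move=> hF hG; rewrite /has_pd.
have -> : (fun h : R => h^-1 * (F (x + h *: E a) * G (x + h *: E a) - F x * G x)) =
  (fun h => F (x + h *: E a) * (h^-1 * (G (x + h *: E a) - G x)) +
      h^-1 * (F (x + h *: E a) - F x) * G x).
  by apply/funext => h; ring.
exact: (cvgD (cvgM (has_pd_right_continuous hF) hG) (cvgM hF (cvg_cst _))).
Qed.

Lemma has_pdZ a c F x l : has_pd a F x l -> has_pd a (fun y => c * F y) x (c * l).
Proof. by move=> h; have := has_pdM (has_pd_cst a c x) h; rewrite mul0r addr0. Qed.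

Lemma has_pd_sum a (I : Type) (r : seq I) (H : I -> 'rV[R]_n -> R) x (l : I -> R) :
  (forall i, has_pd a (H i) x (l i)) ->
  has_pd a (fun y => \sum_(i <- r) H i y) x (\sum_(i <- r) l i).
Proof.
move=> hH; rewrite /has_pd.
under eq_fun do rewrite -sumrB mulr_sumr; exact: cvg_sumR.
Qed.

Definition relopen A := exists2 V, open V & A = V `&` half_space.

(** The points off the wall: there a relatively open set is a neighbourhood in R^n, and [pd] agrees
    with the two-sided derivative. *)
Definition inner A : set 'rV[R]_n :=
  [set x | A x /\ forall a, a = 0%N :> nat -> 0 < x ord0 a].

Lemma open_inner A : relopen A -> open (inner A).
Proof.
move=> [V oV ->].
have -> : inner (V `&` half_space) =
    V `&` [set x | forall a, a = 0%N :> nat -> 0 < x ord0 a].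
  apply/seteqP; split => x /= [].
    by move=> [].
  by move=> Vx x0; split => //; split => // a a0; exact/ltW/x0.
apply: openI => //.
rewrite openE => x /= x0.
apply: (@filter_forall _ _ (fun a (y : 'rV[R]_n) => a = 0%N :> nat -> 0 < y ord0 a)
  _ (nbhs_filter x)) => a.
have [a0|a0] := eqVneq (a : nat) 0%N; last by apply: nearW => y /eqP; rewrite (negbTE a0).
have /cvgrPdist_lt/(_ _ (x0 a a0)) := @coord_continuous R 1 n ord0 a x.
by apply: filterS => y; rewrite ltr_norml => /andP[_ h] _; move: h; lra.
Qed.

Lemma half_space_shift x a (h : R) : half_space x -> 0 <= h ->
  half_space (x + h *: E a).
Proof.
move=> hx h0 b b0; rewrite !mxE addr_ge0//; first exact: hx.
by rewrite mulr_ge0//; case: (_ && _).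
Qed.

Lemma shift_cvg0 x v : x + h *: v @[h --> (0 : R)^'+] --> x.
Proof.
have h0 : (h : R) @[h --> 0^'+] --> (0 : R).
  by apply: cvg_dnbhs_at_right; exact: cvg_within.
rewrite -[X in _ --> X]addr0 -(scale0r v).
exact: (cvgD (cvg_cst x) (cvgZr_tmp h0)).
Qed.

Lemma relopen_shift A x a : relopen A -> A x -> \forall h \near 0^'+, A (x + h *: E a).
Proof.
move=> [V oV ->] [Vx hx].
have := @shift_cvg0 x (E a) _ (open_nbhs_nbhs (conj oV Vx)).
move=> /= nV; near=> h; split; first by near: h.
by apply: half_space_shift => //; apply: ltW; near: h; exact: nbhs_right_gt.
Unshelve. all: by end_near. Qed.

Lemma smooth_has_pd A F V G x a : relopen A -> A x -> open V -> V x ->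
  Ck 1 V G -> (forall y, V y -> A y -> F y = G y) ->
  has_pd a F x ('D_(E a) G x).
Proof.
move=> rA Ax oV Vx CG FG.
have nV : \forall h \near 0^'+, V (x + h *: E a) := @shift_cvg0 x (E a) _ (open_nbhs_nbhs (conj oV Vx)).
apply: (@has_pd_ext a G F); first by rewrite FG.
  have nA := relopen_shift a rA Ax.
  by apply: filterS2 nV nA => h h1 h2; rewrite FG.
by apply: derivable_has_pd; have [dG _] := CG a; exact: dG.
Qed.

Lemma smooth_pd A F x a : relopen A -> smooth_within A F -> A x ->
  has_pd a F x (pd a F x).
Proof.
move=> rA sF Ax; have [V [G [oV Vx CG FG]]] := sF x Ax.
have h := @smooth_has_pd _ _ _ _ _ a rA Ax oV Vx (CG 1%N) FG.
by rewrite (has_pdE h).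
Qed.

Lemma smooth_within_pd A F a : relopen A -> smooth_within A F ->
  smooth_within A (pd a F).
Proof.
move=> rA sF x Ax; have [V [G [oV Vx CG FG]]] := sF x Ax.
exists V, ('D_(E a) G); split => //.
  by move=> k; have [_ ] := CG k.+1 a.
move=> y Vy Ay; apply: has_pdE; exact: (@smooth_has_pd A F V G y a rA Ay oV Vy (CG 1%N) FG).
Qed.

Lemma smooth_inner_Ck A F k : relopen A -> smooth_within A F -> Ck k (inner A) F.
Proof.
move=> rA sF; apply: Ck_local => x [Ax x0]; have [V [G [oV Vx CG FG]]] := sF x Ax.
have oVA := openI oV (open_inner rA).
exists (V `&` inner A); first by split.
apply: (Ck_ext oVA _ (Ck_sub _ (CG k))) => [y [Vy [Ay _]]|y []//].
by rewrite FG.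
Qed.

Lemma pd_inner A F x a : relopen A -> Ck 1 (inner A) F -> inner A x ->
  pd a F x = 'D_(E a) F x.
Proof.
by move=> rA CF Ax; apply/has_pdE/derivable_has_pd; have [dF _] := CF a; exact: dF.
Qed.

Lemma smooth_within_cvg A F x : smooth_within A F -> A x ->
  F y @[y --> within A (nbhs x)] --> F x.
Proof.
move=> sF Ax; have [V [G [oV Vx CG FG]]] := sF x Ax.
have cG : {for x, continuous G} by exact: (CG 0%N).
rewrite FG//; apply: (@cvg_trans _ (G y @[y --> within A (nbhs x)])); last first.
  exact: cvg_within_filter.
apply: near_eq_cvg; rewrite !near_withinE.
by have := open_nbhs_nbhs (conj oV Vx); apply: filterS => y Vy Ay; rewrite FG.
Qed.

Lemma smooth_within_ext A F G : (forall x, A x -> F x = G x) ->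
  smooth_within A F -> smooth_within A G.
Proof.
move=> FG sF x Ax; have [V [H [oV Vx CH FH]]] := sF x Ax.
by exists V, H; split => // y Vy Ay; rewrite -FG// FH.
Qed.

Lemma smooth_within_cst A (c : R) : smooth_within A (fun=> c).
Proof.
move=> x Ax; exists setT, (fun=> c); split => //; first exact: openT.
by move=> k; exact/Ck_cst/openT.
Qed.

Lemma smooth_withinD A F G : smooth_within A F -> smooth_within A G ->
  smooth_within A (fun x => F x + G x).
Proof.
move=> sF sG x Ax; have [V [H [oV Vx CH FH]]] := sF x Ax.
have [W [K [oW Wx CK GK]]] := sG x Ax; have oVW := openI oV oW.
exists (V `&` W), (fun x => H x + K x); split => //.
  by move=> k; apply: CkD => //; [apply: Ck_sub (CH k)|apply: Ck_sub (CK k)] => y [].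
by move=> y [Vy Wy] Ay; rewrite FH// GK.
Qed.

Lemma smooth_withinM A F G : smooth_within A F -> smooth_within A G ->
  smooth_within A (fun x => F x * G x).
Proof.
move=> sF sG x Ax; have [V [H [oV Vx CH FH]]] := sF x Ax.
have [W [K [oW Wx CK GK]]] := sG x Ax; have oVW := openI oV oW.
exists (V `&` W), (fun x => H x * K x); split => //.
  by move=> k; apply: CkM => //; [apply: Ck_sub (CH k)|apply: Ck_sub (CK k)] => y [].
by move=> y [Vy Wy] Ay; rewrite FH// GK.
Qed.

Lemma smooth_withinN A F : smooth_within A F -> smooth_within A (fun x => - F x).
Proof.
move=> sF; apply: (smooth_within_ext _ (smooth_withinM (@smooth_within_cst A (-1)) sF)).
by move=> x _; rewrite mulN1r.
Qed.

Lemma smooth_withinB A F G : smooth_within A F -> smooth_within A G ->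
  smooth_within A (fun x => F x - G x).
Proof. by move=> sF sG; exact: (smooth_withinD sF (smooth_withinN sG)). Qed.

Lemma smooth_within_sum A (I : Type) (r : seq I) (H : I -> 'rV[R]_n -> R) :
  (forall i, smooth_within A (H i)) -> smooth_within A (fun x => \sum_(i <- r) H i x).
Proof.
move=> sH; elim: r => [|i r IH].
  by apply: (smooth_within_ext _ (@smooth_within_cst A 0)) => x _; rewrite big_nil.
by apply: (smooth_within_ext _ (smooth_withinD (sH i) IH)) => x _; rewrite big_cons.
Qed.

Lemma smooth_within_prod A (I : Type) (r : seq I) (H : I -> 'rV[R]_n -> R) :
  (forall i, smooth_within A (H i)) -> smooth_within A (fun x => \prod_(i <- r) H i x).
Proof.
move=> sH; elim: r => [|i r IH].
  by apply: (smooth_within_ext _ (@smooth_within_cst A 1)) => x _; rewrite big_nil.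
by apply: (smooth_within_ext _ (smooth_withinM (sH i) IH)) => x _; rewrite big_cons.
Qed.

Lemma smooth_withinV A F : (forall x, A x -> F x != 0) -> smooth_within A F ->
  smooth_within A (fun x => (F x)^-1).
Proof.
move=> F0 sF x Ax; have [V [H [oV Vx CH FH]]] := sF x Ax.
pose W := V `&` [set y | H y != 0].
have Wx : W x by split => //=; rewrite -FH// F0.
have oW : open W.
  rewrite openE => y [Vy Hy]; apply: filterI; first exact: (open_nbhs_nbhs (conj oV Vy)).
  exact: (cvgr_neq0 _ (CH 0%N y Vy) Hy).
exists W, (fun y => (H y)^-1); split => //.
  by move=> k; apply: CkV => //; [move=> y []|apply: Ck_sub (CH k) => y []].
by move=> y [Vy _] Ay; rewrite FH.
Qed.

Lemma smooth_within_det A m (H : 'rV[R]_n -> 'M[R]_m) :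
  (forall i j, smooth_within A (fun x => H x i j)) ->
  smooth_within A (fun x => \det (H x)).
Proof.
move=> sH; apply: smooth_within_sum => s; apply: smooth_withinM.
  exact: smooth_within_cst.
by apply: smooth_within_prod => i; exact: sH.
Qed.

Lemma smooth_within_invmx A m (H : 'rV[R]_n -> 'M[R]_m) i j :
  (forall i j, smooth_within A (fun x => H x i j)) ->
  (forall x, A x -> H x \in unitmx) ->
  smooth_within A (fun x => invmx (H x) i j).
Proof.
move=> sH uH.
apply: (@smooth_within_ext A (fun x => (\det (H x))^-1 * cofactor (H x) j i)).
  by move=> x Ax; rewrite /invmx uH// !mxE.
apply: smooth_withinM.
  apply: smooth_withinV; last exact: smooth_within_det.
  by move=> x Ax; have := uH x Ax; rewrite unitmxE unitfE.
apply: smooth_withinM; first exact: smooth_within_cst.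
apply: smooth_within_det => p q.
by apply: (smooth_within_ext _ (sH (lift j p) (lift i q))) => x _; rewrite !mxE.
Qed.

End Smooth_functions.

(** * Calculus with a metric in coordinates *)

Section Matrix_derivatives.
Context {R : realType} {n : nat}.
Implicit Types (x y : 'rV[R]_n) (c : 'I_n).

Definition has_pdmx p q c (M : 'rV[R]_n -> 'M[R]_(p, q)) x (D : 'M[R]_(p, q)) :=
  forall i j, has_pd c (fun y => M y i j) x (D i j).

Lemma has_pdmx_mul p q r c (M : 'rV[R]_n -> 'M[R]_(p, q)) (N : 'rV[R]_n -> 'M[R]_(q, r))
    x D D' : has_pdmx c M x D -> has_pdmx c N x D' ->
  has_pdmx c (fun y => M y *m N y) x (M x *m D' + D *m N x).
Proof.
move=> hM hN i j; rewrite !mxE -big_split /=.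
have := @has_pd_sum _ _ c _ (index_enum _) _ x _ (fun k => has_pdM (hM i k) (hN k j)).
by congr has_pd; apply/funext => y; rewrite mxE.
Qed.

Lemma has_pdmx_tr p q c (M : 'rV[R]_n -> 'M[R]_(p, q)) x D :
  has_pdmx c M x D -> has_pdmx c (fun y => (M y)^T) x D^T.
Proof.
move=> hM i j; rewrite mxE; have := hM j i.
by congr has_pd; apply/funext => y; rewrite mxE.
Qed.

Lemma has_pdmx_unique p q c (M : 'rV[R]_n -> 'M[R]_(p, q)) x D D' :
  has_pdmx c M x D -> has_pdmx c M x D' -> D = D'.
Proof.
by move=> h h'; apply/matrixP => i j; rewrite -(has_pdE (h i j)) (has_pdE (h' i j)).
Qed.

End Matrix_derivatives.

Record metric_on (R : realType) (n : nat) (A : set 'rV[R]_n)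
    (G : 'rV[R]_n -> 'M[R]_n) : Prop := {
  metric_on_relopen : relopen A;
  metric_on_smooth : forall a b, smooth_within A (fun x => G x a b);
  metric_on_sym : forall x, A x -> (G x)^T = G x;
  metric_on_pos : forall x (v : 'rV[R]_n), A x -> v != 0 ->
    0 < (v *m G x *m v^T) ord0 ord0 }.

Section Metric_calculus.
Context {R : realType} {n : nat} {A : set 'rV[R]_n} {G : 'rV[R]_n -> 'M[R]_n}.
Hypothesis mG : metric_on A G.
Implicit Types (x y : 'rV[R]_n) (a b c d : 'I_n) (F K : 'rV[R]_n -> R).

Lemma posdef_unitmx m (S : 'M[R]_m) :
  (forall v : 'rV[R]_m, v != 0 -> 0 < (v *m S *m v^T) ord0 ord0) -> S \in unitmx.
Proof.
move=> pS; rewrite -row_free_unit; apply: inj_row_free => v vS.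
by apply/eqP; apply: contraT => /pS; rewrite vS mul0mx mxE ltxx.
Qed.

Lemma metric_unit x : A x -> G x \in unitmx.
Proof. by move=> Ax; apply: posdef_unitmx => v; exact: (metric_on_pos mG). Qed.

Definition gi x := invmx (G x).

Lemma gi_sym x : A x -> (gi x)^T = gi x.
Proof. by move=> Ax; rewrite /gi trmx_inv (metric_on_sym mG Ax). Qed.

Lemma smooth_gi a b : smooth_within A (fun x => gi x a b).
Proof.
by apply: smooth_within_invmx; [exact: (metric_on_smooth mG)|exact: metric_unit].
Qed.

Definition dmetric c x : 'M[R]_n := \matrix_(a, b) pd c (fun y => G y a b) x.

Lemma has_pd_metric c x : A x -> has_pdmx c G x (dmetric c x).
Proof.
move=> Ax i j; rewrite mxE.
by apply: smooth_pd Ax; [exact: (metric_on_relopen mG)|exact: (metric_on_smooth mG)].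
Qed.

Lemma dmetric_sym c x : A x -> (dmetric c x)^T = dmetric c x.
Proof.
move=> Ax; apply: (has_pdmx_unique (has_pdmx_tr (has_pd_metric (c := c) Ax))) => i j.
apply: (@has_pd_ext _ _ c (fun y => G y i j)); last exact: has_pd_metric.
  by rewrite (metric_on_sym mG Ax).
apply: filterS (relopen_shift c (metric_on_relopen mG) Ax) => h Ah.
by rewrite (metric_on_sym mG Ah).
Qed.

(** Differentiate g^-1 g = 1, the derivative of g^-1 being known to exist by smoothness. *)
Lemma has_pd_gi c x : A x ->
  has_pdmx c gi x (- (gi x *m dmetric c x *m gi x)).
Proof.
move=> Ax; pose X := \matrix_(a, b) pd c (fun y => gi y a b) x.
have hX : has_pdmx c gi x X.
  by move=> i j; rewrite mxE; apply: smooth_pd Ax; [exact: (metric_on_relopen mG)|exact: smooth_gi].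
suff -> : - (gi x *m dmetric c x *m gi x) = X by [].
have h1 := has_pdmx_mul hX (has_pd_metric (c := c) Ax).
have h2 : has_pdmx c (fun y => gi y *m G y) x 0.
  move=> i j; rewrite mxE; apply: (has_pd_ext _ _ (has_pd_cst c ((1%:M : 'M[R]_n) i j) x)).
    by rewrite /gi mulVmx ?metric_unit.
  apply: filterS (relopen_shift c (metric_on_relopen mG) Ax) => h Ah.
  by rewrite /gi mulVmx ?metric_unit.
have /(congr1 (mulmx^~ (gi x))) := has_pdmx_unique h1 h2.
rewrite mulmxDl mul0mx -(mulmxA X) /gi mulmxV ?metric_unit// mulmx1.
by move/eqP; rewrite addrC addr_eq0 => /eqP ->.
Qed.

(** The connection matrix in direction c: the covariant derivative of a column of components w along
    d_c is d_c w + [Gam c] w. *)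
Definition Gam c x : 'M[R]_n := \matrix_(d, a) christoffel G d c a x.

(** Christoffel symbols of the first kind, the upper index being lowered to e. *)
Definition lowGam c x : 'M[R]_n := \matrix_(e, a)
  (2^-1 * (dmetric c x a e + dmetric a x c e - dmetric e x c a)).

Lemma GamE c x : Gam c x = gi x *m lowGam c x.
Proof.
apply/matrixP => d a; rewrite !mxE /christoffel mulr_sumr.
by apply: eq_bigr => e _; rewrite !mxE mulrCA.
Qed.

Lemma dmetricC c a b x : A x -> dmetric c x a b = dmetric c x b a.
Proof. by move=> Ax; rewrite -[in LHS]dmetric_sym// mxE. Qed.

(** The last two terms of L are antisymmetric in (e, a) and cancel. For the derivatives of g this is
    the compatibility of the connection with the metric. *)
Lemma symmetric_part (D : 'I_n -> 'M[R]_n) c : (forall d, (D d)^T = D d) ->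
  let L := \matrix_(e, a) (2^-1 * (D c a e + D a c e - D e c a)) in L + L^T = D c.
Proof.
move=> Ds; have Dc d i j : D d i j = D d j i by rewrite -[in LHS]Ds mxE.
apply/matrixP => e a; rewrite !mxE (Dc c e a).
by field.
Qed.

Lemma lowGamD c x : A x -> lowGam c x + (lowGam c x)^T = dmetric c x.
Proof. by move=> Ax; apply: (symmetric_part (D := dmetric^~ x)) => d; exact: dmetric_sym. Qed.

Lemma has_pd_giE c x : A x ->
  has_pdmx c gi x (- (Gam c x *m gi x + gi x *m (Gam c x)^T)).
Proof.
move=> Ax; have := has_pd_gi (c := c) Ax; congr has_pdmx; congr (- _).
by rewrite -(lowGamD c Ax) GamE mulmxDr mulmxDl trmx_mul gi_sym// !mulmxA.
Qed.

(** The right-hand side is the logarithmic derivative of sqrt (det g) in direction c;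
    [derive_volume] meets it in this form. *)
Lemma trace_Gam c x : A x -> \tr (Gam c x) = 2^-1 * \tr (gi x *m dmetric c x).
Proof.
move=> Ax; rewrite -(lowGamD c Ax) mulmxDr mxtraceD -GamE.
have -> : \tr (gi x *m (lowGam c x)^T) = \tr (Gam c x).
  by rewrite -mxtrace_tr trmx_mul trmxK gi_sym// mxtrace_mulC GamE.
by field.
Qed.

Lemma christoffel_sym c a b x : A x -> christoffel G c a b x = christoffel G c b a x.
Proof.
move=> Ax; rewrite /christoffel; congr (_ * _); apply: eq_bigr => d _.
by have := dmetricC d a b Ax; rewrite !mxE => ->; ring.
Qed.

Definition pd_row F x : 'rV[R]_n := \row_a pd a F x.

Definition coord_grad_prod F K x : R := (pd_row F x *m gi x *m (pd_row K x)^T) ord0 ord0.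

Lemma has_pd_pd_row c F x : smooth_within A F -> A x ->
  has_pdmx c (pd_row F) x (\row_a pd c (pd a F) x).
Proof.
move=> sF Ax i j; rewrite mxE.
have rA := metric_on_relopen mG.
have : has_pd c (pd j F) x (pd c (pd j F) x).
  by apply: smooth_pd Ax => //; exact: smooth_within_pd.
by congr has_pd; apply/funext => y; rewrite mxE.
Qed.

Lemma row_hessian c F x : row c (coord_hessian G F x) =
  \row_a pd c (pd a F) x - pd_row F x *m Gam c x.
Proof.
apply/rowP => a; rewrite !mxE; congr (_ - _); apply: eq_bigr => d _.
by rewrite !mxE mulrC.
Qed.

(** The Christoffel terms of the two Hessians are those produced by differentiating the inverse
    metric, by [has_pd_giE]. *)
Lemma has_pd_grad_prod c F K x : smooth_within A F -> smooth_within A K -> A x ->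
  has_pd c (coord_grad_prod F K) x
    ((row c (coord_hessian G F x) *m gi x *m (pd_row K x)^T
      + pd_row F x *m gi x *m (row c (coord_hessian G K x))^T) ord0 ord0).
Proof.
move=> sF sK Ax.
have := has_pdmx_mul (has_pdmx_mul (has_pd_pd_row (c := c) sF Ax) (has_pd_giE (c := c) Ax))
   (has_pdmx_tr (has_pd_pd_row (c := c) sK Ax)).
move=> /(_ ord0 ord0).
rewrite !row_hessian; set dF := \row_a pd c (pd a F) x; set dK := \row_a pd c (pd a K) x.
move: (pd_row F x) (pd_row K x) (gi x) (gi_sym Ax) (Gam c x) => f k g gs T.
set M1 := (X in has_pd _ _ _ (X _ _) -> _); set M2 := (X in _ -> has_pd _ _ _ (X _ _)).
suff -> : M2 = M1 by [].
rewrite {}/M1 {}/M2 linearB /= trmx_mul mulmxBr mulmxBl mulmxBl mulmxDl mulmxN mulmxDr mulNmx mulmxDl.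
rewrite !mulmxA; set X1 := f *m g *m dK^T; set X2 := f *m T *m g *m k^T.
set X3 := f *m g *m T^T *m k^T; set X4 := dF *m g *m k^T.
congr fun_of_matrix; clearbody X1 X2 X3 X4.
by apply/matrixP => i j; rewrite !mxE; ring.
Qed.

Lemma coord_laplacianE F x : A x ->
  coord_laplacian G F x = \sum_a (gi x *m (row a (coord_hessian G F x))^T) a ord0.
Proof.
move=> Ax; rewrite /coord_laplacian /metric_trace -/(gi x) -mxtrace_tr trmx_mul.
rewrite gi_sym// mxtrace_mulC /mxtrace; apply: eq_bigr => a _.
by rewrite !mxE; apply: eq_bigr => b _; rewrite !mxE.
Qed.

(** The Laplacian is the divergence of the gradient k: sum of d_a k^a + Gamma^c_ac k^a. The
    coordinate derivatives are handed out as a family D with proofs of their existence, since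
    [Green_coord] multiplies them by further factors. *)
Lemma divergence_grad F x : smooth_within A F -> A x ->
  exists2 D : 'I_n -> R,
    (forall a, has_pd a (fun y => (gi y *m (pd_row F y)^T) a ord0) x (D a)) &
    \sum_a D a + \sum_a \tr (Gam a x) * (gi x *m (pd_row F x)^T) a ord0
      = coord_laplacian G F x.
Proof.
move=> sF Ax.
pose D a := (gi x *m (row a (coord_hessian G F x))^T - Gam a x *m gi x *m (pd_row F x)^T) a ord0.
exists D.
  move=> a; have := has_pdmx_mul (has_pd_giE (c := a) Ax) (has_pdmx_tr (has_pd_pd_row (c := a) sF Ax)).
  move=> /(_ a ord0); rewrite /D row_hessian; set dF := \row_b pd a (pd b F) x.
  move: (pd_row F x) (gi x) (Gam a x) => f g T.
  set M1 := (X in has_pd _ _ _ (X _ _) -> _); set M2 := (X in _ -> has_pd _ _ _ (X _ _)).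
  suff -> : M2 = M1 by [].
  rewrite /M1 /M2 linearB /= trmx_mul mulmxBr mulNmx mulmxDl !mulmxA opprD.
  by congr fun_of_matrix; rewrite -addrA [X in _ + X = _]addrC.
rewrite (coord_laplacianE _ Ax) /D.
under eq_bigr do rewrite !mxE -/(gi x).
rewrite sumrB; under [X in X - _]eq_bigr do idtac.
set S := \sum_a \tr _ * _.
suff -> : S = \sum_a \sum_j (Gam a x *m gi x) a j * (pd_row F x)^T j ord0.
  rewrite -addrA [- _ + _]addrC subrr addr0.
  by apply: eq_bigr => a _; rewrite !mxE.
(* The symmetry of the Christoffel symbols in their lower indices turns the trace of each [Gam a]
   into the contraction left over by the covariant derivative. *)
rewrite /S; transitivity (\sum_a \sum_d Gam a x a d * (gi x *m (pd_row F x)^T) d ord0).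
  rewrite exchange_big /=; apply: eq_bigr => d _; rewrite -mulr_suml; congr (_ * _).
  by apply: eq_bigr => a _; rewrite !mxE christoffel_sym.
apply: eq_bigr => a _.
have -> : \sum_j (Gam a x *m gi x) a j * (pd_row F x)^T j ord0 =
  (Gam a x *m gi x *m (pd_row F x)^T) a ord0 by rewrite [RHS]mxE.
by rewrite -mulmxA [RHS]mxE.
Qed.

End Metric_calculus.

(** * Compact supports in an open set, and integration of derivatives *)

Section Compactly_supported.
Context {R : realType} {n : nat}.
Implicit Types (F G : 'rV[R]_n -> R) (x y v : 'rV[R]_n) (U : set 'rV[R]_n) (a : 'I_n).
Local Notation E := (@basis_vec R n).

Definition csupp U F := exists K : set 'rV[R]_n,
  [/\ compact K, K `<=` U & forall x, ~ K x -> F x = 0].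

Lemma near_compact_compl (K : set 'rV[R]_n) x : compact K -> ~ K x ->
  \forall y \near x, ~ K y.
Proof.
move=> cK nK; have clK : closed K by apply: compact_closed cK; exact: norm_hausdorff.
by have := open_nbhs_nbhs (conj (closed_openC clK) nK).
Qed.

Lemma csupp_bounded U F : csupp U F -> exists N, supp_le F N.
Proof.
move=> [K [cK _ F0]]; have [M [_ hM]] := compact_bounded cK.
have [N hN] := nat_ge (`|M| + 1); exists N => x xN; apply: F0 => Kx.
have := hM (`|M| + 1) _ x Kx; rewrite (le_lt_trans (ler_norm M)) ?ltrDl// => /(_ isT).
by move=> h; have := lt_le_trans xN (le_trans h hN); rewrite ltxx.
Qed.

Lemma csupp_Cc U F : Ck 0 U F -> csupp U F -> Cc F.
Proof.
move=> cF sF; split; last exact: csupp_bounded sF.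
move=> x; have [K [cK KU F0]] := sF.
have [Kx|nKx] := pselect (K x); first exact/cF/KU.
rewrite /continuous_at F0// => B B0; have := near_compact_compl cK nKx.
rewrite /nbhs /=; apply: (@filterS _ (nbhs x)) => y /F0 Fy.
by rewrite /preimage /= Fy; exact: nbhs_singleton.
Qed.

Lemma csupp_derivable U F : open U -> Ck 1 U F -> csupp U F ->
  [/\ Cc F, forall a x, derivable F x (E a),
     forall a, csupp U ('D_(E a) F) & forall a, Cc ('D_(E a) F)].
Proof.
move=> oU cF sF; have [K [cK KU F0]] := sF.
have n0 x : ~ K x -> {near x, (fun=> 0) =1 F}.
  by move=> /(near_compact_compl cK); apply: (@filterS _ (nbhs x)) => y /F0.
have dF a : csupp U ('D_(E a) F).
  exists K; split => // x nKx.
  by rewrite -(near_eq_derive _ (n0 _ nKx)) derive_cst.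
split => //.
- by apply: csupp_Cc sF; exact: CkS.
- move=> a x; have [Kx|nKx] := pselect (K x); first by have [h _] := cF a; exact/h/KU.
  by apply: near_eq_derivable (n0 _ nKx) _; exact: derivable_cst.
- by move=> a; apply: csupp_Cc (dF a); have [_ h] := cF a.
Qed.

(** By translation invariance every difference quotient has integral 0; [J_cvg] passes to the
    limit. *)
Lemma J_derive0 F a : Cc F -> (forall x, derivable F x (E a)) ->
  Cc ('D_(E a) F) -> J ('D_(E a) F) = 0.
Proof.
move=> CF dF CdF; have [cF [N FN]] := CF.
have CFh h : Cc (fun x => F (x + h *: E a)) by exact: Cc_shift.
have q0 (h : R) : J (fun x => h^-1 * (F (x + h *: E a) - F x)) = 0.
  by rewrite JZ ?JB ?J_shift ?subrr ?mulr0//; exact: CcB.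
have [N' hN'] := nat_ge (`|E a|).
have H : J (fun x => h^-1 * (F (x + h *: E a) - F x)) @[h --> (0 : R)^'] --> J ('D_(E a) F).
  have [cd [M dM]] := CdF.
  apply: (@J_cvg R n _ _ _ _ (N + N' + M)) => //.
  - by apply: supp_le_leq dM; rewrite leq_addl.
  - have b1 : \forall h \near (0 : R)^', `|h| <= 1.
      apply: nbhs_dnbhs; by exists 1 => //= h /=; rewrite sub0r normrN => /ltW.
    apply: filterS b1 => h h1; split.
      by have [] := CcZ h^-1 (CcB (CFh h) CF).
    move=> x hx; have hx' : (N + N')%:R < `|x|.
      by apply: le_lt_trans hx; rewrite ler_nat leq_addr.
    rewrite (@supp_le_shift _ _ F N N') //.
      by rewrite FN ?subrr ?mulr0//; apply: le_lt_trans hx'; rewrite ler_nat leq_addr.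
    by rewrite normrZ (le_trans _ hN')// ler_piMl.
  - by move=> x; apply: cvg_quotient; [exact: (@filterE _ (nbhs x))|exact: cd].
have H0 : J (fun x => h^-1 * (F (x + h *: E a) - F x)) @[h --> (0 : R)^'] --> (0 : R).
  by under eq_fun do rewrite q0; exact: cvg_cst.
exact: (cvg_unique _ H H0).
Qed.

End Compactly_supported.

(** * A profile of class C^1 for bumps and cutoffs *)

Section Square_of_positive_part.
Context {R : realType}.
Implicit Types s t u : R.

Definition pos s : R := Num.max 0 s.
(** The profile of all bumps and cutoffs below. It is C^1 but not C^2, which suffices since Green's
    formula puts only one derivative on the test function. *)
Definition sqpos s : R := pos s ^+ 2.

Lemma pos_ge0 s : 0 <= pos s. Proof. by rewrite /pos le_max lexx. Qed.
Lemma sqpos_ge0 s : 0 <= sqpos s. Proof. exact: sqr_ge0. Qed.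
Lemma pos_le0 s : s <= 0 -> pos s = 0. Proof. by move=> ?; rewrite /pos max_l. Qed.
Lemma pos_id s : 0 <= s -> pos s = s. Proof. by move=> ?; rewrite /pos max_r. Qed.
Lemma sqpos_le0 s : s <= 0 -> sqpos s = 0.
Proof. by move=> ?; rewrite /sqpos pos_le0// expr0n. Qed.
Lemma sqpos_gt0 s : 0 < s -> 0 < sqpos s.
Proof. by move=> s0; rewrite /sqpos pos_id ?ltW// exprn_gt0. Qed.

Lemma pos_continuous : continuous pos.
Proof.
move=> s; apply: (@continuous_max R R (cst 0) id); first exact: cst_continuous.
exact: cvg_id.
Qed.

Lemma sqpos_continuous : continuous sqpos.
Proof. by move=> s; exact: (cvgM (pos_continuous (x := s)) (pos_continuous (x := s))). Qed.

(** A strict derivative at u: s and t may both move, so the estimate applies to difference quotients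
    whose base point varies. *)
Lemma sqpos_estimate s t u :
  `|sqpos s - sqpos t - 2 * pos u * (s - t)| <= 2 * (`|s - u| + `|t - u|) * `|s - t|.
Proof.
have lip x y : `|pos x - pos y| <= `|x - y|.
  rewrite /pos; have [hx|hx] := leP x 0; have [hy|hy] := leP y 0.
  - by rewrite subrr normr0.
  - by rewrite sub0r normrN gtr0_norm// distrC ler_normr; apply/orP; left; lra.
  - by rewrite subr0 gtr0_norm// ler_normr; apply/orP; left; lra.
  - by [].
wlog st : s t / t <= s.
  move=> W; have [h|/ltW h] := leP t s; first exact: W.
  have := W t s h; rewrite -normrN -[X in _ -> _ <= _ * X]distrC [X in _ <= 2 * X * _]addrC.
  congr (`|_| <= _); rewrite !opprD !opprK; lra.
have [ls lt] := (lip s u, lip t u).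
(* Convexity of [sqpos]; by the 1-Lipschitz bound [lip], both slopes are close to the slope at u. *)
have b : 2 * pos t * (s - t) <= sqpos s - sqpos t <= 2 * pos s * (s - t).
  rewrite /sqpos /pos; have [hs|hs] := leP s 0; have [ht|ht] := leP t 0; apply/andP; split; nra.
have st0 : 0 <= s - t by lra.
rewrite [X in _ <= _ * X](ger0_norm st0); case/andP: b => b1 b2.
move: ls lt; rewrite !ler_norml => /andP[s1 s2] /andP[t1 t2].
have := normr_ge0 (s - u); have := normr_ge0 (t - u) => tu su.
apply/andP; split; nra.
Qed.

Lemma sqpos_chain (T : Type) (FT : set_system T) (h s t : T -> R) (u d : R) :
  Filter FT -> s @ FT --> u -> t @ FT --> u ->
  (h z)^-1 * (s z - t z) @[z --> FT] --> d ->
  (h z)^-1 * (sqpos (s z) - sqpos (t z)) @[z --> FT] --> 2 * pos u * d.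
Proof.
move=> FF su tu sd.
have e0 : 2 * (`|s z - u| + `|t z - u|) * `|(h z)^-1 * (s z - t z)| @[z --> FT] --> (0 : R).
  have -> : (0 : R) = 2 * (`|u - u| + `|u - u|) * `|d|.
    by rewrite subrr normr0 addr0 mulr0 mul0r.
  apply: cvgM (cvg_norm sd); apply: cvgMr.
  by apply: cvgD; apply: cvg_norm; apply: cvgB => //; exact: cvg_cst.
have md : 2 * pos u * ((h z)^-1 * (s z - t z)) @[z --> FT] --> 2 * pos u * d by exact: cvgMr.
rewrite -[X in _ --> X]add0r.
have -> : (fun z => (h z)^-1 * (sqpos (s z) - sqpos (t z))) =
  (fun z => ((h z)^-1 * (sqpos (s z) - sqpos (t z)) - 2 * pos u * ((h z)^-1 * (s z - t z))) +
      2 * pos u * ((h z)^-1 * (s z - t z))).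
  by apply/funext => z; rewrite subrK.
apply: cvgD => //.
apply: (@squeeze_cvgr _ _ _ _ (fun z => - (2 * (`|s z - u| + `|t z - u|) * `|(h z)^-1 * (s z - t z)|))
   (fun z => 2 * (`|s z - u| + `|t z - u|) * `|(h z)^-1 * (s z - t z)|)) => //; last first.
  by rewrite -[X in _ --> X]oppr0; exact: cvgN.
apply: nearW => z; rewrite -ler_norml.
have -> : (h z)^-1 * (sqpos (s z) - sqpos (t z)) - 2 * pos u * ((h z)^-1 * (s z - t z))
  = (h z)^-1 * (sqpos (s z) - sqpos (t z) - 2 * pos u * (s z - t z)) by ring.
rewrite !normrM mulrCA ler_wpM2l//.
exact: sqpos_estimate.
Qed.

Lemma derivable_sqpos n (F : 'rV[R]_n -> R) x v : derivable F x v -> {for x, continuous F} ->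
  derivable (sqpos \o F) x v /\ 'D_v (sqpos \o F) x = 2 * pos (F x) * 'D_v F x.
Proof.
move=> /derive_quotient dF cF; apply: is_derive_quotient => /=.
apply: (@sqpos_chain _ _ id (fun h => F (x + h *: v)) (fun=> F x)) => //; last exact: cvg_cst.
have : x + h *: v @[h --> (0 : R)^'] --> x.
  rewrite -[X in _ --> X]addr0 -(scale0r v).
  apply: (cvgD (cvg_cst x)); apply: cvgZr_tmp.
  exact: cvg_within.
by move=> h; exact: (cvg_comp _ _ h cF).
Qed.

Lemma Ck1_sqpos n (V : set 'rV[R]_n) (F : 'rV[R]_n -> R) : open V -> Ck 1 V F ->
  Ck 1 V (sqpos \o F).
Proof.
move=> oV cF a; have [dF CF] := cF a; have c0 := CkS oV cF.
split; first by move=> x Vx; exact: (derivable_sqpos (dF x Vx) (c0 x Vx)).1.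
apply: (@Ck_ext _ _ 0 V (fun x => 2 * pos (F x) * 'D_(basis_vec a) F x)) => //.
  by move=> x Vx; rewrite (derivable_sqpos (dF x Vx) (c0 x Vx)).2.
move=> x Vx; apply: (cvgM _ (CF x Vx)); apply: cvgMr.
exact: (cvg_comp _ _ (c0 x Vx) (pos_continuous (x := F x))).
Qed.

End Square_of_positive_part.

(** * Volume density and the local Green formula *)

Section Density.
Context {R : realType} {n : nat}.
Implicit Types (x y v w : 'rV[R]_n) (S : 'M[R]_n).
Local Notation E := (@basis_vec R n).

Definition quad S v : R := \sum_i \sum_j v ord0 i * v ord0 j * S i j.

Lemma quadE S v : (v *m S *m v^T) ord0 ord0 = quad S v.
Proof.
rewrite !mxE /quad exchange_big /=; apply: eq_bigr => j _.
by rewrite !mxE mulr_suml; apply: eq_bigr => i _; rewrite mulrAC.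
Qed.

Lemma quadZ S (c : R) v : quad S (c *: v) = c ^+ 2 * quad S v.
Proof.
rewrite /quad mulr_sumr; apply: eq_bigr => i _; rewrite mulr_sumr.
by apply: eq_bigr => j _; rewrite !mxE; ring.
Qed.

Lemma quad_cvg (T : Type) (FT : set_system T) (S : T -> 'M[R]_n) (w : T -> 'rV[R]_n) S0 w0 :
  Filter FT -> (forall i j, S t i j @[t --> FT] --> S0 i j) ->
  (forall i, w t ord0 i @[t --> FT] --> w0 ord0 i) ->
  quad (S t) (w t) @[t --> FT] --> quad S0 w0.
Proof.
move=> FF hS hw; apply: cvg_sumR => i; apply: cvg_sumR => j.
by apply: cvgM => //; exact: cvgM.
Qed.

Lemma coord_cvg (T : Type) (FT : set_system T) (w : T -> 'rV[R]_n) w0 i :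
  Filter FT -> w @ FT --> w0 -> w t ord0 i @[t --> FT] --> w0 ord0 i.
Proof. by move=> FF h; exact: (cvg_comp _ _ h (@coord_continuous R 1 n ord0 i w0)). Qed.

Lemma quad_continuous S : continuous (quad S).
Proof.
move=> v; apply: (@quad_cvg _ (nbhs v) (fun=> S) id) => [i j|i]; first exact: cvg_cst.
exact: coord_cvg.
Qed.

Definition posdef S := forall v, v != 0 -> 0 < quad S v.

(* Coercivity is locally uniform: this bounds the supports of the bumps
   [ellipsoid_bump S] below. *)
Lemma posdef_coercive (T : Type) (FT : set_system T) (S : T -> 'M[R]_n) S0 :
  Filter FT -> (forall i j, S t i j @[t --> FT] --> S0 i j) -> posdef S0 ->
  exists2 c : R, 0 < c & \forall t \near FT, forall v, c * `|v| ^+ 2 <= quad (S t) v.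
Proof.
move=> FF hS pS; pose K := [set v : 'rV[R]_n | `|v| = 1].
have cK : compact K.
  apply: (@subclosed_compact _ _ (@cball R n 1)); last first.
  - by move=> v; rewrite /K /cball /= => ->.
  - exact: compact_cball.
  rewrite (_ : K = (fun v => `|v|) @^-1` [set r | r = 1])//.
  apply: closed_comp; last exact: closed_eq.
  by move=> v _; exact: norm_continuous.
(* The unit sphere is empty when n = 0; then every v is 0 and any c will do. *)
have [[v0 Kv0]|K0] := pselect (K !=set0); last first.
  exists 1 => //; apply: nearW => t v; have [->|v0] := eqVneq v 0.
    rewrite normr0 expr0n mulr0 /quad big1// => i _; rewrite big1// => j _.
    by rewrite !mxE !mul0r.
  exfalso; apply: K0; exists (`|v|^-1 *: v); rewrite /K /= normrZ normfV normr_id.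
  by rewrite mulVf// normr_eq0.
have cq : {within K, continuous (quad S0)} by exact/continuous_subspaceT/quad_continuous.
have [u Ku hu] := @EVT_min_rV R n (quad S0) K (ex_intro _ v0 Kv0) cK cq.
move: Ku => /set_mem Ku; have u0 : u != 0 by rewrite -normr_gt0 Ku.
have qu := pS u u0; exists (quad S0 u / 2); first by rewrite divr_gt0.
have qu2 : 0 < quad S0 u / 2 by rewrite divr_gt0.
have := @unif_cvg R _ T FT K (fun t v => quad (S t) v) (quad S0) FF cK
  (fun v _ => @quad_continuous S0 v) _ _ qu2.
have jc x : K x -> quad (S z.1) z.2 @[z --> (FT, nbhs x)] --> quad S0 x.
  move=> _; apply: quad_cvg => [i j|i]; first exact: (cvg_comp _ _ cvg_fst (hS i j)).
  by apply: coord_cvg; exact: cvg_snd.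
move=> /(_ jc); apply: filterS => t ht v; have [->|v0'] := eqVneq v 0.
  rewrite normr0 expr0n mulr0 /quad big1// => i _; rewrite big1// => j _.
  by rewrite !mxE !mul0r.
have nv : `|v| != 0 by rewrite normr_eq0.
have Kv : K (`|v|^-1 *: v) by rewrite /K /= normrZ normfV normr_id mulVf.
have := ht _ Kv; rewrite ltr_norml => /andP[h1 _].
have := hu _ (mem_set Kv) => h2.
have vE : v = `|v| *: (`|v|^-1 *: v) by rewrite scalerA divff// scale1r.
rewrite [X in _ <= quad _ X]vE quadZ mulrC ler_wpM2l ?sqr_ge0//; lra.
Qed.

(** A bump on the ellipsoid where the form S is less than 1; the profile is C^1, so its integral can
    be differentiated in S. *)
Definition ellipsoid_bump S v : R := sqpos (1 - quad S v).

Definition ellipsoid_volume S : R := J (ellipsoid_bump S).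

(* Up to a constant factor this is sqrt (det S); defining it through [J] spares
   linear changes of variables. *)
Definition density S : R := (ellipsoid_volume S)^-1.

Lemma bump_supp (T : Type) (FT : set_system T) (S : T -> 'M[R]_n) S0 :
  Filter FT -> (forall i j, S t i j @[t --> FT] --> S0 i j) -> posdef S0 ->
  exists N, \forall t \near FT, forall v, N%:R < `|v| -> 1 - quad (S t) v <= 0.
Proof.
move=> FF hS pS; have [c c0 hc] := posdef_coercive FF hS pS.
(* The added 1 gives |v|^2 >= |v| > c^-1, hence c |v|^2 >= 1. *)
have [N hN] := nat_ge (c^-1 + 1); exists N; apply: filterS hc => t ht v vN.
have := ht v; have v1 : c^-1 + 1 < `|v| by exact: le_lt_trans vN.
have ci : 0 < c^-1 by rewrite invr_gt0.
have : 1 <= c * `|v| ^+ 2.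
  rewrite -ler_pdivrMl// mulr1 expr2; nra.
lra.
Qed.

Lemma posdef_bump_supp S : posdef S ->
  exists N, forall v, N%:R < `|v| -> 1 - quad S v <= 0.
Proof.
move=> pS; have [N hN] := @bump_supp nat nat_ultra (fun=> S) S _ (fun i j => cvg_cst _) pS.
by exists N; have [_ ] := filter_ex hN.
Qed.

Lemma ellipsoid_bump_continuous S : continuous (ellipsoid_bump S).
Proof.
move=> v; have h : 1 - quad S w @[w --> v] --> 1 - quad S v.
  exact: (cvgB (cvg_cst _) (@quad_continuous S v)).
exact: (cvg_comp _ _ h (@sqpos_continuous R _)).
Qed.

Lemma Cc_bump_mul S (h : 'rV[R]_n -> R) (m : R -> R) : posdef S -> continuous h ->
  continuous m -> (forall s, s <= 0 -> m s = 0) -> Cc (fun v => h v * m (1 - quad S v)).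
Proof.
move=> pS ch cm m0; apply: CcMl => //; split.
  move=> v; have h1 : 1 - quad S w @[w --> v] --> 1 - quad S v.
    exact: (cvgB (cvg_cst _) (@quad_continuous S v)).
  exact: (cvg_comp _ _ h1 (cm _)).
by have [N hN] := posdef_bump_supp pS; exists N => v /hN; exact: m0.
Qed.

Lemma Cc_ellipsoid_bump S : posdef S -> Cc (ellipsoid_bump S).
Proof.
move=> pS; split; first exact: ellipsoid_bump_continuous.
by have [N hN] := posdef_bump_supp pS; exists N => v /hN; exact: sqpos_le0.
Qed.

Lemma ellipsoid_volume_gt0 S : posdef S -> 0 < ellipsoid_volume S.
Proof.
move=> pS; apply: (@J_gt0 R n _ 0) (Cc_ellipsoid_bump pS) _ _ => [v|].
  exact: sqpos_ge0.
apply: sqpos_gt0; rewrite /quad big1 ?subr0// => i _; rewrite big1// => j _.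
by rewrite !mxE !mul0r.
Qed.

Lemma density_gt0 S : posdef S -> 0 < density S.
Proof. by move=> pS; rewrite invr_gt0 ellipsoid_volume_gt0. Qed.

Lemma ellipsoid_volume_cvg (T : Type) (FT : set_system T) (S : T -> 'M[R]_n) S0 :
  Filter FT -> (forall i j, S t i j @[t --> FT] --> S0 i j) -> posdef S0 ->
  ellipsoid_volume (S t) @[t --> FT] --> ellipsoid_volume S0.
Proof.
move=> FF hS pS; have [N hN] := bump_supp FF hS pS.
have [M hM] := posdef_bump_supp pS.
apply: (@J_cvg R n _ _ _ _ (N + M)) => //.
- exact: ellipsoid_bump_continuous.
- move=> v h; apply: sqpos_le0; apply: hM; apply: le_lt_trans h.
  by rewrite ler_nat leq_addl.
- apply: filterS hN => t ht; split; first exact: ellipsoid_bump_continuous.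
  by move=> v h; apply/sqpos_le0/ht; apply: le_lt_trans h; rewrite ler_nat leq_addr.
- move=> x; have h : quad (S z.1) z.2 @[z --> (FT, nbhs x)] --> quad S0 x.
    apply: quad_cvg => [i j|i]; first exact: (cvg_comp _ _ cvg_fst (hS i j)).
    by apply: coord_cvg; exact: cvg_snd.
  have h1 : 1 - quad (S z.1) z.2 @[z --> (FT, nbhs x)] --> 1 - quad S0 x.
    exact: (cvgB (cvg_cst _) h).
  exact: (cvg_comp _ _ h1 (@sqpos_continuous R _)).
Qed.

Lemma density_cvg (T : Type) (FT : set_system T) (S : T -> 'M[R]_n) S0 :
  Filter FT -> (forall i j, S t i j @[t --> FT] --> S0 i j) -> posdef S0 ->
  density (S t) @[t --> FT] --> density S0.
Proof.
move=> FF hS pS; apply: cvgV; last exact: ellipsoid_volume_cvg.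
by rewrite gt_eqF// ellipsoid_volume_gt0.
Qed.

(* Integrating [d_i (q (1 - quad S v) v_k)] to zero, with [q = sqpos]. *)
Lemma second_moments S : posdef S -> S^T = S ->
  \matrix_(l, k) J (fun v => v ord0 l * v ord0 k * (2 * pos (1 - quad S v))) =
  (ellipsoid_volume S / 2) *: invmx S.
Proof.
move=> pS sS; set T := \matrix_(l, k) _.
have cp : continuous (fun s : R => 2 * pos s).
  by move=> s; apply: cvgMr; exact: pos_continuous.
have p0 (s : R) : s <= 0 -> 2 * pos s = 0 by move=> /pos_le0 ->; rewrite mulr0.
have cc (l k : 'I_n) : continuous (fun v : 'rV[R]_n => v ord0 l * v ord0 k).
  by move=> v; exact: (cvgM (@coord_continuous R 1 n _ _ v) (@coord_continuous R 1 n _ _ v)).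
have CT l k : Cc (fun v => v ord0 l * v ord0 k * (2 * pos (1 - quad S v))).
  by apply: (@Cc_bump_mul S _ (fun s => 2 * pos s)).
have dquad i (v : 'rV[R]_n) : derivable (fun v => 1 - quad S v) v (E i) /\
    'D_(E i) (fun v => 1 - quad S v) v = - (2 * \sum_l S i l * v ord0 l).
  apply: is_derive_quotient.
  have -> : (fun h : R => h^-1 * (1 - quad S (v + h *: E i) - (1 - quad S v))) =
     (fun h => h^-1 * (- (h * (2 * \sum_l S i l * v ord0 l) + h ^+ 2 * S i i))).
    apply/funext => h; congr (_ * _); rewrite -!quadE.
    rewrite linearD /= linearZ /= !mulmxDl !mulmxDr -!scalemxAl -!scalemxAr.
    have e1 : (E i *m S *m v^T) ord0 ord0 = \sum_l S i l * v ord0 l.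
      by rewrite -rowE !mxE; apply: eq_bigr => l _; rewrite !mxE.
    have e2 : (v *m S *m (E i)^T) ord0 ord0 = \sum_l S i l * v ord0 l.
      by rewrite -e1 -[LHS]trace_mx11 -mxtrace_tr !trmx_mul trmxK sS mulmxA trace_mx11.
    have e3 : (E i *m S *m (E i)^T) ord0 ord0 = S i i.
      by rewrite trmx_delta -rowE -colE !mxE.
    move: e1 e2 e3; move: (v *m S *m v^T) (v *m S *m (E i)^T) (E i *m S *m v^T).
    by move: (E i *m S *m (E i)^T) => M4 M1 M2 M3 e1 e2 e3; rewrite !mxE e1 e2 e3; ring.
  have h0 : (h : R) @[h --> (0 : R)^'] --> (0 : R) by exact: cvg_within.
  apply: (@cvg_trans _ (- ((2 * \sum_l S i l * v ord0 l) + h * S i i) @[h --> (0 : R)^'])).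
    apply: near_eq_cvg; apply: filterS (nbhs_dnbhs_neq (0 : R)) => h hn.
    by rewrite mulrN; congr (- _); rewrite mulrDr expr2 -!mulrA !mulKf.
  have h1 : 2 * (\sum_l S i l * v ord0 l) + h * S i i @[h --> (0 : R)^'] -->
      2 * (\sum_l S i l * v ord0 l) + 0 * S i i.
    exact: (cvgD (cvg_cst _) (cvgM h0 (cvg_cst _))).
  rewrite mul0r addr0 in h1; exact: (cvgN h1).
have cq : continuous (fun v : 'rV[R]_n => 1 - quad S v).
  by move=> v; exact: (cvgB (cvg_cst _) (@quad_continuous S v)).
have IBP i k : 2 * \sum_l S i l * T l k = (i == k)%:R * ellipsoid_volume S.
  pose H v := ellipsoid_bump S v * v ord0 k.
  have dH v : derivable H v (E i) /\ 'D_(E i) H v =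
     (i == k)%:R * ellipsoid_bump S v -
     2 * \sum_l S i l * (v ord0 l * v ord0 k * (2 * pos (1 - quad S v))).
    have [d1 d2] := dquad i v; have [d3 d4] := derivable_sqpos d1 (cq v).
    have [d5 d6] := derive_coord i k v; have [d7 d8] := derive_mulE d3 d5.
    split => //; rewrite [LHS]d8 d4 d2 d6 [X in X + _]mulrC; congr (_ + _).
    rewrite mulr_sumr mulr_sumr mulrN mulNr; congr (- _).
    rewrite mulr_sumr mulr_suml; apply: eq_bigr => l _; ring.
  have [S1 S2] := J_sum (index_enum 'I_n) (fun l => CcZ (S i l) (CT l k)).
  have CdH : Cc (fun v => (i == k)%:R * ellipsoid_bump S v -
     2 * \sum_l S i l * (v ord0 l * v ord0 k * (2 * pos (1 - quad S v)))).
    by apply: CcB; apply: CcZ => //; exact: Cc_ellipsoid_bump.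
  have CH : Cc H.
    have := CcMl (@coord_continuous R 1 n ord0 k) (Cc_ellipsoid_bump pS).
    by congr Cc; apply/funext => v; rewrite mulrC.
  have dHE : 'D_(E i) H = (fun v => (i == k)%:R * ellipsoid_bump S v -
     2 * \sum_l S i l * (v ord0 l * v ord0 k * (2 * pos (1 - quad S v)))).
    by apply/funext => v; exact: (dH v).2.
  have := @J_derive0 R n H i CH (fun v => (dH v).1); rewrite dHE => /(_ CdH).
  rewrite JB; [|by apply: CcZ; exact: Cc_ellipsoid_bump|exact: CcZ].
  rewrite (JZ _ (Cc_ellipsoid_bump pS)) (JZ _ S2) S1 => /eqP; rewrite subr_eq0 => /eqP ->.
  by congr (_ * _); apply: eq_bigr => l _; rewrite JZ// mxE.
have uS : S \in unitmx by apply: posdef_unitmx => v v0; rewrite quadE pS.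
have : S *m T = (ellipsoid_volume S / 2)%:M.
  apply/matrixP => i k; rewrite !mxE; have := IBP i k.
  set X := \sum_l _ => h; have -> : X = (2 * X) / 2 by field.
  by rewrite h; case: eqP => _; rewrite ?mul1r ?mulr1n ?mul0r ?mulr0n.
move=> /(congr1 (mulmx (invmx S))); rewrite mulmxA mulVmx// mul1mx => ->.
by rewrite -mul_mx_scalar.
Qed.

End Density.

(** * Derivative of the volume density and Green's formula in one chart *)

Section Local_Green_formula.
Context {R : realType} {n : nat} {A : set 'rV[R]_n} {G : 'rV[R]_n -> 'M[R]_n}.
Hypothesis mG : metric_on A G.
Implicit Types (x y v : 'rV[R]_n) (a b c d : 'I_n) (F K : 'rV[R]_n -> R).
Local Notation E := (@basis_vec R n).
Local Notation U := (inner A).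

Let rA : relopen A := metric_on_relopen mG.
Let oU : open U := open_inner rA.

Lemma metric_posdef x : A x -> posdef (G x).
Proof. by move=> Ax v v0; rewrite -quadE; exact: (metric_on_pos mG). Qed.

Definition vol_density x : R := density (G x).

Lemma vol_density_gt0 x : A x -> 0 < vol_density x.
Proof. by move=> Ax; exact/density_gt0/metric_posdef. Qed.

Lemma vol_density_cvg x : A x -> vol_density y @[y --> within A (nbhs x)] --> vol_density x.
Proof.
move=> Ax; apply: density_cvg; last exact: metric_posdef.
by move=> i j; exact: (smooth_within_cvg (metric_on_smooth mG i j) Ax).
Qed.

Lemma inner_sub : U `<=` A. Proof. by move=> x []. Qed.

Lemma cvg_within_inner F x : U x -> F y @[y --> within A (nbhs x)] --> F x ->
  {for x, continuous F}.
Proof.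
move=> Ux h B /h; rewrite /nbhs /= /within /=.
move=> hB; have nU := open_nbhs_nbhs (conj oU Ux).
apply: (@filterS2 _ (nbhs x) (nbhs_filter x) _ _ _ _ hB nU) => y + Uy.
by apply; exact: inner_sub.
Qed.

Lemma smooth_christoffel c a b : smooth_within A (christoffel G c a b).
Proof.
apply: smooth_withinM; first exact: smooth_within_cst.
apply: smooth_within_sum => d; apply: smooth_withinM; first exact: (smooth_gi mG).
have s a' b' c' : smooth_within A (pd a' (fun y => G y b' c')).
  by apply: smooth_within_pd => //; exact: (metric_on_smooth mG).
by apply: smooth_withinB => //; exact: smooth_withinD.
Qed.

Lemma smooth_trace_Gam a : smooth_within A (fun x => \tr (Gam (G := G) a x)).
Proof.
have h : smooth_within A (fun x => \sum_c christoffel G c a c x).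
  by apply: smooth_within_sum => c; exact: smooth_christoffel.
by apply: (smooth_within_ext _ h) => x _; apply: eq_bigr => c _; rewrite mxE.
Qed.

Lemma shift_cvg_dnbhs x v : x + h *: v @[h --> (0 : R)^'] --> x.
Proof.
rewrite -[X in _ --> X]addr0 -(scale0r v).
by apply: (cvgD (cvg_cst x)); apply: cvgZr_tmp; exact: cvg_within.
Qed.

(** Differentiation under the integral gives minus the second moments contracted with the derivative
    of g; by [second_moments] these are half the volume times g^-1, and [trace_Gam] recognises the
    trace. *)
Lemma derive_volume x a : U x ->
  derivable (fun y => ellipsoid_volume (G y)) x (E a) /\
  'D_(E a) (fun y => ellipsoid_volume (G y)) x =
    - (ellipsoid_volume (G x) * \tr (Gam (G := G) a x)).
Proof.
move=> Ux; have Ax := inner_sub Ux; have pS := metric_posdef Ax.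
have CG i j : Ck 1 U (fun y => G y i j).
  exact: (smooth_inner_Ck _ rA (metric_on_smooth mG i j)).
have dG i j : derivable (fun y => G y i j) x (E a) by have [d _] := CG i j a; exact: d.
have Gc i j : G (x + h *: E a) i j @[h --> (0 : R)^'] --> G x i j.
  have cG : {for x, continuous (fun y => G y i j)} by apply: (CkS oU (CG i j)).
  exact: (cvg_comp _ _ (@shift_cvg_dnbhs x (E a)) cG).
pose P (h : R) v := h^-1 * (ellipsoid_bump (G (x + h *: E a)) v - ellipsoid_bump (G x) v).
pose P0 v := \sum_i \sum_j (- dmetric (G := G) a x i j) *
   (v ord0 i * v ord0 j * (2 * pos (1 - quad (G x) v))).
have cp : continuous (fun s : R => 2 * pos s).
  by move=> s; apply: cvgMr; exact: pos_continuous.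
have cc (l k : 'I_n) : continuous (fun v : 'rV[R]_n => v ord0 l * v ord0 k).
  by move=> v; exact: (cvgM (@coord_continuous R 1 n _ _ v) (@coord_continuous R 1 n _ _ v)).
have CT i j : Cc (fun v => v ord0 i * v ord0 j * (2 * pos (1 - quad (G x) v))).
  apply: (@Cc_bump_mul _ _ (G x) _ (fun s => 2 * pos s)) => //.
  by move=> s /pos_le0 ->; rewrite mulr0.
have JP0 : J P0 = - (ellipsoid_volume (G x) * \tr (Gam (G := G) a x)) /\ Cc P0.
  pose Q i v := \sum_j (- dmetric (G := G) a x i j) *
     (v ord0 i * v ord0 j * (2 * pos (1 - quad (G x) v))).
  have CQ i := J_sum (index_enum 'I_n) (fun j => CcZ (- dmetric (G := G) a x i j) (CT i j)).
  have [S1 S2] := J_sum (index_enum 'I_n) (fun i => (CQ i).2); split => //.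
  rewrite S1; have Ti i j : J (fun v => v ord0 i * v ord0 j * (2 * pos (1 - quad (G x) v))) =
      ellipsoid_volume (G x) / 2 * gi (G := G) x i j.
    have /matrixP/(_ i j) := second_moments pS (metric_on_sym mG Ax).
    by rewrite !mxE.
  rewrite (trace_Gam mG a Ax) /mxtrace !mulr_sumr -sumrN.
  rewrite (eq_bigr (fun i => \sum_j - dmetric (G := G) a x i j *
      (ellipsoid_volume (G x) / 2 * gi (G := G) x i j))); last first.
    by move=> i _; rewrite (CQ i).1; apply: eq_bigr => j _; rewrite JZ// Ti.
  rewrite exchange_big /=; apply: eq_bigr => j _.
  rewrite mxE !mulr_sumr -sumrN; apply: eq_bigr => i _.
  have gs : gi (G := G) x i j = gi (G := G) x j i by rewrite -[in LHS](gi_sym mG Ax) mxE.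
  by rewrite gs; ring.
have HJ : J (P h) @[h --> (0 : R)^'] --> J P0.
  have [N hN] := @bump_supp R n R (0 : R)^' (fun h => G (x + h *: E a)) (G x) _ Gc pS.
  have [M hM] := posdef_bump_supp pS.
  have [cP0 [M' hM']] := JP0.2.
  apply: (@J_cvg R n _ _ _ _ (N + M + M')) => //.
  - by apply: supp_le_leq hM'; rewrite leq_addl.
  - apply: filterS hN => h hh; split.
      move=> v; have b1 := @ellipsoid_bump_continuous R n (G (x + h *: E a)) v.
      have b2 := @ellipsoid_bump_continuous R n (G x) v.
      exact: (cvgM (cvg_cst _) (cvgB b1 b2)).
    move=> v hv; have [h1 h2] : N%:R < `|v| /\ M%:R < `|v|.
      split; apply: le_lt_trans hv; rewrite ler_nat -?addnA ?leq_addr//.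
      by rewrite addnCA leq_addr.
    by rewrite /P /ellipsoid_bump !sqpos_le0 ?subrr ?mulr0//; [exact: hM|exact: hh].
  - move=> v; rewrite /P /ellipsoid_bump.
    have hc : quad (G (x + z.1 *: E a)) z.2 @[z --> ((0 : R)^', nbhs v)] --> quad (G x) v.
      apply: quad_cvg => [i j|i]; first exact: (cvg_comp _ _ cvg_fst (Gc i j)).
      by apply: coord_cvg; exact: cvg_snd.
    have hd : quad (G x) z.2 @[z --> ((0 : R)^', nbhs v)] --> quad (G x) v.
      exact: (cvg_comp (fun z : R * 'rV[R]_n => z.2) (quad (G x)) cvg_snd
        (@quad_continuous _ _ (G x) v)).
    have hq : z.1^-1 * (1 - quad (G (x + z.1 *: E a)) z.2 - (1 - quad (G x) z.2))
       @[z --> ((0 : R)^', nbhs v)] -->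
       - \sum_i \sum_j v ord0 i * v ord0 j * 'D_(E a) (fun y => G y i j) x.
      have -> : (fun z : R * 'rV[R]_n =>
           z.1^-1 * (1 - quad (G (x + z.1 *: E a)) z.2 - (1 - quad (G x) z.2))) =
         (fun z => - \sum_i \sum_j z.2 ord0 i * z.2 ord0 j *
             (z.1^-1 * (G (x + z.1 *: E a) i j - G x i j))).
        apply/funext => z; have e (p q : R) : 1 - p - (1 - q) = - (p - q) by ring.
        rewrite e mulrN; congr (- _); rewrite /quad.
        rewrite -sumrB mulr_sumr; apply: eq_bigr => i _.
        rewrite -sumrB mulr_sumr; apply: eq_bigr => j _; ring.
      apply: cvgN; apply: cvg_sumR => i; apply: cvg_sumR => j; apply: cvgM.
        by apply: cvgM; apply: coord_cvg; exact: cvg_snd.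
      exact: (cvg_comp _ _ cvg_fst (derive_quotient (dG i j))).
    have h1 : 1 - quad (G (x + z.1 *: E a)) z.2 @[z --> ((0 : R)^', nbhs v)] --> 1 - quad (G x) v.
      exact: (cvgB (cvg_cst _) hc).
    have h2 : 1 - quad (G x) z.2 @[z --> ((0 : R)^', nbhs v)] --> 1 - quad (G x) v.
      exact: (cvgB (cvg_cst _) hd).
    have h3 := @sqpos_chain R _ _ fst _ _ _ _ _ h1 h2 hq.
    rewrite (_ : P0 v = 2 * pos (1 - quad (G x) v) *
       - \sum_i \sum_j v ord0 i * v ord0 j * 'D_(E a) (fun y => G y i j) x); first exact: h3.
    rewrite /P0; move: (2 * pos (1 - quad (G x) v)) => r; rewrite mulrN mulr_sumr -sumrN; apply: eq_bigr => i _.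
    rewrite mulr_sumr -sumrN; apply: eq_bigr => j _.
    rewrite mxE (pd_inner a rA (CG i j) Ux); ring.
apply: is_derive_quotient; rewrite -JP0.1.
apply: (cvg_trans _ HJ); apply: near_eq_cvg.
have nU : \forall h \near (0 : R)^', U (x + h *: E a).
  exact: (@shift_cvg_dnbhs x (E a) _ (open_nbhs_nbhs (conj oU Ux))).
apply: filterS nU => h /inner_sub Ah; have pSh := metric_posdef Ah.
have C1 := Cc_ellipsoid_bump pSh; have C2 := Cc_ellipsoid_bump pS.
by rewrite /P (JZ _ (CcB C1 C2)) (JB C1 C2).
Qed.

(** The differential equation satisfied by sqrt (det g), on which [Green_coord] rests. *)
Lemma derive_vol_density x a : U x ->
  derivable vol_density x (E a) /\
  'D_(E a) vol_density x = vol_density x * \tr (Gam (G := G) a x).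
Proof.
move=> Ux; have [d1 d2] := derive_volume a Ux.
have V0 : ellipsoid_volume (G x) != 0.
  by rewrite gt_eqF// ellipsoid_volume_gt0//; exact/metric_posdef/inner_sub.
split; first exact: derivableV.
have -> : vol_density = (fun y => (ellipsoid_volume (G y))^-1) by [].
have dV := @deriveV R _ (fun y => ellipsoid_volume (G y)) x (E a) V0 d1.
rewrite dV d2; move: (ellipsoid_volume (G x)) V0 (\tr _) => r V0 t.
by rewrite -[LHS]/(_ * _); field.
Qed.

Lemma Ck1_vol_density : Ck 1 U vol_density.
Proof.
have c0 : Ck 0 U vol_density.
  by move=> x Ux; apply: cvg_within_inner => //; exact/vol_density_cvg/inner_sub.
move=> a; split; first by move=> x Ux; exact: (derive_vol_density a Ux).1.
apply: (@Ck_ext _ _ 0 U (fun x => vol_density x * \tr (Gam (G := G) a x))) => //.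
  by move=> x Ux; rewrite (derive_vol_density a Ux).2.
exact: (CkM oU c0 (smooth_inner_Ck 0 rA (smooth_trace_Gam a))).
Qed.

Lemma csupp_mul V F K : csupp V K -> csupp V (fun x => F x * K x).
Proof. by move=> [C [cC CV C0]]; exists C; split => // x /C0 ->; rewrite mulr0. Qed.

(** The integrand is the coordinate divergence of density * F * grad K: the derivative of the
    density supplies the Christoffel trace that [divergence_grad] needs. *)
Lemma Green_coord F K : Ck 1 U F -> csupp U F -> smooth_within A K ->
  J (fun x => vol_density x * (coord_grad_prod (G := G) F K x
                               + F x * coord_laplacian G K x)) = 0.
Proof.
move=> cF sF sK.
pose k a x := (gi (G := G) x *m (pd_row K x)^T) a ord0.
have sk a : smooth_within A (k a).
  have h : smooth_within A (fun x => \sum_b gi (G := G) x a b * pd b K x).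
    apply: smooth_within_sum => b; apply: smooth_withinM; first exact: (smooth_gi mG).
    exact: smooth_within_pd.
  by apply: (smooth_within_ext _ h) => x _; rewrite /k mxE; apply: eq_bigr => b _; rewrite !mxE.
have ck a := smooth_inner_Ck 1 rA (sk a).
pose Y a x := vol_density x * k a x * F x.
have cY a : Ck 1 U (Y a) by exact: (CkM oU (CkM oU Ck1_vol_density (ck a)) cF).
have sY a : csupp U (Y a) by exact: csupp_mul.
have dY a := csupp_derivable oU (cY a) (sY a).
have J0 a : J ('D_(E a) (Y a)) = 0.
  by have [h1 h2 h3 h4] := dY a; apply: J_derive0.
have CdY a : Cc ('D_(E a) (Y a)) by have [_ _ _] := dY a.
have [S1 _] := J_sum (index_enum 'I_n) CdY.
rewrite [RHS](_ : 0 = \sum_a J ('D_(E a) (Y a))); last by rewrite big1.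
rewrite -S1; apply: J_eq => x.
have [Ux|nUx] := pselect (U x); last first.
  rewrite big1; last first.
    move=> a _; have [_ _ h _] := dY a; have [C [_ CU C0]] := h a.
    by apply: C0 => /CU.
  have [C [cC CU C0]] := sF.
  have nC : ~ C x by move=> /CU.
  have F0 a : pd a F x = 0.
    apply: has_pdE; apply: (@has_pd_ext _ _ a (fun=> 0)); last exact: has_pd_cst.
      by rewrite C0.
    have nS : \forall h \near 0^'+, ~ C (x + h *: E a).
      exact: (@shift_cvg0 _ _ x (E a) _ (near_compact_compl cC nC)).
    by apply: filterS nS => h /C0.
  rewrite C0// mul0r addr0 /coord_grad_prod.
  have -> : pd_row F x = 0 by apply/rowP => a; rewrite !mxE F0.
  by rewrite !mul0mx mxE mulr0.
have Ax := inner_sub Ux; have [D hD DE] := divergence_grad mG sK Ax.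
have dYE a : 'D_(E a) (Y a) x = vol_density x * k a x * pd a F x +
    (vol_density x * D a + vol_density x * \tr (Gam (G := G) a x) * k a x) * F x.
  have [d1 d2] := derive_vol_density a Ux.
  have hF : has_pd a F x (pd a F x).
    by rewrite (pd_inner a rA cF Ux); apply: derivable_has_pd; have [h _] := cF a; exact: h.
  have h1 := has_pdM (has_pdM (derivable_has_pd d1) (hD a)) hF.
  have h2 : has_pd a (Y a) x ('D_(E a) (Y a) x).
    by have [_ h _ _] := dY a; exact: (derivable_has_pd (h a x)).
  by rewrite -(has_pdE h2) (has_pdE h1) d2.
under eq_bigr do rewrite dYE.
rewrite big_split /= -mulr_suml big_split /= -mulr_sumr.
have -> : \sum_a vol_density x * \tr (Gam (G := G) a x) * k a x =
   vol_density x * \sum_a \tr (Gam (G := G) a x) * k a x.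
  by rewrite mulr_sumr; apply: eq_bigr => a _; rewrite mulrA.
rewrite -mulrDr DE mulrDr; congr (_ + _); last by rewrite mulrA mulrAC.
rewrite /coord_grad_prod -mulmxA mxE mulr_sumr; apply: eq_bigr => a _.
by rewrite mxE -/(k a x); ring.
Qed.

End Local_Green_formula.

(** * Change of variables *)

Lemma cvg_cont (T : Type) (FT : set_system T) (X Y : topologicalType)
    (f : T -> X) (h : X -> Y) (x : X) :
  f @ FT --> x -> {for x, continuous h} -> h (f t) @[t --> FT] --> h x.
Proof. by move=> fx hx; exact: (cvg_comp _ _ fx hx). Qed.

Section Change_of_variables.
Context {R : realType} {n : nat}.
Implicit Types (x y v w : 'rV[R]_n) (a b : 'I_n) (e : R).
Local Notation E := (@basis_vec R n).

Lemma rV_cvg (T : Type) (FT : set_system T) (f : T -> 'rV[R]_n) (l : 'rV[R]_n) :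
  Filter FT -> (forall a, f t ord0 a @[t --> FT] --> l ord0 a) -> f @ FT --> l.
Proof.
move=> FF h; apply/cvgrPdist_le => e e0.
have : \forall t \near FT, forall a, `|l ord0 a - f t ord0 a| <= e.
  apply: (@filter_forall _ _ (fun a t => `|l ord0 a - f t ord0 a| <= e)) => a.
  by have /cvgrPdist_le := h a; apply.
apply: filterS => t ht; apply: norm_le_coord => [|a]; first exact: ltW.
by rewrite !mxE.
Qed.

Lemma partials_lipschitz (F : 'rV[R]_n -> R) p : partials_near F p ->
  exists2 L : R, 0 < L & \forall z \near (p, p), `|F z.2 - F z.1| <= L * `|z.2 - z.1|.
Proof.
move=> pF; pose C := \sum_a `|'D_(E a) F p|.
have C0 : 0 <= C by rewrite sumr_ge0.
exists (C + 1); first by rewrite ltr_wpDl.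
have := strict_differentiable pF ltr01; apply: filterS => -[y z] /= h.
rewrite -(subrK (\sum_a 'D_(E a) F p * (z - y) ord0 a) (F z - F y)).
apply: (le_trans (ler_normD _ _)); rewrite mulrDl addrC; apply: lerD => //.
apply: (le_trans (ler_norm_sum _ _ _)); rewrite mulr_suml; apply: ler_sum => a _.
by rewrite normrM ler_wpM2l//; exact: coord_le_norm.
Qed.

(** Row vector convention: [w *m differential S y] is the derivative of S at y along w. *)
Definition differential (S : 'rV[R]_n -> 'rV[R]_n) y : 'M[R]_n :=
  \matrix_(a, b) 'D_(E a) (fun z => S z ord0 b) y.

Variables (A B : set 'rV[R]_n) (G H : 'rV[R]_n -> 'M[R]_n).
Hypotheses (mG : metric_on A G) (mH : metric_on B H).
Variables (Kx Ky : set 'rV[R]_n) (S T : 'rV[R]_n -> 'rV[R]_n).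
Hypotheses (cKx : compact Kx) (cKy : compact Ky).
Hypotheses (KxA : Kx `<=` inner A) (KyB : Ky `<=` inner B).
Hypotheses (SK : forall y, Ky y -> Kx (S y)) (TK : forall x, Kx x -> Ky (T x)).
(** Asked near each point, because the blow-up limit is taken while the base point tends to x; [TS]
    is used at points of [Ky] alone. *)
Hypothesis ST : forall x, Kx x -> \forall z \near x, S (T z) = z.
Hypothesis TS : forall y, Ky y -> T (S y) = y.
Hypothesis dS : forall y b, Ky y -> partials_near (fun z => S z ord0 b) y.
Hypothesis dT : forall x b, Kx x -> partials_near (fun z => T z ord0 b) x.
Hypothesis HG : forall y, Ky y ->
  H y = differential S y *m G (S y) *m (differential S y)^T.
Variables (f g : 'rV[R]_n -> R).
Hypotheses (cf : continuous f) (cg : continuous g).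
Hypotheses (f0 : forall x, ~ Kx x -> f x = 0) (g0 : forall y, ~ Ky y -> g y = 0).
Hypothesis fg : forall x, Kx x -> f x = g (T x).

Let Gc x : Kx x -> forall a b, {for x, continuous (fun z => G z a b)}.
Proof.
move=> Kx1 a b; apply: (cvg_within_inner mG (KxA Kx1)).
exact: (smooth_within_cvg (metric_on_smooth mG a b) (inner_sub (KxA Kx1))).
Qed.

Let Gp x : Kx x -> posdef (G x).
Proof. by move=> /KxA /inner_sub; exact: metric_posdef. Qed.

Let Hp y : Ky y -> posdef (H y).
Proof. by move=> /KyB /inner_sub; exact: metric_posdef. Qed.

Let Sc y : Ky y -> {for y, continuous S}.
Proof.
by move=> Ky1; apply: (@rV_cvg _ (nbhs y) S) => a; exact: (partials_continuous (dS a Ky1)).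
Qed.

Let Tc x : Kx x -> {for x, continuous T}.
Proof.
by move=> Kx1; apply: (@rV_cvg _ (nbhs x) T) => a; exact: (partials_continuous (dT a Kx1)).
Qed.

Let GSc y : Ky y -> forall a b, G (S z) a b @[z --> y] --> G (S y) a b.
Proof. by move=> Ky1 a b; exact: (cvg_cont (Sc Ky1) (@Gc _ (SK Ky1) a b)). Qed.

Let rGc x : Kx x -> {for x, continuous (vol_density (G := G))}.
Proof.
by move=> Kx1; apply: (density_cvg (FT := nbhs x) (S := G)); [exact: Gc|exact: Gp].
Qed.

Let rHc y : Ky y -> {for y, continuous (vol_density (G := H))}.
Proof.
move=> Ky1; apply: (cvg_within_inner mH (KyB Ky1)).
exact: (vol_density_cvg mH (inner_sub (KyB Ky1))).
Qed.

Let coercive : exists2 c : R, 0 < c & forall y, Ky y -> forall v, c * `|v| ^+ 2 <= quad (G (S y)) v.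
Proof.
have /compact_near_coveringP nc := cKy.
have := nc R (0^'+) (fun c y => Ky y -> forall v, c * `|v| ^+ 2 <= quad (G (S y)) v) _.
move=> /(_ _) [].
  move=> y Ky1.
  have [c c0 hc] := @posdef_coercive R n _ (nbhs y) (fun z => G (S z)) (G (S y)) (nbhs_filter y)
    (@GSc y Ky1) (Gp (SK Ky1)).
  exists ([set z | forall v, c * `|v| ^+ 2 <= quad (G (S z)) v], [set r | r <= c]).
    by split => //=; exact: nbhs_right_le.
  move=> [z r] /= [hz rc] _ v; apply: le_trans (hz v).
  by rewrite ler_wpM2r// sqr_ge0.
move=> e /= e0 he; exists (e / 2); first by rewrite divr_gt0.
move=> y Ky1; apply: (he (e / 2) _ _ y Ky1 Ky1).
  by rewrite /= sub0r normrN gtr0_norm ?divr_gt0//; lra.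
by rewrite divr_gt0.
Qed.

(* Mollification at scale e by the ellipsoids of the metric: integrating the
   kernel in x recovers the mass of g at y, and integrating it in y, after
   blowing up by e, that of f at x. With Fubini and e -> 0 this gives the change
   of variables without a Jacobian determinant. *)
Definition kernel (e : R) x y : R :=
  g y * vol_density (G := H) y * vol_density (G := G) (S y)
  * ellipsoid_bump (G (S y)) (e^-1 *: (x - S y)).

Let kernel0 e x y : ~ Ky y -> kernel e x y = 0.
Proof. by move=> /g0 gy; rewrite /kernel gy !mul0r. Qed.

Let kernel_continuous e : 0 < e -> continuous (fun z => kernel e z.1 z.2).
Proof.
move=> e0 [x y]; have [Ky1|nK] := pselect (Ky y); last first.
  rewrite /continuous_at kernel0// => P P0.
  have nK2 := near_compact_compl cKy nK.
  exists (setT, [set z | ~ Ky z]) => /=; first by split => //; exact: filterT.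
  by move=> [x' y'] /= [_ nKy']; rewrite kernel0//; exact: nbhs_singleton.
have s2 : S z.2 @[z --> (x, y)] --> S y by exact: (cvg_cont cvg_snd (Sc Ky1)).
have hq : quad (G (S z.2)) (e^-1 *: (z.1 - S z.2)) @[z --> (x, y)] -->
    quad (G (S y)) (e^-1 *: (x - S y)).
  apply: quad_cvg => [a b|a].
    exact: (cvg_comp (fun z : 'rV[R]_n * 'rV[R]_n => z.2) (fun z => G (S z) a b)
      cvg_snd (@GSc _ Ky1 a b)).
  have h1 : e^-1 *: (z.1 - S z.2) @[z --> (x, y)] --> e^-1 *: (x - S y).
    have h2 : z.1 - S z.2 @[z --> (x, y)] --> x - S y by exact: (cvgB cvg_fst s2).
    exact: (cvg_cont h2 (@scaler_continuous _ _ e^-1 _)).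
  exact: (coord_cvg _ h1).
have hb : 1 - quad (G (S z.2)) (e^-1 *: (z.1 - S z.2)) @[z --> (x, y)] -->
    1 - quad (G (S y)) (e^-1 *: (x - S y)) by exact: (cvgB (cvg_cst _) hq).
apply: cvgM; last exact: (cvg_cont hb (@sqpos_continuous R _)).
apply: cvgM; last exact: (cvg_cont s2 (rGc (SK Ky1))).
apply: cvgM; first exact: (cvg_cont cvg_snd (@cg y)).
exact: (cvg_cont cvg_snd (rHc Ky1)).
Qed.

Let kernel_supp : exists2 L : R, 0 < L & forall e x y, 0 < e -> kernel e x y != 0 ->
  Ky y /\ `|x - S y| <= L * e.
Proof.
(* With r = |x - S y| / e, coercivity gives r^2 <= c^-1 where the kernel is nonzero, and then r <=
   c^-1 + 1 without a square root. *)
have [c c0 hc] := coercive; exists (c^-1 + 1); first by rewrite ltr_wpDl// invr_ge0 ltW.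
move=> e x y e0 kn; have Ky1 : Ky y.
  by have [//|/kernel0 k0] := pselect (Ky y); rewrite k0 eqxx in kn.
split => //; rewrite -ler_pdivrMr//.
have := hc y Ky1 (e^-1 *: (x - S y)); rewrite normrZ gtr0_norm ?invr_gt0// [_^-1 * _]mulrC.
set r := _ / e => h; have r0 : 0 <= r by rewrite divr_ge0// ltW.
have q1 : quad (G (S y)) (e^-1 *: (x - S y)) <= 1.
  rewrite leNgt; apply/negP => q1; move: kn; rewrite /kernel /ellipsoid_bump sqpos_le0 ?mulr0 ?eqxx//.
  by rewrite subr_le0 ltW.
have : r ^+ 2 <= c^-1 by rewrite -[c^-1]mul1r ler_pdivlMr// mulrC (le_trans h).
have : 0 <= c^-1 by rewrite invr_ge0 ltW.
by rewrite expr2; nra.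
Qed.

Let kernel_bounded : exists N, supp_le f N /\ (forall e x y, 0 < e -> e <= 1 ->
  N%:R < `|x| \/ N%:R < `|y| -> kernel e x y = 0).
Proof.
have [L L0 hL] := kernel_supp.
have bK (K : set 'rV[R]_n) : compact K -> exists N, forall x, K x -> `|x| <= N%:R.
  move=> /compact_bounded [M [_ hM]]; have [N hN] := nat_ge (`|M| + 1).
  exists N => x Kx1; apply: le_trans hN; apply: hM => //.
  by apply: (le_lt_trans (ler_norm M)); rewrite ltrDl.
have [N1 h1] := bK _ cKx; have [N2 h2] := bK _ cKy; have [N3 h3] := nat_ge L.
have p1 : 0 <= N1%:R :> R by []; have p2 : 0 <= N2%:R :> R by []; have p3 : 0 <= N3%:R :> R by [].
exists (N1 + N2 + N3)%N; split=> [x|e x y e0 e1 hxy].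
  by rewrite !natrD => hx; apply: f0 => /h1; lra.
apply/eqP; apply: contraT => kn.
have [Ky1 xS] := hL e x y e0 kn; have := h1 _ (SK Ky1); have := h2 _ Ky1 => yN SN.
have x1 : `|x| <= N1%:R + N3%:R.
  rewrite -(subrK (S y) x) addrC; apply: (le_trans (ler_normD _ _)); apply: lerD => //.
  by apply: (le_trans xS); nra.
by move: hxy; rewrite !natrD => -[]; lra.
Qed.

(** It plays the role of e^n: by [J_scale], substituting e^-1 x multiplies the integral by this
    factor. *)
Definition dilation (e : R) : R := J (fun x : 'rV[R]_n => unit_bump (e^-1 *: x)).

Let dilation_gt0 e : 0 < e -> 0 < dilation e.
Proof. by move=> e0; apply: J_scale_gt0; rewrite invr_eq0 gt_eqF. Qed.

Let kernel_mass e y : 0 < e ->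
  J (fun x => kernel e x y) = dilation e * (g y * vol_density (G := H) y).
Proof.
move=> e0; have [Ky1|nK] := pselect (Ky y); last first.
  rewrite g0// mul0r mulr0 -[RHS](@J0 R n); apply: J_eq => x; exact: kernel0.
have pG := Gp (SK Ky1); have en : e^-1 != 0 by rewrite invr_eq0 gt_eqF.
have Cb := Cc_ellipsoid_bump pG.
rewrite (JZ _ (Cc_shift (- S y) (Cc_scale en Cb) : Cc (fun x => ellipsoid_bump (G (S y)) (e^-1 *: (x - S y))))).
rewrite (J_shift (- S y) (Cc_scale en Cb)) (J_scale en Cb).
rewrite -/(dilation e) -/(ellipsoid_volume (G (S y))) /vol_density /density.
have V0 : ellipsoid_volume (G (S y)) != 0 by rewrite gt_eqF// ellipsoid_volume_gt0.
by rewrite mulrCA divfK.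
Qed.

(** The kernel as a function of y, seen at scale e around the point that corresponds to x. *)
Let blowup e x w : R := kernel e x (T x + e *: w).

Let blowup_int e x : 0 < e -> e <= 1 -> Cc (kernel e x) ->
  J (kernel e x) = dilation e * J (blowup e x).
Proof.
move=> e0 e1 Ck1; have en : e != 0 by rewrite gt_eqF.
have en' : e^-1 != 0 by rewrite invr_eq0.
have C1 := Cc_shift (T x) Ck1; have C2 := Cc_scale en C1.
have -> : blowup e x = (fun w => kernel e x (e *: w + T x)).
  by apply/funext => w; rewrite /blowup addrC.
rewrite -(J_scale en' C2) -(J_shift (T x) Ck1); apply: J_eq => w.
by rewrite scalerA divff// scale1r.
Qed.

(** The limit ellipsoid is that of H at T x, so its mass cancels the density of H and leaves the
    density of G. *)
Let limit_bump x w : R := g (T x) * vol_density (G := H) (T x) * vol_density (G := G) x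
  * ellipsoid_bump (H (T x)) w.

Let limit_bump_int x : Kx x -> J (limit_bump x) = f x * vol_density (G := G) x.
Proof.
move=> Kx1; have pH := Hp (TK Kx1); rewrite (JZ _ (Cc_ellipsoid_bump pH)) fg//.
rewrite -/(ellipsoid_volume (H (T x))) /vol_density {1}/density.
have V0 : ellipsoid_volume (H (T x)) != 0 by rewrite gt_eqF// ellipsoid_volume_gt0.
by field.
Qed.

Let quad_congr (P Q : 'M[R]_n) w : quad Q (w *m P) = quad (P *m Q *m P^T) w.
Proof. by rewrite -!quadE trmx_mul !mulmxA. Qed.

(** By [cvg_chain] the rescaled difference x' - S (T x' + e w') tends to minus the image of w under
    the differential of S; by [HG] its G-square is the H-square of w. *)
Let blowup_cvg x w : Kx x ->
  blowup z.1.1 z.1.2 z.2 @[z --> (((0 : R)^'+, nbhs x), nbhs w)] --> limit_bump x w.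
Proof.
move=> Kx1; have Ky1 := TK Kx1; have STx : S (T x) = x by exact: nbhs_singleton (ST Kx1).
pose FT : set_system (R * 'rV[R]_n * 'rV[R]_n) := filter_prod (filter_prod (0 : R)^'+ (nbhs x)) (nbhs w).
have ce : z.1.1 @[z --> FT] --> (0 : R).
  have h : (h : R) @[h --> 0^'+] --> (0 : R) by apply: cvg_dnbhs_at_right; exact: cvg_within.
  exact: (cvg_comp _ _ (cvg_comp _ _ cvg_fst cvg_fst) h).
have cx : z.1.2 @[z --> FT] --> x by exact: (cvg_comp _ _ cvg_fst cvg_snd).
have cw : z.2 @[z --> FT] --> w by exact: cvg_snd.
have cTx : T z.1.2 @[z --> FT] --> T x by exact: (cvg_cont cx (Tc Kx1)).
have cy : T z.1.2 + z.1.1 *: z.2 @[z --> FT] --> T x.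
  have h1 : z.1.1 *: z.2 @[z --> FT] --> 0 *: w by exact: (cvgZ ce cw).
  have h2 : T z.1.2 + z.1.1 *: z.2 @[z --> FT] --> T x + 0 *: w by exact: (cvgD cTx h1).
  by move: h2; rewrite scale0r addr0.
have cS : S (T z.1.2 + z.1.1 *: z.2) @[z --> FT] --> x.
  by rewrite -[X in _ --> X]STx; exact: (cvg_cont cy (Sc Ky1)).
have cd (b : 'I_n) : ((z.1.1)^-1 *: (z.1.2 - S (T z.1.2 + z.1.1 *: z.2))) ord0 b @[z --> FT]
    --> (- (w *m differential S (T x))) ord0 b.
  have h1 : (z.1.1)^-1 * (S (T z.1.2 + z.1.1 *: z.2) ord0 b - S (T z.1.2) ord0 b) @[z --> FT]
     --> \sum_a 'D_(E a) (fun z => S z ord0 b) (T x) * w ord0 a.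
    apply: (@cvg_chain R n _ _ _ FT (fun z => z.1.1) (fun z => T z.1.2)
      (fun z => T z.1.2 + z.1.1 *: z.2) (fun a => w ord0 a)) => //.
      exact: (dS b Ky1).
    move=> a; have h3 : (fun z : R * 'rV[R]_n * 'rV[R]_n => z.2 ord0 a) @ FT --> w ord0 a by exact: (coord_cvg _ cw).
    apply: (cvg_trans _ h3); apply: near_eq_cvg.
    have n0 : \forall h \near 0^'+, 0 < (h : R) by exact: nbhs_right_gt.
    exists ([set h | 0 < h.1], setT) => /=.
      split; last exact: filterT.
      by exists ([set h | 0 < h], setT) => /=; [split => //; exact: filterT|move=> [? ?] []].
    move=> [[h x'] w'] /= [h0 _].
    by rewrite !mxE addrAC subrr add0r mulKf// gt_eqF.
  have h2 : - ((z.1.1)^-1 * (S (T z.1.2 + z.1.1 *: z.2) ord0 b - S (T z.1.2) ord0 b)) @[z --> FT]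
     --> - \sum_a 'D_(E a) (fun z => S z ord0 b) (T x) * w ord0 a by exact: cvgN.
  have -> : (- (w *m differential S (T x))) ord0 b =
      - \sum_a 'D_(E a) (fun z => S z ord0 b) (T x) * w ord0 a.
    by rewrite !mxE; congr (- _); apply: eq_bigr => a _; rewrite !mxE mulrC.
  apply: (cvg_trans _ h2); apply: near_eq_cvg.
  exists ([set h | S (T h.2) = h.2], setT) => /=.
    split; last exact: filterT.
    by exists (setT, [set z | S (T z) = z]) => /=;
      [split => //; [exact: filterT|exact: ST]|move=> [? ?] []].
  move=> [[h x'] w'] /= [Sx' _].
  by rewrite !mxE Sx' -mulrN opprB.
have cG (a b : 'I_n) : G (S (T z.1.2 + z.1.1 *: z.2)) a b @[z --> FT] --> G x a b.
  exact: (cvg_cont cS (@Gc _ Kx1 a b)).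
have cq : quad (G (S (T z.1.2 + z.1.1 *: z.2)))
   ((z.1.1)^-1 *: (z.1.2 - S (T z.1.2 + z.1.1 *: z.2))) @[z --> FT] --> quad (H (T x)) w.
  rewrite HG// STx -quad_congr.
  have -> : quad (G x) (w *m differential S (T x)) = quad (G x) (- (w *m differential S (T x))).
    by rewrite -scaleN1r quadZ sqrrN expr1n mul1r.
  by apply: quad_cvg.
have cb : 1 - quad (G (S (T z.1.2 + z.1.1 *: z.2)))
   ((z.1.1)^-1 *: (z.1.2 - S (T z.1.2 + z.1.1 *: z.2))) @[z --> FT] --> 1 - quad (H (T x)) w.
  exact: (cvgB (cvg_cst _) cq).
apply: cvgM; last exact: (cvg_cont cb (@sqpos_continuous R _)).
apply: cvgM; last exact: (cvg_cont cS (rGc Kx1)).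
apply: cvgM; first exact: (cvg_cont cy (@cg _)).
exact: (cvg_cont cy (rHc Ky1)).
Qed.

Let T_lipschitz x : Kx x -> exists2 L : R, 0 < L &
  \forall z \near (x, x), `|T z.2 - T z.1| <= L * `|z.2 - z.1|.
Proof.
move=> Kx1; have h b := partials_lipschitz (dT b Kx1).
pose l b := sval (cid2 (h b)).
have l0 b : 0 < l b by rewrite /l; case: cid2.
have hl b : \forall z \near (x, x), `|T z.2 ord0 b - T z.1 ord0 b| <= l b * `|z.2 - z.1|.
  by rewrite /l; case: cid2.
have L0 : 0 <= \sum_b l b by apply: sumr_ge0 => b _; exact: ltW.
exists (\sum_b l b + 1); first by rewrite ltr_wpDl.
have : \forall z \near (x, x), forall b, `|T z.2 ord0 b - T z.1 ord0 b| <= l b * `|z.2 - z.1|.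
  exact: (@filter_forall _ _ (fun b z => `|T z.2 ord0 b - T z.1 ord0 b| <= l b * `|z.2 - z.1|)
    (nbhs (x, x)) (nbhs_filter (x, x)) hl).
apply: filterS => -[y z] /= hz.
apply: norm_le_coord => [|b]; first by rewrite mulr_ge0// addr_ge0.
rewrite !mxE; apply: (le_trans (hz b)); rewrite ler_wpM2r// (bigD1 b)//= -addrA lerDl.
by rewrite addr_ge0// sumr_ge0// => c _; exact: ltW.
Qed.

(** If the kernel is nonzero at y = T x' + e w, then S y is within L e of x'; applying T, which is
    l-Lipschitz near x, gives e |w| <= l L e. *)
Let blowup_supp x : Kx x -> exists N, \forall z \near (filter_prod (0 : R)^'+ (nbhs x)),
  supp_le (blowup z.1 z.2) N.
Proof.
move=> Kx1; have [L L0 hL] := kernel_supp; have [l l0 hl] := T_lipschitz Kx1.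
have [N hN] := nat_ge (l * L); exists N.
have /nbhs_ballP[r r0 hr] := hl.
have r3 : 0 < r / 2 by rewrite divr_gt0.
have rL : 0 < r / 2 / L by rewrite divr_gt0.
exists ([set e | 0 < e < r / 2 / L], ball x (r / 2)) => /=.
  split; last exact: nbhsx_ballx.
  near=> e => /=; apply/andP; split; first by near: e; exact: nbhs_right_gt.
  by near: e; exact: nbhs_right_lt.
move=> [e x'] /= [/andP[e0 er] xx'] w hw; apply/eqP; apply: contraT => kn.
have [Ky1 xS] := hL e x' _ e0 kn.
set y := T x' + e *: w in Ky1 xS.
have Le : L * e < r / 2 by rewrite mulrC -ltr_pdivlMr.
have : `|T (S y) - T x'| <= l * `|S y - x'|.
  apply: (hr (x', S y)); split => /=; first by apply: le_ball xx'; lra.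
  rewrite -ball_normE /=; move: xx'; rewrite -ball_normE /= => xx'.
  rewrite -(subrK x' x) -addrA; apply: (le_lt_trans (ler_normD _ _)); lra.
rewrite TS// addrAC subrr add0r normrZ gtr0_norm// distrC => h.
have : e * `|w| <= l * (L * e) by apply: (le_trans h); rewrite ler_wpM2l// ltW.
rewrite mulrA mulrC ler_pM2r// => h2.
by move: hw; rewrite ltNge (le_trans h2 hN).
Unshelve. all: by end_near. Qed.

Lemma change_of_variables :
  J (fun x => f x * vol_density (G := G) x) = J (fun y => g y * vol_density (G := H) y).
Proof.
have [N [fN kN]] := kernel_bounded; have [L L0 hL] := kernel_supp.
(* The mollification of f times the density of G. Its integral does not depend on e, by Fubini and
   [kernel_mass], so its limit as e tends to 0 yields the identity. *)
pose m e x := (dilation e)^-1 * J (kernel e x).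
have k4 e (e0 : 0 < e) (e1 : e <= 1) :=
  Cc_param (kernel_continuous e0) (fun x y => kN e x y e0 e1).
have Jm e : 0 < e -> e <= 1 -> J (m e) = J (fun y => g y * vol_density (G := H) y).
  move=> e0 e1; have [C1 C2 C3 C4] := k4 _ e0 e1.
  rewrite (JZ _ C3) (J_Fubini (kernel_continuous e0) (fun x y => kN e x y e0 e1)).
  have d0 : dilation e != 0 by rewrite gt_eqF// dilation_gt0.
  have -> : (fun y => J (kernel e ^~ y)) = (fun y => dilation e * (g y * vol_density (G := H) y)).
    by apply/funext => y; exact: kernel_mass.
  have Cg : Cc (fun y => g y * vol_density (G := H) y).
    have -> : (fun y => g y * vol_density (G := H) y) = (fun y => (dilation e)^-1 * J (kernel e ^~ y)).
      by apply/funext => y; rewrite kernel_mass// mulKf.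
    exact: CcZ.
  by rewrite (JZ _ Cg) mulKf.
have cP0 : continuous (fun x => f x * vol_density (G := G) x).
  move=> x; have [Kx1|nK] := pselect (Kx x); first exact: (cvgM (@cf x) (rGc Kx1)).
  rewrite /continuous_at f0// mul0r => P P0.
  have := near_compact_compl cKx nK; apply: filterS => z nKz /=.
  by rewrite f0// mul0r; exact: nbhs_singleton.
have sP0 : supp_le (fun x => f x * vol_density (G := G) x) N.
  by move=> x /fN fx; rewrite fx mul0r.
have e01 : \forall e \near (0 : R)^'+, 0 < e /\ e <= 1.
  near=> e; split; first by near: e; exact: nbhs_right_gt.
  by near: e; exact: nbhs_right_le.
have joint x : m z.1 z.2 @[z --> ((0 : R)^'+, nbhs x)] --> f x * vol_density (G := G) x.
  have [Kx1|nK] := pselect (Kx x); last first.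
    (* Off [Kx] the mollification vanishes for small e: a nonzero kernel would put the point S y of
       [Kx] within L e of x'. *)
    rewrite f0// mul0r => P P0.
    have /nbhs_ballP[r r0 hr] := near_compact_compl cKx nK.
    have r3 : 0 < r / 2 by rewrite divr_gt0.
    have rL : 0 < r / 2 / L by rewrite divr_gt0.
    exists ([set e | 0 < e < r / 2 / L], ball x (r / 2)) => /=.
      split; last exact: nbhsx_ballx.
      near=> e => /=; apply/andP; split; first by near: e; exact: nbhs_right_gt.
      by near: e; exact: nbhs_right_lt.
    move=> [e x'] /= [/andP[e0 er] xx'].
    have -> : m e x' = 0; last exact: nbhs_singleton.
    rewrite /m (_ : kernel e x' = fun=> 0) ?J0 ?mulr0//; apply/funext => y.
    apply/eqP; apply: contraT => kn; have [Ky1 xS] := hL e x' _ e0 kn.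
    have Le : L * e < r / 2 by rewrite mulrC -ltr_pdivlMr.
    exfalso; apply: (hr (S y)) (SK Ky1).
    rewrite -ball_normE /=; move: xx'; rewrite -ball_normE /= => xx'.
    rewrite -(subrK x' x) -addrA; apply: (le_lt_trans (ler_normD _ _)); lra.
  rewrite -(limit_bump_int Kx1); have [N1 hN1] := blowup_supp Kx1.
  have pH := Hp (TK Kx1); have [cb [N2 hN2]] := Cc_ellipsoid_bump pH.
  apply: (@cvg_trans _ (J (blowup z.1 z.2) @[z --> ((0 : R)^'+, nbhs x)])).
    apply: near_eq_cvg; exists ([set e | 0 < e /\ e <= 1], setT) => /=.
      by split => //; exact: filterT.
    move=> [e x'] /= [[e0 e1] _]; have [C1 _ _ _] := k4 _ e0 e1.
    by rewrite /m blowup_int// mulKf// gt_eqF// dilation_gt0.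
  apply: (@J_cvg R n _ (filter_prod (0 : R)^'+ (nbhs x)) (fun z => blowup z.1 z.2) (limit_bump x) (N1 + N2)%N).
  - move=> w; exact: (cvgM (cvg_cst _) (@cb w)).
  - move=> w hw; rewrite /limit_bump hN2 ?mulr0//; apply: le_lt_trans hw.
    by rewrite ler_nat leq_addl.
  - have e01' : \forall z \near (filter_prod (0 : R)^'+ (nbhs x)), 0 < z.1 /\ z.1 <= 1.
      exists ([set e | 0 < e /\ e <= 1], setT) => /=; first by split => //; exact: filterT.
      by move=> [e x'] /= [].
    apply: filterS2 hN1 e01' => -[e x'] /= s1 [e0 e1]; split.
      have [C1 _ _ _] := k4 _ e0 e1; have en : e != 0 by rewrite gt_eqF.
      have [c _] := Cc_scale en (Cc_shift (T x') (C1 x')).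
      have -> : blowup e x' = (fun w => kernel e x' (e *: w + T x')).
        by apply/funext => w; rewrite /blowup addrC.
      exact: c.
    by move=> w hw; apply: s1; apply: le_lt_trans hw; rewrite ler_nat leq_addr.
  - by move=> w; exact: blowup_cvg.
have h : J (m e) @[e --> 0^'+] --> J (fun x => f x * vol_density (G := G) x).
  apply: (@J_cvg R n _ (0 : R)^'+ m _ N) => //.
  apply: filterS e01 => e [e0 e1]; have [C1 C2 [C3 _] C4] := k4 _ e0 e1; split.
    move=> x; exact: (cvgM (cvg_cst _) (@C3 x)).
  move=> x hx; rewrite /m (_ : kernel e x = fun=> 0) ?J0 ?mulr0//; apply/funext => y.
  by apply: kN => //; left.
have h2 : J (m e) @[e --> 0^'+] --> J (fun y => g y * vol_density (G := H) y).
  apply: (cvg_trans _ (cvg_cst (J (fun y => g y * vol_density (G := H) y)) (F := (0 : R)^'+))).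
  by apply: near_eq_cvg; apply: filterS e01 => e [e0 e1]; rewrite Jm.
exact: (cvg_unique (@norm_hausdorff _ _) h h2).
Unshelve. all: by end_near. Qed.

End Change_of_variables.

(** * Charts *)

Section Charts.
Context {R : realType} {n : nat} {M : riemannian R n}.
Implicit Types (p q : M) (i j : Defs.index M) (x y : 'rV[R]_n) (u v : M -> R) (a b : 'I_n).
Implicit Types (U : set M).

Definition dom i : set M := domain (chart_of i).
Definition cc i : M -> 'rV[R]_n := Defs.coord (chart_of i).
Definition pp i : 'rV[R]_n -> M := param (chart_of i).
Definition im i U : set 'rV[R]_n := cc i @` (dom i `&` U).
Definition rng i : set 'rV[R]_n := cc i @` dom i.

Lemma ppK i p : dom i p -> pp i (cc i p) = p.
Proof. exact: paramK. Qed.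

Lemma cc_rng i p : dom i p -> rng i (cc i p).
Proof. by exists p. Qed.

Lemma rng_pp i x : rng i x -> dom i (pp i x) /\ cc i (pp i x) = x.
Proof. by move=> [p ip <-]; rewrite ppK. Qed.

Lemma imP i U x : im i U x <-> rng i x /\ U (pp i x).
Proof.
split=> [[p [ip Up] <-]|[[p ip <-]]]; first by rewrite ppK//; split => //; exists p.
by rewrite ppK// => Up; exists p.
Qed.

Lemma cc_im i U p : dom i p -> U p -> im i U (cc i p).
Proof. by move=> ip Up; exists p. Qed.

Lemma open_dom i : open (dom i).
Proof. exact: open_domain. Qed.

Lemma cc_continuous i p : dom i p -> {for p, continuous (cc i)}.
Proof.
move=> ip; have := @Defs.coord_continuous R n M (chart_of i).
rewrite continuous_open_subspace; last exact: open_domain.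
by move=> h; apply: (h p); exact/mem_set.
Qed.

Lemma pp_cvg i x : rng i x -> pp i y @[y --> within (rng i) (nbhs x)] --> pp i x.
Proof. by move=> Ax; have /subspace_continuousP := @param_continuous R n M (chart_of i); apply. Qed.

Lemma rng_half i x : rng i x -> half_space x.
Proof.
by move=> Ax; have [V _ e] := coord_range (chart_of i); have : (V `&` half_space) x by [rewrite -e]; case.
Qed.

Lemma relopen_im i U : open U -> relopen (im i U).
Proof.
move=> oU; have [V oV e] := coord_range (chart_of i).
exists (V `&` [set x | rng i x -> U (pp i x)]^°); first by apply: openI => //; exact: open_interior.
apply/seteqP; split => x.
  move=> /imP[Ax Ux]; have : (V `&` half_space) x by rewrite -e.
  move=> [Vx hx]; split => //; split => //.
  have := @pp_cvg i x Ax U (open_nbhs_nbhs (conj oU Ux)).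
  by apply: filterS => y; exact.
move=> [[Vx /nbhs_singleton /= Ux] hx]; apply/imP; have Ax : rng i x by rewrite /rng -/(_ @` _) e.
by split => //; exact: Ux.
Qed.

Lemma im_setT i : im i setT = rng i.
Proof. by rewrite /im setIT. Qed.

Lemma relopen_rng i : relopen (rng i).
Proof. by rewrite -im_setT; apply: relopen_im; exact: openT. Qed.

Lemma metric_chart i : metric_on (rng i) (metric M i).
Proof.
split; first exact: relopen_rng.
- exact: metric_smooth.
- by move=> x [p ip <-]; rewrite Defs.metric_sym.
- by move=> x v [p ip <-] v0; exact: (metric_pos ip v0).
Qed.

Definition trans i j x := cc j (pp i x).

Lemma smooth_trans i j a : smooth_within (im i (dom j)) (fun x => trans i j x ord0 a).
Proof. exact: smooth_transition. Qed.

Lemma derive_at_min (F : 'rV[R]_n -> R) x w : derivable F x w ->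
  (\forall y \near x, F x <= F y) -> 'D_w F x = 0.
Proof.
move=> dF minF; have /cvgrPdist_lt hq := derive_quotient dF.
apply/eqP; apply: contraT => l0; have l1 : 0 < `|'D_w F x| by rewrite normr_gt0.
have := hq _ l1; rewrite /dnbhs /within /= => /nbhs_ballP[e /= e0 he].
have c : x + h *: w @[h --> (0 : R)] --> x.
  rewrite -[X in _ --> X]addr0 -(scale0r w).
  exact: (cvgD (cvg_cst x) (cvgZr_tmp (cvg_id))).
have /nbhs_ballP[e' /= e'0 he'] := c _ minF.
pose h := Num.min e e' / 2; have h0 : 0 < h by rewrite divr_gt0// lt_min e0 e'0.
have hm : h < Num.min e e' by rewrite ltr_pdivrMr// ltr_pMr ?lt_min ?e0 ?e'0//; lra.
have [h1 h2] : h < e /\ h < e' by apply/andP; rewrite -lt_min.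
have q s : `|s| = h -> s != 0 -> 0 <= F (x + s *: w) - F x /\
    `|'D_w F x - s^-1 * (F (x + s *: w) - F x)| < `|'D_w F x|.
  move=> sh s0; split; last by apply: he => //; rewrite /ball /= sub0r normrN sh.
  by rewrite subr_ge0; apply: he'; rewrite /ball /= sub0r normrN sh.
have [p1 p2] := q h (gtr0_norm h0) (lt0r_neq0 h0).
have [m1 m2] : 0 <= F (x + - h *: w) - F x /\
    `|'D_w F x - (- h)^-1 * (F (x + - h *: w) - F x)| < `|'D_w F x|.
  by apply: q; rewrite ?normrN ?gtr0_norm// oppr_eq0 gt_eqF.
have hi : 0 < h^-1 by rewrite invr_gt0.
have P1 := mulr_ge0 (ltW hi) p1; have P2 := mulr_ge0 (ltW hi) m1.
move: m2 p2; rewrite invrN mulNr opprK; move: P1 P2; set X := _ * _; set Y := _ * _; move: l0.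
case: (ltrgtP ('D_w F x) 0) => [l0|l0|->] _ X0 Y0 //; [rewrite !(ltr0_norm l0)|rewrite !(gtr0_norm l0)];
  rewrite !ltr_norml => /andP[? ?] /andP[? ?]; lra.
Qed.

(** A single notion that covers smooth functions at boundary points and C^1 cutoffs at interior
    points. *)
Definition C1_at i p u := exists V F, [/\ open V, V (cc i p), Ck 1 V F &
  forall x, V x -> rng i x -> u (pp i x) = F x].

Lemma smooth_C1_at i p u : dom i p -> smooth u -> C1_at i p u.
Proof.
move=> ip su; have [V [F [oV Vp CF uF]]] := su i _ (cc_rng ip).
by exists V, F; split.
Qed.

Lemma C1_at_pd i p u : dom i p -> C1_at i p u ->
  exists2 F, partials_near F (cc i p) & exists2 V, open V /\ V (cc i p) &
   (forall x, V x -> rng i x -> u (pp i x) = F x) /\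
   forall a, pd a (u \o pp i) (cc i p) = 'D_(basis_vec a) F (cc i p).
Proof.
move=> ip [V [F [oV Vp CF uF]]]; exists F; first exact: Ck1_partials Vp.
exists V => //; split => // a; apply: has_pdE.
exact: (@smooth_has_pd R n _ _ _ _ _ a (relopen_rng i) (cc_rng ip) oV Vp CF uF).
Qed.

Lemma has_pd_trans i j p a b : dom i p -> dom j p ->
  has_pd a (fun x => trans i j x ord0 b) (cc i p) (jacobian_at i j p a b).
Proof.
move=> ip jp; rewrite mxE.
exact: (@smooth_pd R n _ _ _ a (relopen_im i (open_dom j)) (@smooth_trans i j b) (cc_im ip jp)).
Qed.

(** A coordinate line of chart i becomes a curve in chart j that [pd] does not follow, so the chain
    rule is applied to a C^1 extension of u in chart j. *)
Lemma pd_trans i j p u a : dom i p -> dom j p -> C1_at j p u ->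
  has_pd a (u \o pp i) (cc i p)
    (\sum_b jacobian_at i j p a b * pd b (u \o pp j) (cc j p)).
Proof.
move=> ip jp /(C1_at_pd jp)[F pF [V [oV Vp] [uF pdF]]].
have tE : trans i j (cc i p) = cc j p by rewrite /trans ppK.
have ht b := @has_pd_trans i j p a b ip jp.
have ct : trans i j (cc i p + h *: basis_vec a) @[h --> (0 : R)^'+] --> cc j p.
  apply: rV_cvg => b; rewrite -tE; exact: (has_pd_right_continuous (ht b)).
have : h^-1 * (F (trans i j (cc i p + h *: basis_vec a)) - F (cc j p)) @[h --> 0^'+] -->
    \sum_b 'D_(basis_vec b) F (cc j p) * jacobian_at i j p a b.
  apply: (@cvg_chain R n F (cc j p) R (0 : R)^'+ id (fun=> cc j p)
    (fun h => trans i j (cc i p + h *: basis_vec a)) (fun b => jacobian_at i j p a b) _ pF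
    (cvg_cst _) ct) => b.
  by have := ht b; rewrite /has_pd tE.
under eq_bigr do rewrite -pdF mulrC.
rewrite /has_pd; apply: cvg_trans; apply: near_eq_cvg.
have nA := relopen_shift a (relopen_im i (open_dom j)) (cc_im ip jp).
have nV : \forall h \near (0 : R)^'+, V (trans i j (cc i p + h *: basis_vec a)).
  exact: (ct _ (open_nbhs_nbhs (conj oV Vp))).
apply: filterS2 nA nV => h /imP[Ah jh] Vh /=.
rewrite ppK// -(uF _ Vh) ?/trans; last exact: cc_rng.
by rewrite ppK// -(uF _ Vp) ?ppK//; exact: cc_rng.
Qed.

Lemma pd_row_trans i j p u : dom i p -> dom j p -> C1_at j p u ->
  pd_row (u \o pp i) (cc i p) = pd_row (u \o pp j) (cc j p) *m (jacobian_at i j p)^T.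
Proof.
move=> ip jp ju; apply/rowP => a; rewrite !mxE (has_pdE (@pd_trans i j p u a ip jp ju)).
by apply: eq_bigr => b _; rewrite !mxE mulrC.
Qed.

(** The Jacobian is a factor of the invertible matrix of the metric in [metric_change]. *)
Lemma jacobian_unit i j p : dom i p -> dom j p -> jacobian_at i j p \in unitmx.
Proof.
move=> ip jp; have := metric_unit (metric_chart i) (cc_rng ip).
rewrite (metric_change ip jp) !unitmx_mul => /andP[/andP[//]].
Qed.

Definition grad_prod_in i u v p := coord_grad_prod (G := metric M i) (u \o pp i) (v \o pp i) (cc i p).

Lemma grad_prod_in_chart i j p u v : dom i p -> dom j p -> C1_at j p u -> C1_at j p v ->
  grad_prod_in i u v p = grad_prod_in j u v p.
Proof.
move=> ip jp ju jv; rewrite /grad_prod_in /coord_grad_prod (pd_row_trans ip jp ju) (pd_row_trans ip jp jv).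
have uJ := jacobian_unit ip jp; have uJt : (jacobian_at i j p)^T \in unitmx by rewrite unitmx_tr.
have uG := metric_unit (metric_chart j) (cc_rng jp).
have -> : gi (G := metric M i) (cc i p) =
    invmx (jacobian_at i j p)^T *m gi (G := metric M j) (cc j p) *m invmx (jacobian_at i j p).
  have uGi := metric_unit (metric_chart i) (cc_rng ip).
  apply: (can_inj (mulKmx uGi)); rewrite /gi mulmxV// {1}(metric_change ip jp).
  by rewrite -!mulmxA (mulKVmx uJt) (mulKVmx uG) mulmxV.
rewrite trmx_mul trmxK !mulmxA; congr (_ ord0 ord0).
by rewrite (mulmxK uJt) mulmxKV.
Qed.

Definition grad_prod u v p := grad_prod_in (chart_at p) u v p.

Lemma grad_prodE i p u v : dom i p -> C1_at i p u -> C1_at i p v -> grad_prod u v p = grad_prod_in i u v p.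
Proof. by move=> ip iu iv; apply: grad_prod_in_chart => //; exact: domain_chart_at. Qed.

(* If p had interior coordinates in chart i, the first component of the
   transition map to j would have a minimum there, so that the jacobian would
   not be invertible. *)
Lemma boundary_wall i p : boundary M p -> dom i p -> wall (cc i p).
Proof.
move=> [j [jp [hj [a a0 ja]]]] ip; split; first exact: rng_half (cc_rng ip).
exists a => //; apply/eqP; rewrite eq_le (rng_half (cc_rng ip))// andbT leNgt; apply/negP => pa.
have Ax : inner (im i (dom j)) (cc i p).
  split; first exact: cc_im.
  by move=> b b0; have -> : b = a by apply: val_inj; rewrite /= a0.
have CT : Ck 1 (inner (im i (dom j))) (fun x => trans i j x ord0 a).
  exact: (@smooth_inner_Ck R n _ _ 1 (relopen_im i (open_dom j)) (@smooth_trans i j a)).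
have oI := open_inner (relopen_im i (open_dom j)).
have J0 b : jacobian_at i j p b a = 0.
  have [dT _] := CT b; rewrite mxE.
  rewrite (pd_inner b (relopen_im i (open_dom j)) CT Ax : pd b _ _ = _).
  apply: (derive_at_min (dT _ Ax)).
  have := open_nbhs_nbhs (conj oI Ax); apply: filterS => x [/imP[_ jx] _].
  rewrite /trans ppK// ja; exact: (rng_half (cc_rng jx)).
have uJ := jacobian_unit ip jp.
have : jacobian_at i j p *m (delta_mx a ord0 : 'cV_n) = 0.
  by rewrite -colE; apply/colP => b; rewrite [LHS]mxE J0 mxE.
move=> /(congr1 (mulmx (invmx (jacobian_at i j p)))); rewrite mulmxA mulVmx// mul1mx mulmx0.
by move=> /colP/(_ a); rewrite !mxE !eqxx => /eqP; rewrite oner_eq0.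
Qed.

End Charts.

(** * Regularity classes, supports and transport of integrals between charts *)

Section Smooth_structure.
Context {R : realType} {n : nat} {M : riemannian R n}.
Implicit Types (p q : M) (i j : Defs.index M) (x y : 'rV[R]_n) (u v : M -> R) (a b : 'I_n).
Implicit Types (U K : set M).

Lemma inner_boundary i p : dom i p -> inner (rng i) (cc i p) <-> ~ boundary M p.
Proof.
move=> ip; split=> [[_ h0] bp|nb].
  by have [_ [a a0 /eqP]] := boundary_wall bp ip; rewrite gt_eqF// h0.
split; first exact: cc_rng.
move=> a a0; rewrite lt_neqAle (rng_half (cc_rng ip) a0) andbT; apply/eqP => e.
by apply: nb; exists i; split => //; split; [exact: rng_half (cc_rng ip)|exists a].
Qed.

Lemma inner_rng_pp i x : inner (rng i) x -> dom i (pp i x) /\ ~ boundary M (pp i x).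
Proof.
move=> Ax; have [ix xE] := rng_pp Ax.1; split => //.
by apply/(inner_boundary ix); rewrite xE.
Qed.

Lemma inner_imP i U x : inner (im i U) x <-> inner (rng i) x /\ U (pp i x).
Proof.
split=> [[/imP[Ax Ux] x0]|[[Ax x0] Ux]]; first by [].
by split => //; apply/imP.
Qed.

Lemma open_interior_points : open [set p | ~ boundary M p].
Proof.
rewrite openE => p nb /=; have ip : dom (chart_at p) p by exact: domain_chart_at.
have := (inner_boundary ip).2 nb; set i := chart_at p => Ap.
have oI := open_inner (relopen_rng i).
have := cc_continuous ip (open_nbhs_nbhs (conj oI Ap)).
have nd := open_nbhs_nbhs (conj (open_dom i) ip).
by apply: filterS2 nd => q iq; exact: (inner_boundary iq).1.
Qed.

Lemma smooth_cst (c : R) : smooth (fun _ : M => c).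
Proof. by move=> i; exact: smooth_within_cst. Qed.

Lemma smoothD u v : smooth u -> smooth v -> smooth (fun p => u p + v p).
Proof. by move=> su sv i; exact: (smooth_withinD (su i) (sv i)). Qed.

Lemma smoothM u v : smooth u -> smooth v -> smooth (fun p => u p * v p).
Proof. by move=> su sv i; exact: (smooth_withinM (su i) (sv i)). Qed.

Lemma smoothN u : smooth u -> smooth (fun p => - u p).
Proof. by move=> su i; exact: (smooth_withinN (su i)). Qed.

Lemma smooth_within_pd_row (A : set 'rV[R]_n) (F : 'rV[R]_n -> R) a : relopen A -> smooth_within A F ->
  smooth_within A (fun x => pd_row F x ord0 a).
Proof.
move=> rA sF; apply: (@smooth_within_ext _ _ _ (pd a F)) => [x _|]; first by rewrite mxE.
exact: smooth_within_pd.
Qed.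

Lemma smooth_coord_grad_prod (A : set 'rV[R]_n) G (F H : 'rV[R]_n -> R) : metric_on A G ->
  smooth_within A F -> smooth_within A H -> smooth_within A (coord_grad_prod (G := G) F H).
Proof.
move=> mG sF sH; have rA := metric_on_relopen mG.
have e x : A x -> \sum_b (\sum_a pd_row F x ord0 a * gi (G := G) x a b) * pd_row H x ord0 b =
    coord_grad_prod (G := G) F H x.
  move=> _; rewrite /coord_grad_prod [RHS]mxE; apply: eq_bigr => b _.
  by rewrite [X in _ = X * _]mxE [X in _ = _ * X]mxE.
apply: (smooth_within_ext e); apply: smooth_within_sum => b.
apply: smooth_withinM; last exact: smooth_within_pd_row.
apply: smooth_within_sum => a; apply: smooth_withinM; first exact: smooth_within_pd_row.
exact: smooth_gi.
Qed.

Lemma smooth_coord_hessian (A : set 'rV[R]_n) G (F : 'rV[R]_n -> R) a b : metric_on A G ->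
  smooth_within A F -> smooth_within A (fun x => coord_hessian G F x a b).
Proof.
move=> mG sF; have rA := metric_on_relopen mG.
apply: (@smooth_within_ext _ _ _
  (fun x => pd a (pd b F) x - \sum_c christoffel G c a b x * pd c F x)) => [x _|].
  by rewrite mxE.
apply: smooth_withinB; first by do 2 apply: smooth_within_pd => //.
apply: smooth_within_sum => c; apply: smooth_withinM; last exact: smooth_within_pd.
exact: smooth_christoffel.
Qed.

Lemma smooth_coord_laplacian (A : set 'rV[R]_n) G (F : 'rV[R]_n -> R) : metric_on A G ->
  smooth_within A F -> smooth_within A (coord_laplacian G F).
Proof.
move=> mG sF; rewrite /coord_laplacian /metric_trace /mxtrace.
apply: smooth_within_sum => a.
apply: (@smooth_within_ext _ _ _
  (fun x => \sum_b invmx (G x) a b * coord_hessian G F x b a)) => [x _|].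
  by rewrite mxE.
apply: smooth_within_sum => b; apply: smooth_withinM; first exact: (smooth_gi mG).
exact: smooth_coord_hessian.
Qed.

Lemma smooth_grad_prod u v : smooth u -> smooth v -> smooth (grad_prod u v).
Proof.
move=> su sv i.
apply: (smooth_within_ext _ (smooth_coord_grad_prod (metric_chart i) (su i) (sv i))) => x Ax.
have [ix xE] := rng_pp Ax.
by rewrite /= (grad_prodE ix) /grad_prod_in ?xE//; exact: smooth_C1_at.
Qed.

(** C^1 off the boundary, the regularity of bumps and cutoffs; nothing is asked at boundary
    points. *)
Definition C1int u := forall i, Ck 1 (inner (rng i)) (u \o pp i).
Definition C0int u := forall i, Ck 0 (inner (rng i)) (u \o pp i).

Let oI i := open_inner (relopen_rng (M := M) i).

Lemma smooth_C1int u : smooth u -> C1int u.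
Proof. by move=> su i; exact: (@smooth_inner_Ck R n _ _ 1 (relopen_rng i) (su i)). Qed.

Lemma C1int_C0int u : C1int u -> C0int u.
Proof. by move=> su i; exact: (@CkS R n 0 _ _ (@oI i) (su i)). Qed.

Lemma C1intD u v : C1int u -> C1int v -> C1int (fun p => u p + v p).
Proof. by move=> su sv i; exact: (@CkD R n 1 _ _ _ (@oI i) (su i) (sv i)). Qed.

Lemma C1intM u v : C1int u -> C1int v -> C1int (fun p => u p * v p).
Proof. by move=> su sv i; exact: (@CkM R n 1 _ _ _ (@oI i) (su i) (sv i)). Qed.

Lemma C1intV u : (forall p, u p != 0) -> C1int u -> C1int (fun p => (u p)^-1).
Proof. by move=> u0 su i; exact: (@CkV R n 1 _ _ (@oI i) (fun x _ => u0 (pp i x)) (su i)). Qed.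

Lemma C1int_sum (I : Type) (r : seq I) (u : I -> M -> R) : (forall k, C1int (u k)) ->
  C1int (fun p => \sum_(k <- r) u k p).
Proof. by move=> su i; exact: (@Ck_sum R n 1 _ _ r _ (@oI i) (fun k => su k i)). Qed.

Lemma C1int_sqpos u : C1int u -> C1int (fun p => sqpos (u p)).
Proof. by move=> su i; exact: (@Ck1_sqpos R n _ _ (@oI i) (su i)). Qed.

Lemma C1int_C1_at i p u : C1int u -> dom i p -> ~ boundary M p -> C1_at i p u.
Proof.
move=> su ip nb; exists (inner (rng i)), (u \o pp i); split => //.
by apply/inner_boundary.
Qed.

Lemma C0int_grad_prod u v : C1int u -> C1int v -> C0int (grad_prod u v).
Proof.
move=> su sv i.
have e x : inner (rng i) x -> \sum_b (\sum_a 'D_(basis_vec a) (u \o pp i) x *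
    gi (G := metric M i) x a b) * 'D_(basis_vec b) (v \o pp i) x = (grad_prod u v \o pp i) x.
  move=> Ax; have [ix nb] := inner_rng_pp Ax.
  rewrite /= (grad_prodE ix (C1int_C1_at su ix nb) (C1int_C1_at sv ix nb)) /grad_prod_in.
  have [_ ->] := rng_pp Ax.1; rewrite /coord_grad_prod [RHS]mxE; apply: eq_bigr => b _.
  rewrite [X in _ = X * _]mxE [X in _ = _ * X]mxE [X in _ = _ * X]mxE.
  rewrite (pd_inner b (relopen_rng i) (sv i) Ax); congr (_ * _); apply: eq_bigr => a _.
  by rewrite mxE (pd_inner a (relopen_rng i) (su i) Ax).
apply: (Ck_ext (@oI i) e); apply: Ck_sum => // b; apply: CkM => //; last first.
  by have [_] := sv i b.
apply: Ck_sum => // a; apply: CkM => //; first by have [_] := su i a.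
exact: (@smooth_inner_Ck R n _ _ 0 (relopen_rng i) (@smooth_gi R n _ _ (metric_chart i) a b)).
Qed.

Definition laplacian_in i u p := coord_laplacian (metric M i) (u \o pp i) (cc i p).

Lemma pp_continuous i x : inner (rng i) x -> {for x, continuous (pp i)}.
Proof.
move=> Ax B nB; have := pp_cvg Ax.1 nB.
have := open_nbhs_nbhs (conj (@oI i) Ax).
by apply: filterS2 => y [Ay _]; exact.
Qed.

Lemma compact_pp i (K : set 'rV[R]_n) : compact K -> K `<=` rng i -> compact (pp i @` K).
Proof.
move=> cK KA; apply: continuous_compact cK; apply: continuous_subspaceW KA _.
exact: param_continuous.
Qed.

Lemma compact_cc i K : compact K -> K `<=` dom i -> compact (cc i @` K).
Proof.
move=> cK KA; apply: continuous_compact cK; apply: continuous_subspaceW KA _.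
exact: Defs.coord_continuous.
Qed.

Lemma closed_compact K : compact K -> closed K.
Proof. by apply: compact_closed; exact: point_hausdorff. Qed.

Lemma near_compl K p : compact K -> ~ K p -> \forall q \near p, ~ K q.
Proof.
by move=> /closed_compact cK nK; exact: (open_nbhs_nbhs (conj (closed_openC cK) nK)).
Qed.

Lemma C0int_continuous_at u p : C0int u -> ~ boundary M p -> {for p, continuous u}.
Proof.
move=> su nb; have ip : dom (chart_at p) p by exact: domain_chart_at.
set i := chart_at p in ip; have Ap := (inner_boundary ip).2 nb.
have h : (u \o pp i) (cc i q) @[q --> p] --> (u \o pp i) (cc i p).
  exact: (cvg_cont (cc_continuous ip) (su i _ Ap)).
rewrite /= ppK// in h; apply: cvg_trans h; apply: near_eq_cvg.
by have := open_nbhs_nbhs (conj (open_dom i) ip); apply: filterS => q iq /=; rewrite ppK.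
Qed.

Lemma smooth_continuous u : smooth u -> continuous u.
Proof.
move=> su p; have ip : dom (chart_at p) p by exact: domain_chart_at.
set i := chart_at p in ip.
have h : (u \o pp i) (cc i q) @[q --> p] --> (u \o pp i) (cc i p).
  have := smooth_within_cvg (su i) (cc_rng ip); move=> hu B nB.
  have := cc_continuous ip (hu B nB).
  have := open_nbhs_nbhs (conj (open_dom i) ip).
  by apply: filterS2 => q iq /=; apply; exact: cc_rng.
rewrite /= ppK// in h; apply: cvg_trans h; apply: near_eq_cvg.
by have := open_nbhs_nbhs (conj (open_dom i) ip); apply: filterS => q iq /=; rewrite ppK.
Qed.

Definition supp_in K u := [/\ compact K, (forall p, K p -> ~ boundary M p) &
  forall p, ~ K p -> u p = 0].

Lemma supp_in_continuous K u : supp_in K u -> (forall p, K p -> {for p, continuous u}) ->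
  continuous u.
Proof.
move=> [cK Kb u0] su p; have [Kp|nK] := pselect (K p); first exact: su.
rewrite /continuous_at u0// => B B0; have := near_compl cK nK.
by apply: filterS => q nq /=; rewrite u0//; exact: nbhs_singleton.
Qed.

(** [J] integrates over R^n, while [param] is arbitrary outside the range of the chart; hence the
    extension by 0. *)
Definition pull i u x : R := if `[< rng i x >] then u (pp i x) else 0.

Lemma pullE i u x : rng i x -> pull i u x = u (pp i x).
Proof. by move=> Ax; rewrite /pull asboolT. Qed.

Lemma pull_compl i K u x : (forall p, ~ K p -> u p = 0) -> ~ (cc i @` K) x -> pull i u x = 0.
Proof.
move=> u0 nx; rewrite /pull; case: asboolP => // Ax; apply: u0 => Kx; apply: nx.
by exists (pp i x) => //; have [] := rng_pp Ax.
Qed.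

Lemma pull_csupp i K u : supp_in K u -> K `<=` dom i -> csupp (inner (rng i)) (pull i u).
Proof.
move=> [cK Kb u0] Ki; exists (cc i @` K); split; first exact: compact_cc.
- by move=> _ [p Kp <-]; apply/inner_boundary; [exact: Ki|exact: Kb].
- by move=> x; exact: pull_compl.
Qed.

Lemma Ck_pull i u k : Ck k (inner (rng i)) (u \o pp i) -> Ck k (inner (rng i)) (pull i u).
Proof. by apply: Ck_ext => // x [Ax _]; rewrite pullE. Qed.

Lemma pull_Cc i K u : supp_in K u -> K `<=` dom i -> continuous u -> Cc (pull i u).
Proof.
move=> sK Ki cu; apply: csupp_Cc (pull_csupp sK Ki); apply: Ck_pull => x Ax.
exact: (cvg_cont (@pp_continuous i x Ax) (cu _)).
Qed.

Lemma pullD i u v x : pull i (fun p => u p + v p) x = pull i u x + pull i v x.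
Proof. by rewrite /pull; case: asboolP => //; rewrite addr0. Qed.

Definition rho i : 'rV[R]_n -> R := vol_density (G := metric M i).

(** [metric_change] is the hypothesis [HG] of the change of variables, once the two-sided
    [differential] of the transition map is identified with the one-sided [jacobian_at] at interior
    points. *)
Lemma integral_chart i j K u : supp_in K u -> K `<=` dom i -> K `<=` dom j -> continuous u ->
  J (fun x => pull i u x * rho i x) = J (fun x => pull j u x * rho j x).
Proof.
move=> sK Ki Kj su; have [cK Kb u0] := sK.
have cu k : K `<=` dom k -> continuous (pull k u) by move=> Kk; have [] := pull_Cc sK Kk su.
have Kin k : K `<=` dom k -> cc k @` K `<=` inner (rng k).
  by move=> Kk _ [p Kp <-]; apply/inner_boundary; [exact: Kk|exact: Kb].
have pT k l b p : K `<=` dom k -> K `<=` dom l -> K p ->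
    partials_near (fun z => trans k l z ord0 b) (cc k p).
  move=> Kk Kl Kp; have oW := open_inner (relopen_im k (open_dom l)).
  apply: (Ck1_partials oW).
    exact: (@smooth_inner_Ck R n _ _ 1 (relopen_im k (open_dom l)) (@smooth_trans R n M k l b)).
  apply/inner_imP; rewrite ppK; last exact: Kk.
  by split; [apply: (Kin _ Kk); exists p|exact: Kl].
apply: (@change_of_variables R n (rng i) (rng j) (metric M i) (metric M j) (metric_chart i)
  (metric_chart j) (cc i @` K) (cc j @` K) (trans j i) (trans i j)).
- exact: compact_cc.
- exact: compact_cc.
- exact: Kin.
- exact: Kin.
- by move=> _ [p Kp <-]; exists p => //; rewrite /trans ppK//; exact: Kj.
- by move=> _ [p Kp <-]; exists p => //; rewrite /trans ppK//; exact: Ki.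
- move=> _ [p Kp <-].
  have oW := open_inner (relopen_im i (open_dom j)).
  have Wp : inner (im i (dom j)) (cc i p).
    apply/inner_imP; rewrite ppK; last exact: Ki.
    by split; [apply: (Kin _ Ki); exists p|exact: Kj].
  have := open_nbhs_nbhs (conj oW Wp); apply: filterS => z [/imP[Az jz] _].
  by rewrite /trans ppK//; have [] := rng_pp Az.
- by move=> _ [p Kp <-]; have ip := Ki _ Kp; have jp := Kj _ Kp; rewrite /trans ppK// ppK.
- by move=> _ b [p Kp <-]; exact: pT.
- by move=> _ b [p Kp <-]; exact: pT.
- move=> _ [p Kp <-]; have ip := Ki _ Kp; have jp := Kj _ Kp.
  rewrite {2}/trans ppK//.
  have -> : differential (trans j i) (cc j p) = jacobian_at j i p; last exact: metric_change.
  apply/matrixP => a b; rewrite mxE -(has_pdE (@has_pd_trans R n M j i p a b jp ip)).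
  apply/esym/has_pdE/derivable_has_pd.
  by have [h _] := pT j i b p Kj Ki Kp; exact: (nbhs_singleton h).
- exact: cu.
- exact: cu.
- by move=> x; exact: pull_compl.
- by move=> x; exact: pull_compl.
- move=> _ [p Kp <-]; have ip := Ki _ Kp; have jp := Kj _ Kp.
  by rewrite /trans ppK// !pullE ?ppK//; exact: cc_rng.
Qed.

End Smooth_structure.

(** * Bumps in charts, and chart independence of the Laplacian *)

Section Bumps.
Context {R : realType} {n : nat} {M : riemannian R n}.
Implicit Types (p q : M) (i j : Defs.index M) (x y : 'rV[R]_n) (u v : M -> R) (a b : 'I_n).
Implicit Types (U K : set M) (r : R).

Lemma pd_near (F G : 'rV[R]_n -> R) x a : F x = G x ->
  (\forall h \near 0^'+, F (x + h *: basis_vec a) = G (x + h *: basis_vec a)) ->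
  pd a F x = pd a G x.
Proof.
move=> Fx FG; rewrite /pd; congr lim; apply/seteqP; split => P;
  by apply: filterS2 FG => h e /=; rewrite Fx e.
Qed.

(** The squared Euclidean distance, used because the norm on row vectors is the maximum norm, which
    is not differentiable. *)
Definition qdist x0 x : R := \sum_a (x ord0 a - x0 ord0 a) ^+ 2.

Definition bump i x0 r p : R := if `[< dom i p >] then sqpos (r - qdist x0 (cc i p)) else 0.

Definition bball x0 r : set 'rV[R]_n := half_space `&` [set x | qdist x0 x <= r].

Lemma qdist_coord x0 x a : (x ord0 a - x0 ord0 a) ^+ 2 <= qdist x0 x.
Proof. by rewrite /qdist (bigD1 a)//= lerDl sumr_ge0// => b _; exact: sqr_ge0. Qed.

Lemma qdist_norm x0 x r : 0 <= r -> qdist x0 x <= r ^+ 2 -> `|x - x0| <= r.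
Proof.
move=> r0 h; apply: norm_le_coord => // a; rewrite !mxE.
rewrite -(@ler_pXn2r _ 2)// ?nnegrE// real_normK ?num_real//.
exact: le_trans (qdist_coord _ _ _) h.
Qed.

Lemma qdist_Ck k V x0 : open V -> Ck k V (qdist x0).
Proof.
move=> oV; apply: Ck_sum => // a.
have h : Ck k V (fun x : 'rV[R]_n => x ord0 a - x0 ord0 a).
  by apply: CkB => //; [exact: Ck_coord|exact: Ck_cst].
have := @CkM R n k _ _ _ oV h h; apply: Ck_ext => // x _.
Qed.

Lemma qdist_continuous x0 : continuous (qdist x0).
Proof. by move=> x; exact: (@qdist_Ck 0 setT x0 openT x). Qed.

Lemma closed_half_space : closed (@half_space R n).
Proof.
have -> : @half_space R n = \bigcap_(a in [set a : 'I_n | a = 0%N :> nat]) [set x | 0 <= x ord0 a].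
  by apply/seteqP; split => x /= h a; exact: h.
apply: closed_bigI => a _.
apply: (@closed_comp _ _ (fun x : 'rV[R]_n => x ord0 a) [set t : R | 0 <= t]).
  by move=> x _; exact: coord_continuous.
exact: closed_ge.
Qed.

Lemma bball_compact x0 r : compact (bball x0 r).
Proof.
apply: bounded_closed_compact.
  exists (`|x0| + (`|r| + 1)); split; first exact: num_real.
  move=> t ht x [_ /= qx]; apply: ltW; apply: le_lt_trans ht.
  rewrite -(subrK x0 x) addrC; apply: (le_trans (ler_normD _ _)); rewrite lerD2l.
  apply: qdist_norm; first by rewrite addr_ge0.
  by apply: (le_trans qx); apply: (le_trans (ler_norm r)); have := normr_ge0 r; nra.
apply: closedI; first exact: closed_half_space.
have -> : [set x | qdist x0 x <= r] = qdist x0 @^-1` [set t : R | t <= r] by [].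
by apply: closed_comp; [move=> x _; exact: qdist_continuous|exact: closed_le].
Qed.

Lemma bball_sub i U p : open U -> U p -> dom i p ->
  exists2 r, 0 < r & bball (cc i p) r `<=` im i U.
Proof.
move=> oU Up ip; have [V oV e] := relopen_im i oU.
have : (V `&` half_space) (cc i p) by rewrite -e; exact: cc_im.
move=> [Vp _]; have /nbhs_ballP[d d0 hd] := open_nbhs_nbhs (conj oV Vp).
(* [qdist] is a squared distance, so r is a squared radius. *)
exists ((d / 2) ^+ 2); first by rewrite exprn_gt0// divr_gt0.
move=> x [hx qx]; rewrite e; split => //; apply: hd; rewrite -ball_normE /= distrC.
apply: (@le_lt_trans _ _ (d / 2)); first by apply: qdist_norm => //; rewrite divr_ge0// ltW.
by rewrite ltr_pdivrMr// ltr_pMr//; lra.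
Qed.

Lemma bump_ge0 i x0 r p : 0 <= bump i x0 r p.
Proof. by rewrite /bump; case: asboolP => // _; exact: sqpos_ge0. Qed.

Lemma bump_gt0 i r p : dom i p -> 0 < r -> 0 < bump i (cc i p) r p.
Proof.
move=> ip r0; rewrite /bump asboolT// sqpos_gt0// /qdist big1 ?subr0// => a _.
by rewrite subrr expr0n.
Qed.

Lemma bump_off i x0 r p : ~ (pp i @` bball x0 r) p -> bump i x0 r p = 0.
Proof.
move=> np; rewrite /bump; case: asboolP => // ip; apply: sqpos_le0; rewrite subr_le0 leNgt.
apply/negP => qp; apply: np; exists (cc i p); last exact: ppK.
by split; [exact: rng_half (cc_rng ip)|exact: ltW].
Qed.

Lemma bump_continuous i x0 r : bball x0 r `<=` rng i -> continuous (bump i x0 r).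
Proof.
move=> bA p; have cK := compact_pp (@bball_compact x0 r) bA.
have [ip|np] := pselect (dom i p); last first.
  have nK : ~ (pp i @` bball x0 r) p.
    by move=> [x /bA Ax xE]; apply: np; rewrite -xE; exact: (rng_pp Ax).1.
  rewrite /continuous_at bump_off// => B B0; have := near_compl cK nK.
  by apply: filterS => q nq /=; rewrite bump_off//; exact: nbhs_singleton.
have h : sqpos (r - qdist x0 (cc i q)) @[q --> p] --> sqpos (r - qdist x0 (cc i p)).
  apply: (@cvg_cont _ _ _ _ (fun q => r - qdist x0 (cc i q))); last exact: sqpos_continuous.
  apply: (cvgB (cvg_cst _) (cvg_cont (cc_continuous ip) (@qdist_continuous x0 _))).
rewrite /continuous_at {2}/bump asboolT//; apply: cvg_trans h; apply: near_eq_cvg.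
have := open_nbhs_nbhs (conj (open_dom i) ip); apply: filterS => q iq.
by rewrite /bump asboolT.
Qed.

(** Seen from chart j: in the domain of i the bump is a C^1 function of the transition map;
    elsewhere it vanishes nearby, its support being the image of a compact set and hence closed. *)
Lemma bump_C1int i x0 r : bball x0 r `<=` rng i -> C1int (bump i x0 r).
Proof.
move=> bA j; apply: Ck_local => x Ax; have cK := compact_pp (@bball_compact x0 r) bA.
have [jx _] := rng_pp Ax.1; have [ix|nx] := pselect (dom i (pp j x)).
  have oW := open_inner (relopen_im j (open_dom i)).
  exists (inner (im j (dom i))); first by apply/inner_imP.
  have CT b := @smooth_inner_Ck R n _ _ 1 (relopen_im j (open_dom i)) (@smooth_trans R n M j i b).
  have CB : Ck 1 (inner (im j (dom i))) (fun y => r - qdist x0 (trans j i y)).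
    apply: CkB => //; first exact: Ck_cst.
    apply: (@Ck_sum R n 1 _ _ _ (fun a y => (trans j i y ord0 a - x0 ord0 a) ^+ 2)) => // a.
    have h := @CkB R n 1 _ _ _ oW (CT a) (Ck_cst 1 (x0 ord0 a) oW).
    by have := @CkM R n 1 _ _ _ oW h h; apply: Ck_ext => // y _; rewrite expr2.
  apply: (Ck_ext oW _ (Ck1_sqpos oW CB)) => y /inner_imP[_ iy].
  by rewrite /= /bump asboolT.
pose U := ~` (pp i @` bball x0 r).
have oU : open U by apply: closed_openC; exact: closed_compact.
have oW := open_inner (relopen_im j oU); exists (inner (im j U)).
  apply/inner_imP; split => // -[y /bA Ay yx]; apply: nx; rewrite -yx; exact: (rng_pp Ay).1.
apply: (Ck_ext oW _ (Ck_cst 1 0 oW)) => y /inner_imP[_ iy].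
by rewrite /= bump_off.
Qed.

Lemma bump_supp_in i x0 r : bball x0 r `<=` inner (rng i) -> supp_in (pp i @` bball x0 r) (bump i x0 r).
Proof.
move=> bA; split; first by apply: compact_pp; [exact: bball_compact|move=> x /bA[]].
- by move=> _ [x /bA Ax <-]; exact: (inner_rng_pp Ax).2.
- exact: bump_off.
Qed.

Lemma pd_row_near i p u v : dom i p -> (\forall q \near p, u q = v q) ->
  pd_row (u \o pp i) (cc i p) = pd_row (v \o pp i) (cc i p).
Proof.
move=> ip uv; apply/rowP => a; rewrite !mxE; apply: pd_near.
  by rewrite /= ppK//; exact: nbhs_singleton uv.
have Ap := cc_rng ip; have nA := relopen_shift a (relopen_rng i) Ap.
have := pp_cvg Ap; rewrite ppK// => /(_ _ uv) /(@shift_cvg0 R n (cc i p) (basis_vec a)).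
by apply: filterS2 nA => h Ah; exact.
Qed.

Lemma grad_prod_in_near i p u u' v : dom i p -> (\forall q \near p, u q = u' q) ->
  grad_prod_in i u v p = grad_prod_in i u' v p.
Proof. by move=> ip uu'; rewrite /grad_prod_in /coord_grad_prod (pd_row_near ip uu'). Qed.

Lemma grad_prod_in0 i p v : grad_prod_in i (fun=> 0) v p = 0.
Proof.
rewrite /grad_prod_in /coord_grad_prod (_ : pd_row _ _ = 0) ?mul0mx ?mxE//.
by apply/rowP => a; rewrite !mxE; apply: has_pdE; exact: has_pd_cst.
Qed.

Lemma grad_prod_in_supp K u v i p : supp_in K u -> dom i p -> ~ K p -> grad_prod_in i u v p = 0.
Proof.
move=> [cK _ u0] ip nK; rewrite (@grad_prod_in_near i p u (fun=> 0)) ?grad_prod_in0//.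
exact: filterS u0 (near_compl cK nK).
Qed.

Lemma laplacian_in_continuous i v p : smooth v -> dom i p -> ~ boundary M p -> {for p, continuous (laplacian_in i v)}.
Proof.
move=> sv ip nb; have Ap := (inner_boundary ip).2 nb.
have := @smooth_inner_Ck R n _ _ 0 (relopen_rng i) (smooth_coord_laplacian (metric_chart i) (sv i)).
move=> /(_ _ Ap) h; exact: (cvg_cont (cc_continuous ip) h).
Qed.

Lemma Green_chart i K u v : C1int u -> supp_in K u -> K `<=` dom i -> smooth v ->
  J (fun x => pull i (fun p => grad_prod u v p + u p * laplacian_in i v p) x * rho i x) = 0.
Proof.
move=> Cu sK Ki sv.
have [cK Kb u0] := sK.
rewrite -[RHS](Green_coord (metric_chart i) (Ck_pull (Cu i)) (pull_csupp sK Ki) (sv i)).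
apply: J_eq => x; rewrite mulrC; congr (_ * _).
have [Ax|nAx] := pselect (rng i x); last first.
  have nK : ~ (cc i @` K) x by move=> [p /Ki ip xE]; apply: nAx; rewrite -xE; exact: cc_rng.
  rewrite {1}/pull asboolF// (pull_compl u0 nK) mul0r addr0 /coord_grad_prod.
  rewrite (_ : pd_row (pull i u) x = 0) ?mul0mx ?mxE//; apply/rowP => a; rewrite !mxE.
  rewrite (@pd_near _ (fun=> 0)); first by apply: has_pdE; exact: has_pd_cst.
    exact: pull_compl u0 nK.
  have nh : \forall h \near (0 : R)^'+, ~ (cc i @` K) (x + h *: basis_vec a).
    exact: (@shift_cvg0 R n x (basis_vec a) _ (near_compact_compl (compact_cc cK Ki) nK)).
  by apply: filterS nh => h /=; exact: pull_compl.
have [ix xE] := rng_pp Ax; rewrite pullE// pullE// /laplacian_in xE; congr (_ + _).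
have -> : grad_prod u v (pp i x) = grad_prod_in i u v (pp i x).
  have [Kx|nK] := pselect (K (pp i x)).
    by apply: grad_prodE => //; [apply: C1int_C1_at => //; exact: Kb|exact: smooth_C1_at].
  by rewrite (grad_prod_in_supp v sK ix nK) /grad_prod (grad_prod_in_supp v sK _ nK)//; exact: domain_chart_at.
rewrite /grad_prod_in xE /coord_grad_prod; congr ((_ *m _ *m _) ord0 ord0).
apply/rowP => a; rewrite !mxE; apply: pd_near; first by rewrite pullE.
by have := relopen_shift a (relopen_rng i) Ax; apply: filterS => h Ah; rewrite pullE.
Qed.

Lemma Cc_pull_rho i K u : supp_in K u -> K `<=` dom i -> continuous u ->
  Cc (fun x => pull i u x * rho i x).
Proof.
move=> sK Ki cu; apply: (@csupp_Cc R n (inner (rng i))); last first.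
  have -> : (fun x => pull i u x * rho i x) = (fun x => rho i x * pull i u x).
    by apply/funext => x; rewrite mulrC.
  exact/csupp_mul/(pull_csupp sK Ki).
have oI := open_inner (relopen_rng (M := M) i).
apply: CkM => //; first by move=> x _; have [c _] := pull_Cc sK Ki cu; exact: c.
exact: CkS (Ck1_vol_density (metric_chart i)).
Qed.

(* Green's formula in both charts and the change of variables show that the
   difference of the two expressions integrates to 0 against every bump. *)
Lemma laplacian_in_le i j v p : smooth v -> dom i p -> dom j p -> ~ boundary M p ->
  laplacian_in i v p <= laplacian_in j v p.
Proof.
move=> sv ip jp nb; rewrite leNgt; apply/negP => lt.
(* The interior is open by construction; p lies in it because both Laplacians are continuous off the
   boundary. *)
pose U : set M := [set q | [/\ dom i q, dom j q, ~ boundary M q & laplacian_in j v q < laplacian_in i v q]]^°.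
have Up : U p.
  have ni := open_nbhs_nbhs (conj (open_dom i) ip); have nj := open_nbhs_nbhs (conj (open_dom j) jp).
  have nn := open_nbhs_nbhs (conj (@open_interior_points R n M) nb).
  have c : laplacian_in i v q - laplacian_in j v q @[q --> p] --> laplacian_in i v p - laplacian_in j v p.
    exact: (cvgB (laplacian_in_continuous sv ip nb) (laplacian_in_continuous sv jp nb)).
  have nc : \forall q \near p, 0 < laplacian_in i v q - laplacian_in j v q.
    by apply: (cvgr_gt _ c); rewrite subr_gt0.
  near=> q; split; [by near: q|by near: q|by near: q|].
  by rewrite -subr_gt0; near: q.
have [r r0 hr] := bball_sub (@open_interior _ _) Up ip.
have bA : bball (cc i p) r `<=` inner (rng i).
  move=> x /hr /imP[Ax /nbhs_singleton [ix _ nbx _]].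
  by have := (inner_boundary ix).2 nbx; have [_ ->] := rng_pp Ax.
have bA' : bball (cc i p) r `<=` rng i by move=> x /bA[].
set K := pp i @` bball (cc i p) r.
have KU q : K q -> [/\ dom i q, dom j q, ~ boundary M q & laplacian_in j v q < laplacian_in i v q].
  by move=> [x /hr /imP[_ /nbhs_singleton h] <-].
have Ki : K `<=` dom i by move=> q /KU[].
have Kj : K `<=` dom j by move=> q /KU[].
pose b := bump i (cc i p) r.
have sK : supp_in K b by exact: bump_supp_in.
have Cb : C1int b by exact: bump_C1int.
have [cK Kb b0] := sK.
pose e k q := grad_prod b v q + b q * laplacian_in k v q.
have se k : supp_in K (e k).
  split => // q nq; rewrite /e b0// mul0r addr0 /grad_prod.
  by apply: (grad_prod_in_supp _ sK) => //; exact: domain_chart_at.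
have ce k : K `<=` dom k -> continuous (e k).
  move=> Kk; apply: (supp_in_continuous (se k)) => q Kq; apply: cvgD.
    exact: (C0int_continuous_at (C0int_grad_prod Cb (smooth_C1int sv)) (Kb _ Kq)).
  apply: cvgM; last by apply: laplacian_in_continuous => //; [exact: Kk|exact: Kb].
  exact: (C0int_continuous_at (C1int_C0int Cb) (Kb _ Kq)).
have Ji := Green_chart Cb sK Ki sv.
have Jj := Green_chart Cb sK Kj sv.
have := integral_chart (se j) Ki Kj (ce j Kj).
rewrite [RHS]Jj => Jij.
have Ai := Cc_pull_rho (se i) Ki (ce i Ki); have Aj := Cc_pull_rho (se j) Ki (ce j Kj).
pose D x := pull i (e i) x * rho i x + (-1) * (pull i (e j) x * rho i x).
have CD : Cc D by apply: CcD => //; exact: CcZ.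
have DE x : D x = pull i (fun q => b q * (laplacian_in i v q - laplacian_in j v q)) x * rho i x.
  rewrite /D mulN1r -mulrBl; congr (_ * _); rewrite /pull; case: asboolP => // _.
    by rewrite /e; ring.
  by rewrite subrr.
have : 0 < J D.
  apply: (@J_gt0 R n D (cc i p)) => // [x|].
    rewrite DE /pull; case: asboolP => Ax; last by rewrite mul0r.
    rewrite mulr_ge0//; last exact: ltW (vol_density_gt0 (metric_chart i) Ax).
    have [Kx|nK] := pselect (K (pp i x)); last by rewrite b0// mul0r.
    by rewrite mulr_ge0// ?bump_ge0// subr_ge0; have [_ _ _ /ltW] := KU _ Kx.
  rewrite DE pullE ?ppK//; last exact: cc_rng.
  rewrite mulr_gt0//; last exact: (vol_density_gt0 (metric_chart i) (cc_rng ip)).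
  by rewrite mulr_gt0 ?subr_gt0//; exact: bump_gt0.
rewrite /D JD//; last exact: CcZ.
by rewrite (JZ _ Aj) Jij mulr0 addr0 Ji ltxx.
Unshelve. all: by end_near. Qed.

(** The vector of ones points into the half-space, so every point, on the wall or not, is a limit of
    interior points along one ray. Identities pass to the boundary this way. *)
Lemma relopen_approach (A : set 'rV[R]_n) x : relopen A -> A x ->
  \forall h \near (0 : R)^'+, inner A (x + h *: const_mx 1).
Proof.
move=> [V oV ->] [Vx hx].
have nV : \forall h \near (0 : R)^'+, V (x + h *: const_mx 1).
  exact: (@shift_cvg0 R n x (const_mx 1) _ (open_nbhs_nbhs (conj oV Vx))).
have n0 : \forall h \near 0^'+, 0 < (h : R) by exact: nbhs_right_gt.
apply: filterS2 nV n0 => h Vh h0.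
have H a : a = 0%N :> nat -> 0 < (x + h *: const_mx 1 : 'rV[R]_n) ord0 a.
  by move=> a0; rewrite !mxE mulr1 ltr_wpDl//; exact: hx.
by split => //; split => // a a0; exact/ltW/H.
Qed.

(** At interior points [laplacian_in_le] holds in both directions; a boundary point is reached along
    the ray of [relopen_approach], both expressions being smooth up to the wall. *)
Lemma laplacian_in_chart i j v p : smooth v -> dom i p -> dom j p -> laplacian_in i v p = laplacian_in j v p.
Proof.
move=> sv ip jp; have rW := relopen_im i (open_dom j).
have nI := relopen_approach rW (cc_im ip jp).
pose L k := coord_laplacian (metric M k) (v \o pp k).
have sL k : smooth_within (rng k) (L k) by exact: smooth_coord_laplacian (metric_chart k) (sv k).
have c1 : cc i p + h *: const_mx 1 @[h --> (0 : R)^'+] --> within (rng i) (nbhs (cc i p)).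
  move=> B nB; have := @shift_cvg0 R n (cc i p) (const_mx 1) _ nB.
  by apply: filterS2 nI => h [/imP[Ah _] _]; exact.
have c2 : trans i j (cc i p + h *: const_mx 1) @[h --> (0 : R)^'+] --> within (rng j) (nbhs (cc j p)).
  have ct : trans i j y @[y --> within (im i (dom j)) (nbhs (cc i p))] --> cc j p.
    rewrite -[X in _ --> cc j X](ppK ip); apply: rV_cvg => b.
    exact: (smooth_within_cvg (@smooth_trans R n M i j b) (cc_im ip jp)).
  move=> B nB; have := @shift_cvg0 R n (cc i p) (const_mx 1) _ (ct _ nB).
  apply: filterS2 nI => h [Ah _] /(_ Ah) /=; apply.
  by apply: cc_rng; have [_] := (imP _ _ _).1 Ah.
have l1 : L i (cc i p + h *: const_mx 1) @[h --> (0 : R)^'+] --> L i (cc i p).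
  exact: (cvg_comp _ _ c1 (smooth_within_cvg (sL i) (cc_rng ip))).
have l2 : L j (trans i j (cc i p + h *: const_mx 1)) @[h --> (0 : R)^'+] --> L j (cc j p).
  exact: (cvg_comp _ _ c2 (smooth_within_cvg (sL j) (cc_rng jp))).
apply: (cvg_unique (@norm_hausdorff _ _) l1); apply: cvg_trans l2; apply: near_eq_cvg.
apply: filterS nI => h /inner_imP[Ah jh]; have [ih nb] := inner_rng_pp Ah.
have := @laplacian_in_le i j v _ sv ih jh nb; have := @laplacian_in_le j i v _ sv jh ih nb.
rewrite /laplacian_in -/(trans _ _ _) (rng_pp Ah.1).2 => h1 h2.
by apply/eqP; rewrite eq_le h1 h2.
Qed.

Lemma laplacianE i v p : smooth v -> dom i p -> laplacian v p = laplacian_in i v p.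
Proof. by move=> sv ip; apply: laplacian_in_chart => //; exact: domain_chart_at. Qed.

Lemma smooth_laplacian v : smooth v -> smooth (laplacian v).
Proof.
move=> sv i.
apply: (smooth_within_ext _ (smooth_coord_laplacian (metric_chart i) (sv i))) => x Ax.
by have [ix xE] := rng_pp Ax; rewrite /= (laplacianE sv ix) /laplacian_in xE.
Qed.

End Bumps.

(** * Integration on a compact manifold *)

Section Integral.
Context {R : realType} {n : nat} {M : riemannian R n}.
Implicit Types (p q : M) (i j : Defs.index M) (x y : 'rV[R]_n) (u v w : M -> R) (a b : 'I_n).
Implicit Types (U K : set M) (r c : R).

Lemma C1_at_has_pd i p u a : dom i p -> C1_at i p u ->
  has_pd a (u \o pp i) (cc i p) (pd a (u \o pp i) (cc i p)).
Proof.
move=> ip [V [F [oV Vp CF uF]]].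
have h := @smooth_has_pd R n _ _ _ _ _ a (relopen_rng i) (cc_rng ip) oV Vp CF uF.
by rewrite (has_pdE h).
Qed.

Lemma grad_prod_sum (I : Type) (r : seq I) (u : I -> M -> R) v p :
  (forall k, C1_at (chart_at p) p (u k)) ->
  grad_prod (fun q => \sum_(k <- r) u k q) v p = \sum_(k <- r) grad_prod (u k) v p.
Proof.
move=> Cu; have ip : dom (chart_at p) p by exact: domain_chart_at.
rewrite /grad_prod /grad_prod_in /coord_grad_prod.
have -> : pd_row ((fun q => \sum_(k <- r) u k q) \o pp (chart_at p)) (cc (chart_at p) p) =
    \sum_(k <- r) pd_row (u k \o pp (chart_at p)) (cc (chart_at p) p).
  apply/rowP => a; rewrite mxE summxE; under eq_bigr do rewrite mxE.
  apply: has_pdE.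
  apply: (@has_pd_sum R n a I r (fun k => u k \o pp (chart_at p)) _
    (fun k => pd a (u k \o pp (chart_at p)) (cc (chart_at p) p))) => k.
  exact: C1_at_has_pd.
by rewrite !mulmx_suml summxE.
Qed.

Lemma grad_prodM u w v p : C1_at (chart_at p) p u -> C1_at (chart_at p) p w ->
  grad_prod (fun q => u q * w q) v p = u p * grad_prod w v p + w p * grad_prod u v p.
Proof.
move=> Cu Cw; have ip : dom (chart_at p) p by exact: domain_chart_at.
rewrite /grad_prod /grad_prod_in /coord_grad_prod.
have -> : pd_row ((fun q => u q * w q) \o pp (chart_at p)) (cc (chart_at p) p) =
    u p *: pd_row (w \o pp (chart_at p)) (cc (chart_at p) p) +
    w p *: pd_row (u \o pp (chart_at p)) (cc (chart_at p) p).
  apply/rowP => a; rewrite !mxE; apply: has_pdE.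
  have := has_pdM (C1_at_has_pd (a := a) ip Cu) (C1_at_has_pd (a := a) ip Cw).
  by rewrite /= ppK// [X in _ + X]mulrC.
by rewrite !mulmxDl -!scalemxAl !mxE.
Qed.

Lemma supp_inM K K' u w : supp_in K u -> compact K' -> (forall p, ~ K' p -> w p = 0) ->
  supp_in (K `&` K') (fun p => w p * u p).
Proof.
move=> [cK Kb u0] cK' w0; split.
- by apply: compact_closedI => //; exact: closed_compact.
- by move=> p [/Kb].
- move=> p nK; have [Kp|/u0->] := pselect (K p); last by rewrite mulr0.
  by rewrite w0 ?mul0r// => K'p; apply: nK.
Qed.

Variables (N : nat) (ci : 'I_N -> Defs.index M) (cx : 'I_N -> 'rV[R]_n) (cr : 'I_N -> R).
Hypothesis cA : forall t, bball (cx t) (cr t) `<=` rng (ci t).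
Let chi t := bump (ci t) (cx t) (cr t).
Hypothesis cov : forall p, exists t, 0 < chi t p.

Let W p := \sum_t chi t p.
Let Kc t : set M := pp (ci t) @` bball (cx t) (cr t).

Let W_gt0 p : 0 < W p.
Proof.
have [t ht] := cov p; rewrite /W (bigD1 t)//= ltr_pwDl// sumr_ge0// => s _.
exact: bump_ge0.
Qed.

Let W_neq0 p : W p != 0. Proof. by rewrite gt_eqF. Qed.

(** A partition of unity, continuous on M and C^1 off the boundary. *)
Definition eta t p := chi t p * (W p)^-1.

Let eta_ge0 t p : 0 <= eta t p.
Proof. by rewrite mulr_ge0 ?bump_ge0// invr_ge0 ltW. Qed.

Let eta_sum p : \sum_t eta t p = 1.
Proof. by rewrite /eta -mulr_suml mulfV// W_neq0. Qed.

Let eta_le1 t p : eta t p <= 1.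
Proof. by rewrite -(eta_sum p) (bigD1 t)//= lerDl sumr_ge0. Qed.

Let eta_C1int t : C1int (eta t).
Proof.
apply: C1intM; first exact: bump_C1int.
by apply: C1intV => //; apply: C1int_sum => s; exact: bump_C1int.
Qed.

Let eta_continuous t : continuous (eta t).
Proof.
move=> p; have cW : W q @[q --> p] --> W p.
  by apply: (@cvg_sumR R) => s; exact: (@bump_continuous R n M _ _ _ (@cA s) p).
exact: (cvgM (@bump_continuous R n M _ _ _ (@cA t) p) (cvgV (W_neq0 p) cW)).
Qed.

Let eta_supp t p : ~ Kc t p -> eta t p = 0.
Proof. by move=> nK; rewrite /eta /chi bump_off ?mul0r. Qed.

Let Kc_compact t : compact (Kc t).
Proof. by apply: compact_pp => //; exact: bball_compact. Qed.

Let Kc_dom t : Kc t `<=` dom (ci t).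
Proof. by move=> _ [x /cA Ax <-]; exact: (rng_pp Ax).1. Qed.

Definition testfun u := continuous u /\ exists K, supp_in K u.

Definition part t u x := pull (ci t) (fun p => eta t p * u p) x * rho (ci t) x.

Definition integral u : R := \sum_t J (part t u).

Let part_Cc t u : testfun u -> Cc (part t u).
Proof.
move=> [cu [K sK]]; apply: (Cc_pull_rho (supp_inM sK (@Kc_compact t) (@eta_supp t))).
  by move=> p [_]; exact: Kc_dom.
by move=> p; exact: (cvgM (@eta_continuous t p) (cu p)).
Qed.

Lemma testfunD u v : testfun u -> testfun v -> testfun (fun p => u p + v p).
Proof.
move=> [cu [K [cK Kb u0]]] [cv [K' [cK' Kb' v0]]]; split.
  by move=> p; exact: (cvgD (cu p) (cv p)).
exists (K `|` K'); split; first exact: compactU.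
  by move=> p [/Kb|/Kb'].
by move=> p nK; rewrite u0 ?v0 ?addr0// => h; apply: nK; [right|left].
Qed.

Lemma testfunZ c u : testfun u -> testfun (fun p => c * u p).
Proof.
move=> [cu [K [cK Kb u0]]]; split.
  by move=> p; exact: (cvgM (cvg_cst c) (cu p)).
by exists K; split => // p /u0 ->; rewrite mulr0.
Qed.

Lemma integralD u v : testfun u -> testfun v ->
  integral (fun p => u p + v p) = integral u + integral v.
Proof.
move=> tu tv; rewrite /integral -big_split /=; apply: eq_bigr => t _.
rewrite -(JD (part_Cc t tu) (part_Cc t tv)); apply: J_eq => x; rewrite /part -mulrDl -pullD.
by congr (pull _ _ _ * _); apply/funext => p; rewrite mulrDr.
Qed.

Lemma integralZ c u : testfun u -> integral (fun p => c * u p) = c * integral u.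
Proof.
move=> tu; rewrite /integral mulr_sumr; apply: eq_bigr => t _.
rewrite -(JZ c (part_Cc t tu)); apply: J_eq => x; rewrite /part mulrA; congr (_ * _).
by rewrite /pull; case: asboolP => _; rewrite ?mulr0// mulrCA.
Qed.

Let rho_ge0 i x : rng i x -> 0 <= rho i x.
Proof. by move=> Ax; exact/ltW/(vol_density_gt0 (metric_chart i)). Qed.

Lemma integral_le u v : testfun u -> testfun v -> (forall p, u p <= v p) -> integral u <= integral v.
Proof.
move=> tu tv uv; apply: ler_sum => t _; apply: J_le; [exact: part_Cc|exact: part_Cc|] => x.
rewrite /part /pull; case: asboolP => Ax; last by rewrite !mul0r.
by rewrite ler_wpM2r ?rho_ge0// ler_wpM2l.
Qed.

Lemma integral_gt0 u p : testfun u -> (forall q, 0 <= u q) -> 0 < u p -> 0 < integral u.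
Proof.
move=> tu u0 up; have h x t : 0 <= part t u x.
  rewrite /part /pull; case: asboolP => Ax; last by rewrite mul0r.
  by rewrite mulr_ge0 ?rho_ge0// mulr_ge0.
have [t ht] := cov p; rewrite /integral (bigD1 t)//= ltr_pwDl//; last first.
  by apply: sumr_ge0 => s _; apply: J_ge0 => //; exact: part_Cc.
have ip : dom (ci t) p.
  by move: ht; rewrite /chi /bump; case: asboolP => //; rewrite ltxx.
apply: (@J_gt0 R n _ (cc (ci t) p)) => //; first exact: part_Cc.
rewrite /part pullE ?ppK//; last exact: cc_rng.
rewrite mulr_gt0//; last exact: (vol_density_gt0 (metric_chart _) (cc_rng ip)).
by rewrite mulr_gt0// mulr_gt0// invr_gt0.
Qed.

(** A substitute for the volume of M, since the constant 1 is not a test function: each piece lives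
    on a compact half-ball, where the density is bounded. *)
Lemma integral_volume : exists V, forall u, testfun u -> (forall p, 0 <= u p <= 1) -> integral u <= V.
Proof.
have h t : exists V, forall u, testfun u -> (forall p, 0 <= u p <= 1) -> J (part t u) <= V.
  have crho : {within bball (cx t) (cr t), continuous (rho (ci t))}.
    apply/subspace_continuousP => x /cA Ax.
    move=> P /(vol_density_cvg (metric_chart (ci t)) Ax) nP.
    by apply: (@filterS _ (nbhs x) (nbhs_filter x) _ _ _ nP) => y hy By; exact: hy (cA By).
  have cB := @bball_compact R n (cx t) (cr t).
  have [B [_ hB]] := compact_bounded (continuous_compact crho cB).
  have [B' [_ hB']] := compact_bounded cB; have [m hm] := nat_ge (`|B'| + 1).
  exists ((`|B| + 1) * @grid_card R n m) => u tu u01.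
  have off x : ~ bball (cx t) (cr t) x -> part t u x = 0.
    move=> nx; rewrite /part /pull; case: asboolP => Ax; rewrite ?mul0r//.
    rewrite /eta /chi bump_off ?mul0r// => -[y By yx]; apply: nx.
    by have := (rng_pp Ax).2; rewrite -yx (rng_pp (cA By)).2 => <-.
  apply: le_trans (ler_norm _) _; apply: J_bound.
  - by have [] := part_Cc t tu.
  - move=> x hx; apply: off => Bx; have := hB' (`|B'| + 1) _ x Bx.
    have hb : B' < `|B'| + 1 by apply: (le_lt_trans (ler_norm _)); rewrite ltrDl.
    by move=> /(_ hb) /= xB; have := le_lt_trans (le_trans xB hm) hx; rewrite ltxx.
  - move=> x; have [Bx|/off->] := pselect (bball (cx t) (cr t) x); last by rewrite normr0 addr_ge0.
    have rx : `|rho (ci t) x| <= `|B| + 1.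
      apply: hB; last by exists x.
      by apply: (le_lt_trans (ler_norm _)); rewrite ltrDl.
    rewrite /part normrM -[leRHS]mul1r; apply: ler_pM => //.
    rewrite pullE; last exact: cA.
    have /andP[u0 u1] := u01 (pp (ci t) x).
    have e0 : 0 <= eta t (pp (ci t) x) * u (pp (ci t) x) by exact: mulr_ge0.
    by rewrite [X in X <= _](ger0_norm e0 : _ = _) mulr_ile1.
exists (\sum_t sval (cid (h t))) => u tu u01; apply: ler_sum => t _.
by case: cid => V /= hV; exact: hV.
Qed.

(** Write u as the sum of the eta_s u. The integrand of the s-th term, cut once more by the eta_t,
    is moved to chart s, where the eta_t sum to 1 and [Green_chart] applies. *)
Lemma Green K u v : C1int u -> supp_in K u -> smooth v ->
  testfun (fun p => grad_prod u v p + u p * laplacian v p) /\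
  integral (fun p => grad_prod u v p + u p * laplacian v p) = 0.
Proof.
move=> Cu sK sv; have [cK Kb u0] := sK.
pose E w p := grad_prod w v p + w p * laplacian v p.
have sE w K' : supp_in K' w -> supp_in K' (E w).
  move=> sw; have [? ? w0] := sw; split => // p np; rewrite /E w0// mul0r addr0.
  by apply: (grad_prod_in_supp _ sw) => //; exact: domain_chart_at.
have cE w K' : C1int w -> supp_in K' w -> continuous (E w).
  move=> Cw sw; have [_ Kb' _] := sw; apply: (supp_in_continuous (sE _ _ sw)) => p Kp; apply: cvgD.
    exact: (C0int_continuous_at (C0int_grad_prod Cw (smooth_C1int sv)) (Kb' _ Kp)).
  apply: cvgM; first exact: (C0int_continuous_at (C1int_C0int Cw) (Kb' _ Kp)).
  exact: (smooth_continuous (smooth_laplacian sv)).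
split; first by split; [exact: (cE _ K)|exists K; exact: sE].
pose us s p := eta s p * u p.
have sus s : supp_in (K `&` Kc s) (us s) by apply: supp_inM => //; exact: eta_supp.
have Cus s : C1int (us s) by exact: C1intM.
have EE p : E u p = \sum_s E (us s) p.
  have [Kp|nK] := pselect (K p); last first.
    have [_ _ E0] := sE _ _ sK; rewrite E0// big1// => s _.
    by have [_ _ E0'] := sE _ _ (sus s); apply: E0' => -[].
  have Cp s : C1_at (chart_at p) p (us s) by apply: C1int_C1_at => //; [exact: domain_chart_at|exact: Kb].
  rewrite /E big_split /= -(grad_prod_sum _ v Cp) -mulr_suml /us.
  rewrite -mulr_suml eta_sum mul1r; congr (grad_prod _ v p + _).
  by apply/funext => q; rewrite -mulr_suml eta_sum mul1r.
have sts s t : supp_in (K `&` Kc s `&` Kc t) (fun p => eta t p * E (us s) p).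
  by apply: supp_inM; [exact: sE|exact: Kc_compact|exact: eta_supp].
have cts s t : continuous (fun p => eta t p * E (us s) p).
  by move=> p; exact: (cvgM (@eta_continuous t p) (cE _ _ (Cus s) (sus s) p)).
have tE s : testfun (E (us s)) by split; [exact: (cE _ _ (Cus s) (sus s))|exists (K `&` Kc s); exact: sE].
have step t : J (part t (E u)) = \sum_s J (part t (E (us s))).
  rewrite -(J_sum _ (fun s => part_Cc t (tE s))).1; apply: J_eq => x.
  rewrite /part /pull; case: asboolP => Ax; last by rewrite mul0r big1// => s _; rewrite mul0r.
  by rewrite EE mulr_sumr mulr_suml.
rewrite /integral (eq_bigr _ (fun t _ => step t)) exchange_big big1//= => s _.
(* The piece indexed by t is supported in the domains of both charts, so it may be integrated in
   chart s. *)
have cov_ts t : J (part t (E (us s))) =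
    J (fun x => pull (ci s) (fun p => eta t p * E (us s) p) x * rho (ci s) x).
  apply: (integral_chart (sts s t)) => //.
  - by move=> p [_]; exact: Kc_dom.
  - by move=> p [[_ +] _]; exact: Kc_dom.
rewrite (eq_bigr _ (fun t _ => cov_ts t)).
have Ccs t : Cc (fun x => pull (ci s) (fun p => eta t p * E (us s) p) x * rho (ci s) x).
  by apply: (Cc_pull_rho (sts s t)) => // p [[_ +] _]; exact: Kc_dom.
rewrite -(J_sum _ Ccs).1.
have Ks : K `&` Kc s `<=` dom (ci s) by move=> p [_]; exact: Kc_dom.
rewrite -[RHS](Green_chart (Cus s) (sus s) Ks sv); apply: J_eq => x.
rewrite -mulr_suml; congr (_ * _); rewrite /pull; case: asboolP => Ax; last by rewrite big1.
by rewrite -mulr_suml eta_sum mul1r /E (laplacianE sv (rng_pp Ax).1).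
Qed.

End Integral.

(** * Fields with nonnegative divergence and nonpositive outward flux *)

Section Divergence_theorem.
Context {R : realType} {n : nat} {M : riemannian R n}.
Implicit Types (p q : M) (i j : Defs.index M) (x y : 'rV[R]_n) (u v w : M -> R) (a b : 'I_n).
Implicit Types (U K : set M) (r c t : R).
Hypothesis cM : compact [set: M].

Lemma finite_chart_cover : exists (N : nat) (ci : 'I_N -> Defs.index M) (cx : 'I_N -> 'rV[R]_n)
    (cr : 'I_N -> R),
  (forall k, bball (cx k) (cr k) `<=` rng (ci k)) /\
  forall p, exists k, 0 < bump (ci k) (cx k) (cr k) p.
Proof.
have h p : exists2 r, 0 < r & bball (cc (chart_at p) p) r `<=` rng (chart_at p).
  have [r r0 hr] := @bball_sub R n M (chart_at p) setT p openT I (domain_chart_at p).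
  by exists r => // x /hr; rewrite im_setT.
pose r p := sval (cid2 (h p)).
have r0 p : 0 < r p by rewrite /r; case: cid2.
have hr p : bball (cc (chart_at p) p) (r p) `<=` rng (chart_at p) by rewrite /r; case: cid2.
pose chi p := bump (chart_at p) (cc (chart_at p) p) (r p).
(* Finite lists of centres, directed by inclusion: the near-covering form of compactness along this
   filter yields a finite subcover. *)
pose F : set_system (seq M) := [set P | exists s0 : seq M, forall s : seq M, {subset s0 <= s} -> P s].
have FF : Filter F.
  split; first by exists [::].
    move=> P Q [s hs] [s' hs']; exists (s ++ s') => s2 h2; split.
      by apply: hs => q qs; apply: h2; rewrite mem_cat qs.
    by apply: hs' => q qs; apply: h2; rewrite mem_cat qs orbT.
  by move=> P Q PQ [s hs]; exists s => s2 /hs; exact: PQ.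
have /compact_near_coveringP := cM.
move=> /(_ (seq M) F (fun s q => exists2 p, p \in s & 0 < chi p q) FF)[q _|s hs].
  exists ([set q' | 0 < chi q q'], [set s : seq M | q \in s]) => /=.
    split; last by exists [:: q] => s; apply; rewrite mem_head.
    have c : chi q q' @[q' --> q] --> chi q q by exact: (@bump_continuous R n M _ _ _ (hr q) q).
    by apply: (cvgr_gt _ c); apply: bump_gt0 => //; exact: domain_chart_at.
  by move=> [q' s] /= [h1 h2]; exists q.
have hs' q : exists2 p, p \in s & 0 < chi p q by exact: (hs s (fun _ => id) q I).
pose pk (k : 'I_(size s)) := tnth (in_tuple s) k.
exists (size s), (fun k => chart_at (pk k)), (fun k => cc (chart_at (pk k)) (pk k)), (fun k => r (pk k)).
split => // p; have [q qs hq] := hs' p; have [k kE] := seq_tnthP qs.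
by exists k; rewrite /pk -kE.
Qed.

Lemma positive_min K u : compact K -> continuous u -> (forall p, K p -> 0 < u p) ->
  exists2 t, 0 < t & forall p, K p -> t <= u p.
Proof.
move=> cK cu u0; have [K0|K0] := pselect (K !=set0); last first.
  by exists 1 => // p Kp; exfalso; apply: K0; exists p.
have [p Kp hp] := compact_EVT_min K0 cK (continuous_subspaceT cu).
exists (u p); first exact: u0 _ (set_mem Kp).
by move=> q Kq; apply: hp; exact/mem_set.
Qed.

Lemma grad_prod_affine c t u v p : C1_at (chart_at p) p u ->
  grad_prod (fun q => c + t * u q) v p = t * grad_prod u v p.
Proof.
move=> Cu; have ip : dom (chart_at p) p by exact: domain_chart_at.
rewrite /grad_prod /grad_prod_in /coord_grad_prod.
have -> : pd_row ((fun q => c + t * u q) \o pp (chart_at p)) (cc (chart_at p) p) =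
    t *: pd_row (u \o pp (chart_at p)) (cc (chart_at p) p).
  apply/rowP => a; rewrite !mxE; apply: has_pdE.
  have := has_pdD (@has_pd_cst R n a c _) (has_pdZ (c := t) (C1_at_has_pd (a := a) ip Cu)).
  by rewrite add0r.
by rewrite -!scalemxAl mxE.
Qed.

Lemma grad_prod_sqpos u v p : C1int u -> ~ boundary M p ->
  grad_prod (fun q => sqpos (u q)) v p = 2 * pos (u p) * grad_prod u v p.
Proof.
move=> Cu nb; have ip : dom (chart_at p) p by exact: domain_chart_at.
rewrite /grad_prod /grad_prod_in /coord_grad_prod; set i := chart_at p in ip *.
have -> : pd_row ((fun q => sqpos (u q)) \o pp i) (cc i p) = (2 * pos (u p)) *: pd_row (u \o pp i) (cc i p).
  have Ap := (inner_boundary ip).2 nb; apply/rowP => a; rewrite !mxE; apply: has_pdE.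
  have [dF _] := Cu i a.
  have cF : {for cc i p, continuous (u \o pp i)} by exact: (@C1int_C0int R n M u Cu i _ Ap).
  have [dS dE] := derivable_sqpos (dF _ Ap) cF.
  rewrite (pd_inner a (relopen_rng i) (Cu i) Ap).
  by have := derivable_has_pd dS; rewrite dE /= ppK.
by rewrite -!scalemxAl mxE.
Qed.

Lemma grad_prod_in_cst i c v p : grad_prod_in i (fun=> c) v p = 0.
Proof.
rewrite /grad_prod_in /coord_grad_prod (_ : pd_row _ _ = 0) ?mul0mx ?mxE//.
by apply/rowP => a; rewrite !mxE; apply: has_pdE; exact: has_pd_cst.
Qed.

Variables (f : M -> R).
Hypotheses (sf : smooth f) (fpos : forall p, ~ boundary M p -> 0 < f p)
  (fzero : forall p, boundary M p -> f p = 0).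
Hypothesis f_grad : forall p, boundary M p -> 0 < grad_prod f f p.

(* A C^1 cutoff: 0 where f <= t, 1 where f >= 2 t. *)
Let cut t p : R := sqpos (1 + (-1) * sqpos (2 + (- t^-1) * f p)).
(** The derivative of [cut t] as a function of f; it is nonnegative and vanishes where f >= 2 t. *)
Let slope t p : R :=
  2 * pos (1 + (-1) * sqpos (2 + (- t^-1) * f p)) * (2 * pos (2 + (- t^-1) * f p) * t^-1).

Let f_ge0 p : 0 <= f p.
Proof. by have [/fzero->//|/fpos/ltW] := pselect (boundary M p). Qed.

Let smooth_affine c t u : smooth u -> smooth (fun p => c + t * u p).
Proof. by move=> su; apply: smoothD; [exact: smooth_cst|apply: smoothM => //; exact: smooth_cst]. Qed.

Let inner_C1int t : C1int (fun p => sqpos (2 + (- t^-1) * f p)).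
Proof. by apply: C1int_sqpos; apply: smooth_C1int; exact: smooth_affine. Qed.

Let mid_C1int t : C1int (fun p => 1 + (-1) * sqpos (2 + (- t^-1) * f p)).
Proof.
apply: C1intD; first exact/smooth_C1int/smooth_cst.
by apply: C1intM => //; exact/smooth_C1int/smooth_cst.
Qed.

Let cut_C1int t : C1int (cut t).
Proof. exact: C1int_sqpos. Qed.

Let cut_grad t v p : ~ boundary M p -> grad_prod (cut t) v p = slope t p * grad_prod f v p.
Proof.
move=> nb; have ip : dom (chart_at p) p by exact: domain_chart_at.
rewrite (grad_prod_sqpos _ (@mid_C1int t) nb) grad_prod_affine; last first.
  exact: C1int_C1_at.
rewrite grad_prod_sqpos//; last by apply: smooth_C1int; exact: smooth_affine.
rewrite grad_prod_affine; last exact: smooth_C1_at.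
by rewrite /slope; ring.
Qed.

Let sqpos_le (r s : R) : r <= s -> sqpos r <= sqpos s.
Proof.
move=> rs; rewrite /sqpos ler_pXn2r// ?nnegrE ?pos_ge0// /pos ge_max le_max lexx/=.
by rewrite le_max rs orbT.
Qed.

Let sqpos1 : sqpos (1 : R) = 1.
Proof. by rewrite /sqpos pos_id// expr1n. Qed.

Let cut_ge0 t p : 0 <= cut t p. Proof. exact: sqpos_ge0. Qed.

Let cut_le1 t p : cut t p <= 1.
Proof.
by rewrite -[leRHS]sqpos1; apply: sqpos_le; rewrite mulN1r gerDl oppr_le0 sqpos_ge0.
Qed.

Let cut_low t p : 0 < t -> f p <= t -> cut t p = 0.
Proof.
move=> t0 ft; apply: sqpos_le0; rewrite mulN1r subr_le0 -[leLHS]sqpos1; apply: sqpos_le.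
by rewrite mulNr lerBrDr -lerBrDl mulrC ler_pdivrMr//; lra.
Qed.

Let slope_high t p : 0 < t -> 2 * t <= f p -> slope t p = 0.
Proof.
move=> t0 ft; rewrite /slope [pos (2 + _)]pos_le0 ?mulr0 ?mul0r ?mulr0//.
by rewrite mulNr subr_le0 mulrC ler_pdivlMr.
Qed.

Let slope_ge0 t p : 0 < t -> 0 <= slope t p.
Proof. by move=> t0; rewrite !mulr_ge0// ?pos_ge0// invr_ge0 ltW. Qed.

Let cut_high t p : 0 < t -> 2 * t <= f p -> cut t p = 1.
Proof.
move=> t0 ft; rewrite /cut [sqpos (2 + _)]sqpos_le0 ?mulr0 ?addr0 ?sqpos1//.
by rewrite mulNr subr_le0 mulrC ler_pdivlMr.
Qed.

Let cut_anti t s p : 0 < t -> t <= s -> cut s p <= cut t p.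
Proof.
move=> t0 ts; apply: sqpos_le; rewrite lerD2l !mulN1r lerN2; apply: sqpos_le.
by rewrite lerD2l !mulNr lerN2 ler_wpM2r// lef_pV2// posrE// (lt_le_trans t0).
Qed.

Let K0 t : set M := [set p | t <= f p].

Let cut_supp t : 0 < t -> supp_in (K0 t) (cut t).
Proof.
move=> t0; split.
- apply: (@subclosed_compact _ _ setT) => //.
  have -> : K0 t = f @^-1` [set s | t <= s] by [].
  by apply: closed_comp; [move=> p _; exact: smooth_continuous|exact: closed_ge].
- by move=> p /= tf /fzero f0; move: tf; rewrite /K0 /= f0 leNgt t0.
- by move=> p /= /negP; rewrite -ltNge => /ltW; exact: cut_low.
Qed.

Lemma smooth_sum (I : Type) (r : seq I) (h : I -> M -> R) : (forall k, smooth (h k)) ->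
  smooth (fun p => \sum_(k <- r) h k p).
Proof. by move=> sh i; exact: (@smooth_within_sum R n _ _ r _ (fun k => sh k i)). Qed.

(* Adding a small multiple e grad f to the field makes its flux positive near the
   boundary; testing with [cut t] for small t then bounds the integral of d by e
   times the volume of M. *)
Theorem divergence_zero (m : nat) (phi psi : 'I_m -> M -> R) :
  let d p := \sum_k (grad_prod (phi k) (psi k) p + phi k p * laplacian (psi k) p) in
  (forall k, smooth (phi k)) -> (forall k, smooth (psi k)) ->
  (forall p, ~ boundary M p -> 0 <= d p) ->
  (forall p, boundary M p -> 0 <= \sum_k phi k p * grad_prod f (psi k) p) ->
  forall p, ~ boundary M p -> d p = 0.
Proof.
move=> d sphi spsi d0 flux0 p0 nb0; apply/eqP; apply: contraT => dp0.
have {}dp0 : 0 < d p0 by rewrite lt_neqAle eq_sym dp0 d0.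
have [N [ci [cx [cr [cA cov]]]]] := finite_chart_cover.
pose Int := @integral R n M N ci cx cr.
have [V hV] := integral_volume cA cov.
have sd : smooth d.
  apply: smooth_sum => k; apply: smoothD; first exact: smooth_grad_prod.
  by apply: smoothM => //; exact: smooth_laplacian.
have test u v K : C1int u -> supp_in K u -> smooth v -> testfun (fun p => u p * v p).
  move=> Cu sK sv; have [cK Kb u0] := sK.
  have sKuv : supp_in K (fun p => u p * v p) by split => // p /u0 ->; rewrite mul0r.
  split; last by exists K.
  apply: (supp_in_continuous sKuv) => p Kp; apply: cvgM; last exact: smooth_continuous.
  exact: (C0int_continuous_at (C1int_C0int Cu) (Kb _ Kp)).
have tcut t v : 0 < t -> smooth v -> testfun (fun p => cut t p * v p).
  by move=> t0; exact: test (@cut_C1int t) (cut_supp t0).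
(* Then [cut t1] is 1 at p0, so [m1] is a positive mass of d, and [cut_anti] keeps it below the mass
   for any smaller t. *)
pose t1 := f p0 / 2; have t10 : 0 < t1 by rewrite divr_gt0// fpos.
pose m1 := Int (fun p => cut t1 p * d p).
have m10 : 0 < m1.
  apply: (integral_gt0 cA cov (p := p0)); first exact: tcut.
    move=> q; have [/fzero fq|nb] := pselect (boundary M q); last by rewrite mulr_ge0// d0.
    by rewrite cut_low ?mul0r// fq ltW.
  by rewrite cut_high// ?mul1r// /t1 mulrC divfK.
have slap : smooth (laplacian f) by exact: smooth_laplacian.
have [C C0 hC] : exists2 C, 0 <= C & forall p, - laplacian f p <= C.
  have cl : continuous (fun p => - laplacian f p) by exact/smooth_continuous/smoothN.
  have [|c _ hc] := compact_EVT_max _ cM (continuous_subspaceT cl); first by exists p0.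
  exists (`|- laplacian f c|) => // p; apply: le_trans (ler_norm _).
  by apply: hc; exact/mem_set.
(* D bounds the integral of [cut t] times - Lap f for every t, so the added e grad f costs at most e
   D, and the choice of e below makes this less than [m1]. *)
pose D := C * (`|V| + 1); have D0 : 0 <= D by rewrite mulr_ge0// addr_ge0.
pose e := m1 / (D + 1); have e0 : 0 < e by rewrite divr_gt0// ltr_wpDl.
pose flux p := \sum_k phi k p * grad_prod f (psi k) p + e * grad_prod f f p.
have sflux : smooth flux.
  apply: smoothD; last by apply: smoothM; [exact: smooth_cst|exact: smooth_grad_prod].
  by apply: smooth_sum => k; apply: smoothM => //; exact: smooth_grad_prod.
pose S : set M := [set p | flux p <= 0].
have cS : compact S.
  apply: (@subclosed_compact _ _ setT) => //.
  have -> : S = flux @^-1` [set s | s <= 0] by [].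
  by apply: closed_comp; [move=> p _; exact: smooth_continuous|exact: closed_le].
(* On the boundary the flux is at least e |grad f|^2 > 0, so the compact set S misses the boundary
   and f is bounded below on it. *)
have [t2 t20 ht2] : exists2 t, 0 < t & forall p, S p -> t <= f p.
  apply: positive_min => //; first exact: smooth_continuous.
  move=> p Sp; apply: fpos => bp; move: Sp; rewrite /S /= leNgt => /negP; apply.
  by rewrite ltr_wpDl ?flux0// mulr_gt0// f_grad.
(* t <= t1 is for [cut_anti]; 2 t < t2 makes the flux positive wherever [slope t] can be nonzero. *)
pose t := Num.min t1 (t2 / 4); have t0 : 0 < t by rewrite lt_min t10 divr_gt0.
have tt1 : t <= t1 by rewrite ge_min lexx.
have tt2 : 2 * t < t2.
  have h : t <= t2 / 4 by rewrite ge_min lexx orbT.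
  by apply: (@le_lt_trans _ _ (t2 / 2)); lra.
have fluxpos p : f p < 2 * t -> 0 < flux p.
  by move=> fp; rewrite ltNge; apply/negP => /ht2; rewrite leNgt (lt_trans fp).
have green u v : smooth u -> smooth v -> let T p := grad_prod (fun q => cut t q * u q) v p
    + cut t p * u p * laplacian v p in testfun T /\ Int T = 0.
  move=> su sv; apply: (Green cA cov (K := K0 t)) => //.
    by apply: C1intM => //; exact: smooth_C1int.
  by have [cK Kb c0] := cut_supp t0; split => // p /c0 ->; rewrite mul0r.
have greenE u v p : smooth u -> smooth v -> ~ boundary M p ->
    grad_prod (fun q => cut t q * u q) v p + cut t p * u p * laplacian v p =
    cut t p * (grad_prod u v p + u p * laplacian v p) + slope t p * (u p * grad_prod f v p).
  move=> su sv nb; have ip : dom (chart_at p) p by exact: domain_chart_at.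
  rewrite grad_prodM ?cut_grad//; first by ring.
  - exact: C1int_C1_at.
  - exact: smooth_C1_at.
have green0 u v p : smooth u -> smooth v -> boundary M p ->
    grad_prod (fun q => cut t q * u q) v p + cut t p * u p * laplacian v p = 0.
  move=> su sv bp; have [cK Kb c0] := cut_supp t0.
  have sK : supp_in (K0 t) (fun q => cut t q * u q) by split => // q /c0 ->; rewrite mul0r.
  have nK : ~ K0 t p by move=> /Kb.
  rewrite c0// !mul0r addr0; apply: (grad_prod_in_supp _ sK) => //; exact: domain_chart_at.
pose T k p := grad_prod (fun q => cut t q * phi k q) (psi k) p + cut t p * phi k p * laplacian (psi k) p.
have sumT (s : seq 'I_m) : testfun (fun p => \sum_(k <- s) T k p) /\ Int (fun p => \sum_(k <- s) T k p) = 0.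
  elim: s => [|k s [IH1 IH2]].
    under eq_fun do rewrite big_nil.
    have [tT IT] := green _ _ (smooth_cst (0 : R)) sf.
    have h0 : (fun p => 0) = (fun p : M => 0 * (grad_prod (fun q => cut t q * 0) f p + cut t p * 0 * laplacian f p)).
      by apply/funext => p; rewrite mul0r.
    by rewrite h0; split; [exact: testfunZ|rewrite /Int (integralZ cA cov)// -/Int IT mulr0].
  have [tT IT] := green _ _ (sphi k) (spsi k).
  under eq_fun do rewrite big_cons; split; first exact: testfunD.
  by rewrite /Int (integralD cA cov)// -/Int IH2 IT addr0.
have [tS IS] := sumT (index_enum 'I_m).
have [tf If] := green _ _ (smooth_cst e) sf.
pose L p := \sum_k T k p + (grad_prod (fun q => cut t q * e) f p + cut t p * e * laplacian f p).
have tL : testfun L by exact: testfunD.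
have IL : Int L = 0 by rewrite /Int (integralD cA cov)// -/Int IS If addr0.
(* Off the boundary L is [cut t] (d + e Lap f) + [slope t] * flux; dropping the last term and
   bounding Lap f below by - C leaves Q. *)
pose Q p := cut t p * d p + (- (e * C)) * (cut t p * 1).
have tc1 : testfun (fun p => cut t p * 1) by apply: tcut => //; exact: smooth_cst.
have td : testfun (fun p => cut t p * d p) by exact: tcut.
have tQ : testfun Q by apply: testfunD => //; exact: testfunZ.
have QL : Int Q <= Int L.
  apply: (integral_le cA cov) => // p; have [bp|nb] := pselect (boundary M p).
    have L0 : L p = 0.
      by rewrite /L (green0 _ _ _ (smooth_cst e) sf bp) addr0 big1// => k _; exact: green0.
    by rewrite L0 /Q cut_low ?fzero ?(ltW t0)// !mul0r mulr0 addr0.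
  rewrite /L (greenE _ _ _ (smooth_cst e) sf nb).
  under eq_bigr do rewrite /T greenE//.
  rewrite big_split /= -!mulr_sumr -/(d p).
  have -> : grad_prod (fun _ : M => e) f p = 0 by rewrite /grad_prod; exact: grad_prod_in_cst.
  have : 0 <= slope t p * flux p.
    have [fp|fp] := leP (2 * t) (f p); first by rewrite slope_high ?mul0r.
    by rewrite mulr_ge0// ?slope_ge0// ltW// fluxpos.
  rewrite /flux /Q mulrDr mulr1.
  have h1 := hC p; have h2 := cut_ge0 t p.
  have : cut t p * e * (- laplacian f p) <= cut t p * e * C by rewrite ler_wpM2l// mulr_ge0// ltW.
  lra.
rewrite IL in QL; move: QL.
rewrite /Int (integralD cA cov)//; last exact: testfunZ.
rewrite (integralZ cA cov)//.
have c1 : integral ci cx cr (fun p => cut t p * 1) <= V.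
  by apply: hV => // p; rewrite mulr1 cut_ge0 cut_le1.
have c2 : m1 <= integral ci cx cr (fun p => cut t p * d p).
  apply: (integral_le cA cov) => //; first exact: tcut.
  move=> q; have [/fzero fq|nb] := pselect (boundary M q); last by rewrite ler_wpM2r ?d0// cut_anti.
  by rewrite !cut_low ?mul0r// fq ltW.
move=> h; have eC : 0 <= e * C by rewrite mulr_ge0// ltW.
have h3 : e * C * integral ci cx cr (fun p => cut t p * 1) <= e * C * (`|V| + 1).
  by rewrite ler_wpM2l//; have := ler_norm V; lra.
have h4 : e * C * (`|V| + 1) < m1.
  rewrite -mulrA -/D /e mulrAC ltr_pdivrMr; last by rewrite ltr_wpDl.
  by rewrite ltr_pM2l//; lra.
exfalso; lra.
Qed.

End Divergence_theorem.

(** * Geometry of the boundary *)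

Section Wall_geometry.
Context {R : realType} {n : nat} {A : set 'rV[R]_n} {G : 'rV[R]_n -> 'M[R]_n}.
Hypothesis mG : metric_on A G.
Variable o : 'I_n.
Hypothesis o0 : o = 0%N :> nat.
Implicit Types (x y : 'rV[R]_n) (a b c d : 'I_n).
Local Notation g x := (gi (G := G) x).

(** The value is left implicit: in [second_form_tangent] it multiplies a component of [basis_vec o]
    that is 0. *)
Lemma has_pd_rsqrt a (s : 'rV[R]_n -> R) x l : has_pd a s x l -> 0 < s x ->
  exists l', has_pd a (fun y => (Num.sqrt (s y))^-1) x l'.
Proof.
move=> hs s0; have cs := has_pd_right_continuous hs.
pose w h := Num.sqrt (s (x + h *: basis_vec a)); pose w0 := Num.sqrt (s x).
have w00 : 0 < w0 by rewrite sqrtr_gt0.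
have cw : w h @[h --> (0 : R)^'+] --> w0 by exact: (cvg_cont cs (@sqrt_continuous R _)).
exists (- (w0 * w0 * (w0 + w0))^-1 * l).
have c1 : - (w h * w0 * (w h + w0))^-1 @[h --> (0 : R)^'+] --> - (w0 * w0 * (w0 + w0))^-1.
  apply: cvgN; apply: cvgV; first by rewrite gt_eqF// !mulr_gt0// addr_gt0.
  exact: (cvgM (cvgM cw (cvg_cst w0)) (cvgD cw (cvg_cst w0))).
have c2 : - (w h * w0 * (w h + w0))^-1 * (h^-1 * (s (x + h *: basis_vec a) - s x)) @[h --> (0 : R)^'+]
    --> - (w0 * w0 * (w0 + w0))^-1 * l by exact: (cvgM c1 hs).
apply: (cvg_trans _ c2); apply: near_eq_cvg.
have sp : \forall h \near (0 : R)^'+, 0 < s (x + h *: basis_vec a) by exact: (cvgr_gt _ cs).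
apply: filterS sp => h sp; rewrite -/(w h) -/w0.
have e1 : s (x + h *: basis_vec a) = w h ^+ 2 by rewrite sqr_sqrtr// ltW.
have e2 : s x = w0 ^+ 2 by rewrite sqr_sqrtr// ltW.
have wh : 0 < w h by rewrite sqrtr_gt0.
rewrite e1 e2.
have n1 : w h != 0 by rewrite gt_eqF.
have n2 : w0 != 0 by rewrite gt_eqF.
have n3 : w h + w0 != 0 by rewrite gt_eqF// addr_gt0.
rewrite subr_sqr.
have -> : (w h)^-1 - w0^-1 = - (w h * w0)^-1 * (w h - w0) by field; rewrite n1 n2.
have -> : (w h * w0 * (w h + w0))^-1 = (w h * w0)^-1 * (w h + w0)^-1 by rewrite invfM.
by generalize ((w h * w0)^-1) (h^-1) => z h'; field.
Qed.

Lemma conormalE : conormal = basis_vec o :> 'rV[R]_n.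
Proof.
apply/rowP => a; rewrite !mxE eqxx /=; congr (_%:R); congr (nat_of_bool _).
by apply/eqP/eqP => [a0|->//]; apply: val_inj; rewrite /= o0.
Qed.

Lemma posdef_diag (S : 'M[R]_n) a :
  (forall v : 'rV[R]_n, v != 0 -> 0 < (v *m S *m v^T) ord0 ord0) -> 0 < S a a.
Proof.
move=> pS; have v0 : (delta_mx ord0 a : 'rV[R]_n) != 0.
  by apply/eqP => /rowP/(_ a); rewrite !mxE !eqxx => /eqP; rewrite oner_eq0.
by have := pS _ v0; rewrite -rowE trmx_delta -colE !mxE.
Qed.

Lemma gi_posdef x (v : 'rV[R]_n) : A x -> v != 0 -> 0 < (v *m g x *m v^T) ord0 ord0.
Proof.
move=> Ax v0; have uG := metric_unit mG Ax.
have w0 : v *m g x != 0.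
  by apply/eqP => h; move: v0; rewrite -(mulmxKV uG v) -/(g x) h mul0mx eqxx.
have := metric_on_pos mG Ax w0.
by rewrite trmx_mul (gi_sym mG Ax) !mulmxA (mulmxKV uG).
Qed.

Lemma gi_diag_gt0 x a : A x -> 0 < g x a a.
Proof. by move=> Ax; apply: posdef_diag => v; exact: gi_posdef. Qed.

Let k x := - (Num.sqrt (g x o o))^-1.

Lemma coord_normalE x : coord_normal G x = k x *: (basis_vec o *m g x).
Proof.
rewrite /coord_normal conormalE /k; congr (- (Num.sqrt _)^-1 *: _).
by rewrite -rowE trmx_delta -colE !mxE.
Qed.

Lemma normal_lower x : A x -> coord_normal G x *m G x = k x *: basis_vec o.
Proof. by move=> Ax; rewrite coord_normalE -scalemxAl (mulmxKV (metric_unit mG Ax)). Qed.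

Let k_sqr x : A x -> k x ^+ 2 * g x o o = 1.
Proof.
move=> Ax; have s0 := gi_diag_gt0 o Ax.
by rewrite /k sqrrN exprVn sqr_sqrtr ?ltW// mulVf// gt_eqF.
Qed.

(** The lowered normal is k dx^o, so its derivative has no component along b, and compatibility with
    the metric leaves - k Gamma^o_ab. *)
Lemma second_form_tangent x a b : A x -> b != o ->
  coord_second_form G x a b = (Num.sqrt (g x o o))^-1 * christoffel G o a b x.
Proof.
move=> Ax bo; have s0 := gi_diag_gt0 o Ax; have uG := metric_unit mG Ax.
have rA := metric_on_relopen mG.
have hg c d : has_pd a (fun y => g y c d) x (pd a (fun y => g y c d) x).
  exact: (@smooth_pd R n _ _ _ a rA (@smooth_gi R n _ _ mG c d) Ax).
have [l hl] := has_pd_rsqrt (hg o o) s0.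
have hk : has_pd a k x (- l).
  by have := has_pdZ (c := -1) hl; rewrite mulN1r; congr has_pd; apply/funext => y; rewrite mulN1r.
have hN c : has_pd a (fun y => coord_normal G y ord0 c) x
    (pd a (fun y => coord_normal G y ord0 c) x).
  have e : (fun y => coord_normal G y ord0 c) = (fun y => k y * g y o c).
    by apply/funext => y; rewrite coord_normalE mxE -rowE mxE.
  by rewrite e; have h := has_pdM hk (hg o c); rewrite (has_pdE h).
pose D : 'rV[R]_n := \row_c pd a (fun y => coord_normal G y ord0 c) x.
have hD : has_pdmx a (coord_normal G) x D.
  by move=> i j; rewrite (ord1 i) mxE; exact: hN.
have h1 := has_pdmx_mul hD (has_pd_metric mG (c := a) Ax).
have h2 : has_pdmx a (fun y => coord_normal G y *m G y) x (- l *: basis_vec o).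
  move=> i j; rewrite mxE.
  have := has_pdM hk (@has_pd_cst R n a (basis_vec o i j) x); rewrite mulr0 add0r.
  apply: has_pd_ext; first by rewrite normal_lower// [RHS]mxE.
  by have := relopen_shift a rA Ax; apply: filterS => h Ah; rewrite normal_lower// [RHS]mxE.
have /(congr1 (fun S : 'rV[R]_n => S ord0 b)) := has_pdmx_unique h1 h2.
rewrite [in LHS]mxE [in RHS]mxE [in X in _ = _ * X]mxE eqxx (negPf bo) mulr0 => e.
have -> : coord_second_form G x a b = (D *m G x) ord0 b + (coord_normal G x *m (Gam (G := G) a x)^T *m G x) ord0 b.
  rewrite [LHS]mxE [in RHS]mxE [X in _ = _ + X]mxE -big_split /=; apply: eq_bigr => c _.
  rewrite mulrDl [D _ _]mxE; congr (_ + _ * _); rewrite mxE; apply: eq_bigr => d _.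
  by rewrite !mxE mulrC.
move: e => /eqP; rewrite addrC addr_eq0 => /eqP ->.
have lowE : lowGam (G := G) a x = G x *m Gam (G := G) a x by rewrite GamE mulKVmx.
have -> : coord_normal G x *m (Gam (G := G) a x)^T *m G x = coord_normal G x *m (lowGam (G := G) a x)^T.
  by rewrite lowE trmx_mul (metric_on_sym mG Ax) mulmxA.
rewrite -(lowGamD mG a Ax) mulmxDr [X in - X + _]mxE opprD subrK lowE mulmxA normal_lower//.
by rewrite -scalemxAl mxE -rowE !mxE /k mulNr opprK.
Qed.

(** g^ab - nu^a nu^b vanishes when a or b is o, so the tangential hypothesis suffices, and its
    contraction with g is n minus the squared length of the normal. *)
Lemma mean_curvature_umbilic x mu : A x ->
  (forall a b, a != o -> b != o -> christoffel G o a b x = mu * G x a b) ->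
  coord_mean_curvature G x = (Num.sqrt (g x o o))^-1 * mu * (n%:R - 1).
Proof.
move=> Ax hmu; have uG := metric_unit mG Ax.
pose P a b := invmx (G x) a b - coord_normal G x ord0 a * coord_normal G x ord0 b.
have NE a : coord_normal G x ord0 a = k x * g x o a by rewrite coord_normalE mxE -rowE mxE.
have gC a b : g x a b = g x b a by rewrite -[in LHS](gi_sym mG Ax) mxE.
have P0 b : P o b = 0.
  rewrite /P !NE -/(g x) mulrACA -expr2 mulrA k_sqr// mul1r subrr.
  by [].
have PC a b : P a b = P b a by rewrite /P -/(g x) gC [X in _ - X]mulrC.
have -> : coord_mean_curvature G x = \sum_a \sum_b P a b * ((Num.sqrt (g x o o))^-1 * mu * G x a b).
  apply: eq_bigr => a _; apply: eq_bigr => b _; rewrite -/(P a b).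
  have [->|ao] := eqVneq a o; first by rewrite P0 !mul0r.
  have [->|bo] := eqVneq b o; first by rewrite PC P0 !mul0r.
  by congr (_ * _); rewrite second_form_tangent// hmu// mulrA.
have -> : \sum_a \sum_b P a b * ((Num.sqrt (g x o o))^-1 * mu * G x a b) =
    (Num.sqrt (g x o o))^-1 * mu * \sum_a \sum_b P a b * G x a b.
  rewrite mulr_sumr; apply: eq_bigr => a _; rewrite mulr_sumr; apply: eq_bigr => b _.
  by rewrite mulrCA.
congr (_ * _).
have -> : \sum_a \sum_b P a b * G x a b = \tr (g x *m G x) -
    (coord_normal G x *m G x *m (coord_normal G x)^T) ord0 ord0.
  have -> : \tr (g x *m G x) = \sum_a \sum_b g x a b * G x a b.
    apply: eq_bigr => a _; rewrite mxE; apply: eq_bigr => b _.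
    by rewrite -[in RHS](metric_on_sym mG Ax) mxE.
  have -> : (coord_normal G x *m G x *m (coord_normal G x)^T) ord0 ord0 =
      \sum_a \sum_b coord_normal G x ord0 a * coord_normal G x ord0 b * G x a b.
    rewrite mxE exchange_big /=; apply: eq_bigr => b _; rewrite mxE mulr_suml; apply: eq_bigr => a _.
    by rewrite [_^T _ _]mxE mulrAC.
  rewrite -sumrB; apply: eq_bigr => a _; rewrite -sumrB; apply: eq_bigr => b _.
  by rewrite mulrBl.
rewrite mulVmx// mxtrace1 normal_lower//; congr (_ - _).
have -> : (k x *: basis_vec o *m (coord_normal G x)^T) ord0 ord0 = k x * coord_normal G x ord0 o.
  by rewrite -scalemxAl mxE -rowE mxE [in LHS]mxE.
by rewrite NE mulrA -expr2 k_sqr.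
Qed.

End Wall_geometry.

(** * Functions with vanishing gradient, and extension of identities to the boundary *)

Section Locally_constant.
Context {R : realType} {n : nat}.
Implicit Types (x y v : 'rV[R]_n) (F : 'rV[R]_n -> R).

Lemma derive_dir (V : set 'rV[R]_n) F x v : open V -> Ck 1 V F -> V x ->
  derivable F x v /\ 'D_v F x = \sum_a 'D_(basis_vec a) F x * v ord0 a.
Proof.
move=> oV CF Vx; apply: is_derive_quotient.
apply: (@cvg_chain R n F x R (0 : R)^' id (fun=> x) (fun h => x + h *: v) (fun a => v ord0 a)).
- exact: (Ck1_partials oV CF Vx).
- exact: cvg_cst.
- exact: shift_cvg_dnbhs.
- move=> a; have c0 : (fun=> v ord0 a) @ (0 : R)^' --> v ord0 a by exact: cvg_cst.
  apply: (cvg_trans _ c0); apply: near_eq_cvg.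
  apply: filterS (nbhs_dnbhs_neq (0 : R)) => h h0.
  by rewrite !mxE addrAC subrr add0r mulKf.
Qed.

(** [MVT_line] asks for derivability on a segment symmetric about its base point; hence the midpoint
    m and the half difference d. *)
Lemma const_segment (V : set 'rV[R]_n) F x y : open V -> Ck 1 V F ->
  (forall s, 0 <= s <= 1 -> let z := x + s *: (y - x) in
     V z /\ forall a, (y - x) ord0 a * 'D_(basis_vec a) F z = 0) ->
  F y = F x.
Proof.
move=> oV CF h; pose d := 2^-1 *: (y - x); pose m := x + d.
have hm t : `|t| <= 1 -> derivable F (m + t *: d) d /\ 'D_d F (m + t *: d) = 0.
  move=> t1; have [|Vz hz] := h ((1 + t) / 2).
    by move: t1; rewrite ler_norml => /andP[? ?]; apply/andP; split; lra.
  have zE : x + ((1 + t) / 2) *: (y - x) = m + t *: d.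
    by rewrite /m /d -addrA; congr (_ + _); rewrite scalerA -scalerDl; congr (_ *: _); field.
  rewrite zE in Vz hz; have [d1 d2] := @derive_dir V F _ d oV CF Vz; split => //.
  rewrite d2 big1// => a _; have -> : d ord0 a = 2^-1 * (y - x) ord0 a by rewrite mxE.
  by rewrite mulrCA [X in _ * X]mulrC hz mulr0.
have key t : `|t| = 1 -> F (m + t *: d) = F m.
  move=> t1; have [c|c ch] := @MVT_line R n F m d t.
    by rewrite t1 => /hm[].
  by rewrite t1 in ch; have [_ ->] := hm c ch; rewrite mul0r => /eqP; rewrite subr_eq0 => /eqP.
have k1 := key 1 (normr1 _); have k2 := key (-1) (normrN1 _).
have e1 : m + 1 *: d = y.
  by rewrite /m scale1r -addrA /d -scalerDl (_ : 2^-1 + 2^-1 = 1 :> R) ?scale1r ?[x + _]addrC ?subrK//; field.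
have e2 : m + -1 *: d = x by rewrite /m scaleN1r addrK.
by rewrite -e1 k1 -k2 e2.
Qed.

Context {M : riemannian R n}.
Implicit Types (p q : M) (i : Defs.index M) (u : M -> R) (C : set 'rV[R]_n) (B : set M).

(** C is the half-space or the wall. The product in the hypothesis covers both: on the wall the
    normal derivative is unrestricted, but the normal coordinate does not vary. *)
Lemma locally_const i p u C : smooth u -> dom i p -> C `<=` half_space ->
  (forall x y (s : R), C x -> C y -> 0 <= s <= 1 -> C (x + s *: (y - x))) -> C (cc i p) ->
  (forall y z a, rng i y -> C y -> C z -> (z - cc i p) ord0 a * pd a (u \o pp i) y = 0) ->
  \forall q \near p, C (cc i q) -> u q = u p.
Proof.
move=> su ip Ch Cconv Cp hpd; have Ap := cc_rng ip.
have [V [F [oV Vp CF uF]]] := su i _ Ap; have [V0 oV0 AE] := relopen_rng (M := M) i.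
have V0p : V0 (cc i p) by move: Ap; rewrite AE => -[].
have /nbhs_ballP[r r0 hr] := open_nbhs_nbhs (conj (openI oV oV0) (conj Vp V0p)).
have nd := open_nbhs_nbhs (conj (open_dom i) ip).
have nb : \forall q \near p, ball (cc i p) r (cc i q).
  exact: (cc_continuous ip (nbhsx_ballx _ _ r0)).
apply: filterS2 nd nb => q iq bq Cq.
have Aq := cc_rng iq; have [Vq _] := hr _ bq.
have up : u p = F (cc i p) by rewrite -(uF _ Vp Ap) /= -/(pp i _) ppK.
have uq : u q = F (cc i q) by rewrite -(uF _ Vq Aq) /= -/(pp i _) ppK.
rewrite uq up; apply: (const_segment oV (CF 1%N)) => s s01 z.
have Cz : C z by exact: Cconv.
have bz : ball (cc i p) r z.
  have bq' : `|cc i q - cc i p| < r by move: bq; rewrite -ball_normE /= distrC.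
  rewrite -ball_normE /= distrC /z addrAC subrr add0r normrZ; apply: le_lt_trans bq'.
  by have /andP[s0 s1] := s01; rewrite ger0_norm// ler_piMl.
have [Vz V0z] := hr _ bz.
have Az : rng i z by rewrite AE; split => //; exact: Ch.
split => // a; have := @smooth_has_pd R n _ _ _ _ _ a (relopen_rng i) Az oV Vz (CF 1%N) uF.
by move=> /has_pdE <-; exact: hpd.
Qed.

Lemma connected_const B u : continuous u -> connected B ->
  (forall p, B p -> \forall q \near p, B q -> u q = u p) ->
  forall p q, B p -> B q -> u q = u p.
Proof.
move=> cu cB loc p q Bp Bq.
have BE : B `&` [set q | u q = u p] = B.
  apply: cB; first by exists p.
    exists ([set q | B q -> u q = u p]^°); first exact: open_interior.
    apply/seteqP; split => q' [Bq' h]; split => //; last exact: (nbhs_singleton h).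
    by have := loc _ Bq'; apply: filterS => q2 h2 Bq2; rewrite h2.
  exists [set q | u q = u p] => //.
  have -> : [set q | u q = u p] = u @^-1` [set t | t = u p] by [].
  by apply: closed_comp; [move=> q' _; exact: cu|exact: closed_eq].
by have [] : (B `&` [set q | u q = u p]) q by rewrite BE.
Qed.

Lemma interior_dense u (v : M -> R) : continuous u -> continuous v ->
  (forall p, ~ boundary M p -> u p = v p) -> u =1 v.
Proof.
move=> cu cv uv p; have ip : dom (chart_at p) p by exact: domain_chart_at.
set i := chart_at p in ip; have Ap := cc_rng ip.
have nI := relopen_approach (relopen_rng i) Ap.
have c : pp i (cc i p + h *: const_mx 1) @[h --> (0 : R)^'+] --> p.
  move=> B nB; have := pp_cvg Ap; rewrite ppK// => /(_ _ nB) /(@shift_cvg0 R n (cc i p) (const_mx 1)).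
  by apply: filterS2 nI => h [Ah _]; exact.
have c1 := cvg_cont c (cu p); have c2 := cvg_cont c (cv p).
apply: (cvg_unique (@norm_hausdorff _ _) c1); apply: cvg_trans c2; apply: near_eq_cvg.
by apply: filterS nI => h /inner_rng_pp[_ nb]; rewrite uv.
Qed.

Lemma half_space_convex (x y : 'rV[R]_n) (s : R) : half_space x -> half_space y -> 0 <= s <= 1 ->
  half_space (x + s *: (y - x)).
Proof.
move=> hx hy /andP[s0 s1] a a0; rewrite !mxE.
have := hx a a0; have := hy a a0; nra.
Qed.

Lemma grad_prod_in_pd_row0 i p u : dom i p -> grad_prod_in i u u p = 0 -> pd_row (u \o pp i) (cc i p) = 0.
Proof.
move=> ip; rewrite /grad_prod_in /coord_grad_prod => h; apply/eqP; apply: contraT => n0.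
by have := gi_posdef (metric_chart i) (cc_rng ip) n0; rewrite h ltxx.
Qed.

Lemma grad0_const u : smooth u -> connected [set: M] ->
  (forall p, ~ boundary M p -> grad_prod u u p = 0) -> forall p q, u q = u p.
Proof.
move=> su conM g0 p q; apply: (connected_const (smooth_continuous su) conM) => // {p q} p _.
have gz : grad_prod u u =1 (fun=> 0).
  by apply: interior_dense => //; [apply: smooth_continuous; exact: smooth_grad_prod|exact: cst_continuous].
have ip : dom (chart_at p) p by exact: domain_chart_at.
have hpd y z a : rng (chart_at p) y -> half_space y -> half_space z ->
    (z - cc (chart_at p) p) ord0 a * pd a (u \o pp (chart_at p)) y = 0.
  move=> Ay _ _; have [iy yE] := rng_pp Ay; have := gz (pp (chart_at p) y).
  have Cy := smooth_C1_at iy su; rewrite (grad_prodE iy Cy Cy) => /(grad_prod_in_pd_row0 iy).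
  by rewrite yE => /rowP/(_ a); rewrite !mxE => ->; rewrite mulr0.
have h := @locally_const (chart_at p) p u half_space su ip (fun _ => id) half_space_convex
  (rng_half (cc_rng ip)) hpd.
have nd := open_nbhs_nbhs (conj (open_dom (chart_at p)) ip).
by apply: filterS2 nd h => q iq h _; apply: h; exact: rng_half (cc_rng iq).
Qed.

End Locally_constant.

(** * The V-static potential along the boundary *)

Section V_static.
Context {R : realType} {n : nat} {M : riemannian R n}.
Implicit Types (p q : M) (i : Defs.index M) (u v : M -> R) (x y : 'rV[R]_n) (a b c : 'I_n).
Variables (f : M -> R) (kappa : R).
Hypothesis n2 : (1 < n)%N.
Hypothesis hM : compact_v_static f kappa.
Hypothesis kappa0 : kappa != 0.

Let o : 'I_n := Ordinal (ltnW n2).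
Let o0 : o = 0%N :> nat. Proof. by []. Qed.

Lemma ord_eq_o a : a = 0%N :> nat -> a = o.
Proof. by move=> a0; apply: val_inj; rewrite /= a0. Qed.

Lemma wallE x : wall x <-> half_space x /\ x ord0 o = 0.
Proof.
split=> [[hx [a /ord_eq_o -> xa]]|[hx xo]]; first by [].
by split => //; exists o.
Qed.

Lemma wall_convex x y (s : R) : wall x -> wall y -> 0 <= s <= 1 -> wall (x + s *: (y - x)).
Proof.
move=> /wallE[hx xo] /wallE[hy yo] s01; apply/wallE; split; first exact: half_space_convex.
by rewrite !mxE xo yo subrr mulr0 addr0.
Qed.

Lemma wall_shift x a (h : R) : a != o -> 0 <= h -> wall x -> wall (x + h *: basis_vec a).
Proof.
move=> ao h0 /wallE[hx xo]; apply/wallE; split; first exact: half_space_shift.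
by rewrite !mxE xo eqxx /= (eq_sym o a) (negPf ao) mulr0 addr0.
Qed.

Lemma rng_wall_boundary i x : rng i x -> wall x -> boundary M (pp i x).
Proof. by move=> Ax wx; exists i; have [ix xE] := rng_pp Ax; split => //; rewrite -[Defs.coord _ _]/(cc i _) xE. Qed.

Lemma tangential_shift i p a : boundary M p -> dom i p -> a != o ->
  \forall h \near (0 : R)^'+, rng i (cc i p + h *: basis_vec a) /\ wall (cc i p + h *: basis_vec a).
Proof.
move=> bp ip ao; have wp := boundary_wall bp ip.
have nA := relopen_shift a (relopen_rng i) (cc_rng ip).
have n0 : \forall h \near 0^'+, 0 < (h : R) by exact: nbhs_right_gt.
by apply: filterS2 nA n0 => h Ah h0; split => //; apply: wall_shift => //; exact: ltW.
Qed.

Lemma tangential_pd u i p a : (forall q, boundary M q -> u q = 0) -> boundary M p -> dom i p ->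
  a != o -> pd a (u \o pp i) (cc i p) = 0.
Proof.
move=> u0 bp ip ao; rewrite (@pd_near R n _ (fun=> 0)).
- by apply: has_pdE; exact: has_pd_cst.
- by rewrite /= ppK// u0.
- apply: filterS (tangential_shift bp ip ao) => h [Ah wh] /=.
  by rewrite u0//; exact: rng_wall_boundary.
Qed.

Lemma pd_row_boundary u i p : (forall q, boundary M q -> u q = 0) -> boundary M p -> dom i p ->
  pd_row (u \o pp i) (cc i p) = pd o (u \o pp i) (cc i p) *: basis_vec o.
Proof.
move=> u0 bp ip; apply/rowP => a; rewrite !mxE eqxx /=.
have [->|ao] := eqVneq a o; first by rewrite mulr1.
by rewrite mulr0; exact: tangential_pd.
Qed.

(** The tangential derivatives of u vanish all along the wall, hence so do their own tangential
    derivatives; only the Christoffel term with upper index o is left. *)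
Lemma hessian_tangent u i p a b : smooth u -> (forall q, boundary M q -> u q = 0) ->
  boundary M p -> dom i p -> a != o -> b != o ->
  hessian u i p a b = - (christoffel (metric M i) o a b (cc i p) * pd o (u \o pp i) (cc i p)).
Proof.
move=> su u0 bp ip ao bo; rewrite mxE -/(pp i) -/(cc i p).
rewrite (@pd_near R n _ (fun=> 0)); first last.
- apply: filterS (tangential_shift bp ip ao) => h [Ah wh] /=.
  have bq := rng_wall_boundary Ah wh; have [iq qE] := rng_pp Ah.
  by have := tangential_pd u0 bq iq bo; rewrite qE.
- exact: tangential_pd.
rewrite (has_pdE (@has_pd_cst R n a 0 _)) sub0r (bigD1 o)//= big1 ?addr0// => c co.
by rewrite (tangential_pd u0 bp ip co) mulr0.
Qed.

Let sf : smooth f. Proof. exact: v_static_smooth hM. Qed.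

Let f0 q : boundary M q -> f q = 0. Proof. exact: (v_static_zero hM). Qed.

Let n1 : (n%:R - 1 : R) != 0.
Proof. by rewrite subr_eq0 pnatr_eq1 gtn_eqF. Qed.

Lemma v_static_trace i p : dom i p ->
  (1 - n%:R) * laplacian f p - f p * metric_trace (metric M i) (ricci i p) (cc i p) = n%:R * kappa.
Proof.
move=> ip; have uG := metric_unit (metric_chart i) (cc_rng ip).
have /(congr1 (fun S => metric_trace (metric M i) S (cc i p))) := v_static_equation hM ip.
have lE : \tr (invmx (metric M i (cc i p)) *m hessian f i p) = laplacian f p.
  by rewrite (laplacianE sf ip).
rewrite /metric_trace -/(cc i p) !mulmxDr mulmxN -!scalemxAr mulVmx// -scaleNr.
rewrite !mxtraceD !mxtraceZ mxtrace1 lE => h.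
by rewrite [RHS]mulrC -h; ring.
Qed.

Lemma laplacian_boundary p : boundary M p -> laplacian f p = - (n%:R * kappa / (n%:R - 1)).
Proof.
move=> bp; have := v_static_trace (domain_chart_at p); rewrite f0// mul0r subr0 => h.
by rewrite -h; field.
Qed.

Lemma hessian_boundary i p : boundary M p -> dom i p ->
  hessian f i p = - (kappa / (n%:R - 1)) *: metric M i (cc i p).
Proof.
move=> bp ip; have := v_static_equation hM ip; rewrite -/(cc i p) /=.
rewrite (laplacian_boundary bp) f0// scale0r subr0 opprK => /(canRL (addKr _)) ->.
by rewrite -scaleNr -scalerDl; congr (_ *: _); field.
Qed.

(** A tangential coordinate direction, available since n >= 2. *)
Let e1 : 'I_n := Ordinal n2.
Let e1o : e1 != o. Proof. by []. Qed.

(* If the normal derivative vanished, so would the tangential part of the Hessian,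
   which is a nonzero multiple of the metric. *)
Lemma pd_normal_gt0 i p : boundary M p -> dom i p -> 0 < pd o (f \o pp i) (cc i p).
Proof.
move=> bp ip; rewrite lt_neqAle; apply/andP; split; last first.
  have h := @smooth_pd R n _ _ _ o (relopen_rng i) (sf (i := i)) (cc_rng ip).
  rewrite leNgt; apply/negP => lt0.
  have nA := relopen_shift o (relopen_rng i) (cc_rng ip).
  have n0 : \forall h \near 0^'+, 0 < (h : R) by exact: nbhs_right_gt.
  have nq : \forall h \near (0 : R)^'+, h^-1 * ((f \o pp i) (cc i p + h *: basis_vec o) - (f \o pp i) (cc i p)) < 0.
    exact: (cvgr_lt _ h).
  have [t [[At t0] qt]] := filter_ex (filterI (filterI nA n0) nq).
  move: qt; rewrite /= ppK// (f0 bp) subr0 pmulr_rlt0 ?invr_gt0// ltNge => /negP; apply.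
  by have [/f0->|/(v_static_pos hM)/ltW] := pselect (boundary M (pp i (cc i p + t *: basis_vec o))).
apply/eqP => E; have := hessian_tangent sf f0 bp ip e1o e1o.
rewrite -E mulr0 oppr0 (hessian_boundary bp ip) mxE => /eqP; rewrite mulf_eq0 oppr_eq0.
have /lt0r_neq0/negPf -> := posdef_diag e1 (fun v0 : 'rV[R]_n => metric_on_pos (v := v0) (metric_chart i) (cc_rng ip)).
by rewrite orbF mulf_eq0 invr_eq0 (negPf kappa0) (negPf n1).
Qed.

Lemma grad_prod_in_boundary i p u : boundary M p -> dom i p ->
  grad_prod_in i f u p = pd o (f \o pp i) (cc i p) *
    (basis_vec o *m gi (G := metric M i) (cc i p) *m (pd_row (u \o pp i) (cc i p))^T) ord0 ord0.
Proof. by move=> bp ip; rewrite /grad_prod_in /coord_grad_prod pd_row_boundary// -!scalemxAl mxE. Qed.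

Lemma grad_prod_in_ff i p : boundary M p -> dom i p ->
  grad_prod_in i f f p = pd o (f \o pp i) (cc i p) ^+ 2 * gi (G := metric M i) (cc i p) o o.
Proof.
move=> bp ip; rewrite grad_prod_in_boundary// pd_row_boundary// linearZ /= -scalemxAr mxE.
by rewrite mulrA expr2 -rowE trmx_delta -colE !mxE.
Qed.

Lemma grad_boundary_gt0 p : boundary M p -> 0 < grad_prod f f p.
Proof.
move=> bp; have ip : dom (chart_at p) p by exact: domain_chart_at.
rewrite /grad_prod grad_prod_in_ff// mulr_gt0//; first by rewrite exprn_gt0// pd_normal_gt0.
exact: (gi_diag_gt0 (metric_chart _)) (cc_rng ip).
Qed.

Let a_ p := Num.sqrt (grad_prod f f p).

Let aE p : boundary M p -> a_ p = pd o (f \o pp (chart_at p)) (cc (chart_at p) p) *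
  Num.sqrt (gi (G := metric M (chart_at p)) (cc (chart_at p) p) o o).
Proof.
move=> bp; have ip : dom (chart_at p) p by exact: domain_chart_at.
rewrite /a_ /grad_prod grad_prod_in_ff// sqrtrM ?sqr_ge0// sqrtr_sqr ger0_norm//.
by rewrite ltW// pd_normal_gt0.
Qed.

(** Both grad f and the normal are multiples of row o of the inverse metric, and the derivative of f
    in direction o is positive: grad f = - |grad f| nu. *)
Lemma grad_prod_normal u p : boundary M p -> grad_prod f u p = - (a_ p * normal_derivative u p).
Proof.
move=> bp; have ip : dom (chart_at p) p by exact: domain_chart_at.
have s0 := gi_diag_gt0 (metric_chart (chart_at p)) o (cc_rng ip).
rewrite aE// /grad_prod grad_prod_in_boundary//.
have -> : normal_derivative u p = (coord_normal (metric M (chart_at p)) (cc (chart_at p) p)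
    *m (pd_row (u \o pp (chart_at p)) (cc (chart_at p) p))^T) ord0 ord0.
  by rewrite mxE; apply: eq_bigr => a _; rewrite [_^T _ _]mxE [pd_row _ _ _ _]mxE.
rewrite (coord_normalE (G := metric M (chart_at p)) o0) -scalemxAl [X in - (_ * X)]mxE.
have w0 : Num.sqrt (gi (G := metric M (chart_at p)) (cc (chart_at p) p) o o) != 0.
  by rewrite gt_eqF// sqrtr_gt0.
by field.
Qed.

(** Comparing [hessian_tangent] with [hessian_boundary] shows that the boundary is umbilic,
    Gamma^o_ab = mu g_ab with mu = kappa / ((n - 1) d_o f). *)
Lemma mean_curvature_boundary p : boundary M p -> mean_curvature p = kappa / a_ p.
Proof.
move=> bp; have ip : dom (chart_at p) p by exact: domain_chart_at.
have s0 := gi_diag_gt0 (metric_chart (chart_at p)) o (cc_rng ip).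
have F0 := pd_normal_gt0 bp ip.
rewrite aE//.
rewrite /mean_curvature (@mean_curvature_umbilic R n _ _ (metric_chart (chart_at p)) o o0 _
  (kappa / (n%:R - 1) / pd o (f \o pp (chart_at p)) (cc (chart_at p) p)) (cc_rng ip)).
  have w0 : Num.sqrt (gi (G := metric M (chart_at p)) (cc (chart_at p) p) o o) != 0.
    by rewrite gt_eqF// sqrtr_gt0.
  by field; rewrite w0 n1 gt_eqF.
move=> a b ao bo; have := hessian_tangent sf f0 bp ip ao bo.
rewrite (hessian_boundary bp ip) mxE mulNr => /oppr_inj h.
by apply: (mulIf (lt0r_neq0 F0)); rewrite -h; field; rewrite n1 gt_eqF.
Qed.

(** Along a tangential direction the derivative of |grad f|^2 is 2 Hess f (grad f, d_a), a multiple
    of d_a f = 0 because Hess f is a multiple of g there. *)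
Lemma grad_boundary_const : connected (boundary M) ->
  forall p q, boundary M p -> boundary M q -> grad_prod f f q = grad_prod f f p.
Proof.
move=> conb; have sg : smooth (grad_prod f f) by exact: smooth_grad_prod.
apply: (connected_const (smooth_continuous sg) conb) => p bp.
have ip : dom (chart_at p) p by exact: domain_chart_at.
set i := chart_at p in ip *; have wp := boundary_wall bp ip.
have hpd y z a : rng i y -> wall y -> wall z ->
    (z - cc i p) ord0 a * pd a (grad_prod f f \o pp i) y = 0.
  move=> Ay wy wz; have [->|ao] := eqVneq a o.
    by move/wallE : wz => [_ zo]; move/wallE : wp => [_ po]; rewrite !mxE zo po subrr mul0r.
  have [iy yE] := rng_pp Ay; have by_ := rng_wall_boundary Ay wy.
  have gE x : rng i x -> (grad_prod f f \o pp i) x = coord_grad_prod (G := metric M i) (f \o pp i) (f \o pp i) x.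
    move=> Ax; have [ix xE] := rng_pp Ax; have Cx := smooth_C1_at ix sf.
    by rewrite /= (grad_prodE ix Cx Cx) /grad_prod_in xE.
  rewrite (@pd_near R n _ (coord_grad_prod (G := metric M i) (f \o pp i) (f \o pp i))); last 2 first.
  - exact: gE.
  - by have := relopen_shift a (relopen_rng i) Ay; apply: filterS => h; exact: gE.
  rewrite (has_pdE (has_pd_grad_prod (metric_chart i) (c := a) (sf (i := i)) (sf (i := i)) Ay)).
  have hE : coord_hessian (metric M i) (f \o pp i) y = - (kappa / (n%:R - 1)) *: metric M i y.
    by have := hessian_boundary by_ iy; rewrite /hessian -/(pp i) -/(cc i _) yE.
  have uG := metric_unit (metric_chart i) Ay.
  have r1 : row a (coord_hessian (metric M i) (f \o pp i) y) *m gi (G := metric M i) y =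
      - (kappa / (n%:R - 1)) *: basis_vec a.
    by rewrite hE linearZ /= -scalemxAl rowE (mulmxK uG).
  have fa : pd a (f \o pp i) y = 0 by have := tangential_pd f0 by_ iy ao; rewrite yE.
  have r2 : (- (kappa / (n%:R - 1)) *: basis_vec a *m (pd_row (f \o pp i) y)^T) ord0 ord0 = 0.
    by rewrite -scalemxAl mxE -rowE !mxE fa mulr0.
  have r3 : pd_row (f \o pp i) y *m gi (G := metric M i) y *m (row a (coord_hessian (metric M i) (f \o pp i) y))^T =
      (- (kappa / (n%:R - 1)) *: basis_vec a *m (pd_row (f \o pp i) y)^T)^T.
    by rewrite -r1 !trmx_mul trmxK (gi_sym (metric_chart i) Ay) mulmxA.
  by rewrite -/(pp i) r3 r1 [X in _ * X]mxE r2 add0r [X in _ * X]mxE r2 mulr0.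
have h := @locally_const R n M i p _ wall sg ip (fun x => @proj1 _ _) wall_convex wp hpd.
have nd := open_nbhs_nbhs (conj (open_dom i) ip).
by apply: filterS2 nd h => q iq h bq; apply: h; exact: boundary_wall.
Qed.

End V_static.

(** * The Steklov problem *)

Section Steklov.
Context {R : realType} {n : nat} {M : riemannian R n}.
Implicit Types (p q : M) (i : Defs.index M) (u v w : M -> R) (a b c d : 'I_n).

Lemma smooth_coord_ricci (A : set 'rV[R]_n) G a b : metric_on A G ->
  smooth_within A (fun x => coord_ricci G x a b).
Proof.
move=> mG; have rA := metric_on_relopen mG; have sG := smooth_christoffel mG.
apply: (@smooth_within_ext _ _ _ (fun x => \sum_c
    (pd c (christoffel G c a b) x - pd b (christoffel G c a c) x
     + \sum_d (christoffel G c c d x * christoffel G d a b x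
               - christoffel G c b d x * christoffel G d a c x)))) => [x _|].
  by rewrite mxE.
apply: smooth_within_sum => c; apply: smooth_withinD.
  by apply: smooth_withinB; apply: smooth_within_pd.
by apply: smooth_within_sum => d; apply: smooth_withinB; apply: smooth_withinM.
Qed.

Lemma grad_prodC u v p : grad_prod u v p = grad_prod v u p.
Proof.
have ip : dom (chart_at p) p by exact: domain_chart_at.
rewrite /grad_prod /grad_prod_in /coord_grad_prod -[in LHS](trmxK (pd_row _ _ *m _ *m _)) [in LHS]mxE.
by rewrite !trmx_mul trmxK (gi_sym (metric_chart _) (cc_rng ip)) mulmxA.
Qed.

Lemma grad_prod_ge0 u p : 0 <= grad_prod u u p.
Proof.
have ip : dom (chart_at p) p by exact: domain_chart_at.
rewrite /grad_prod /grad_prod_in /coord_grad_prod; set v := pd_row _ _.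
have [->|v0] := eqVneq v 0; first by rewrite !mul0mx mxE.
exact: ltW (gi_posdef (metric_chart _) (cc_rng ip) v0).
Qed.

Lemma laplacian_cst (t : R) p : laplacian (fun _ : M => t) p = 0.
Proof.
rewrite /laplacian /coord_laplacian (_ : coord_hessian _ _ _ = 0).
  by rewrite /metric_trace mulmx0 mxtrace0.
have pd0 (s : R) a : pd a (fun _ : 'rV[R]_n => s) = fun=> 0.
  by apply/funext => x; apply: has_pdE; exact: has_pd_cst.
apply/matrixP => a b; rewrite !mxE pd0 pd0 big1 ?subrr// => d _.
by rewrite pd0 mulr0.
Qed.

Lemma laplacianD t u v p : smooth u -> smooth v ->
  laplacian (fun q => u q + t * v q) p = laplacian u p + t * laplacian v p.
Proof.
move=> su sv; have ip : dom (chart_at p) p by exact: domain_chart_at.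
rewrite /laplacian; set i := chart_at p in ip *; rewrite -/(pp i) -/(cc i p).
have rA := relopen_rng (M := M) i; have Ap := cc_rng ip.
pose F := u \o pp i; pose H := v \o pp i; pose E := (fun q => u q + t * v q) \o pp i.
have pdE a y : rng i y -> pd a E y = pd a F y + t * pd a H y.
  move=> Ay; apply: has_pdE.
  exact: (has_pdD (@smooth_pd R n _ _ _ a rA (su i) Ay)
    (has_pdZ (c := t) (@smooth_pd R n _ _ _ a rA (sv i) Ay))).
have pdpdE a b y : rng i y -> pd a (pd b E) y = pd a (pd b F) y + t * pd a (pd b H) y.
  move=> Ay; rewrite (@pd_near R n _ (fun z => pd b F z + t * pd b H z)).
  - have s1 := @smooth_within_pd R n _ _ b rA (su i); have s2 := @smooth_within_pd R n _ _ b rA (sv i).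
    apply: has_pdE; exact: (has_pdD (@smooth_pd R n _ _ _ a rA s1 Ay)
      (has_pdZ (c := t) (@smooth_pd R n _ _ _ a rA s2 Ay))).
  - exact: pdE.
  - by have := relopen_shift a rA Ay; apply: filterS => h; exact: pdE.
have hE : coord_hessian (metric M i) E (cc i p) =
    coord_hessian (metric M i) F (cc i p) + t *: coord_hessian (metric M i) H (cc i p).
  apply/matrixP => a b; rewrite !mxE pdpdE// mulrBr addrACA; congr (_ + _).
  rewrite mulr_sumr -opprD -big_split /=; congr (- _); apply: eq_bigr => d _.
  by rewrite pdE// mulrDr mulrCA.
rewrite /coord_laplacian -/E hE /metric_trace mulmxDr mxtraceD -scalemxAr mxtraceZ.
by [].
Qed.

Variables (f : M -> R) (kappa : R).
Hypothesis n2 : (1 < n)%N.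
Hypothesis hM : compact_v_static f kappa.
Hypothesis hconn : connected (boundary M).
Hypothesis kappa0 : kappa != 0.
Hypothesis hR : forall p : M, 0 <= scalar_curvature p.

Let sf : smooth f. Proof. exact: v_static_smooth hM. Qed.
Let f0 q : boundary M q -> f q = 0. Proof. exact: (v_static_zero hM). Qed.
Let cM : compact [set: M]. Proof. exact: v_static_compact hM. Qed.
Let conM : connected [set: M]. Proof. exact: v_static_connected hM. Qed.
Let fpos p : ~ boundary M p -> 0 < f p. Proof. exact: (v_static_pos hM). Qed.

Let n1 : (n%:R - 1 : R) != 0.
Proof. by rewrite subr_eq0 pnatr_eq1 gtn_eqF. Qed.

Let n1_gt0 : 0 < n%:R - 1 :> R.
Proof. by rewrite subr_gt0 ltr1n. Qed.

Let K := divergence_zero cM sf fpos f0 (grad_boundary_gt0 n2 hM kappa0).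

(** The field w grad w has divergence |grad w|^2 and vanishes on the boundary. *)
Lemma dirichlet_unique w : smooth w -> (forall p, laplacian w p = 0) ->
  (forall p, boundary M p -> w p = 0) -> forall p, w p = 0.
Proof.
move=> sw lw w0; have g0 p : ~ boundary M p -> grad_prod w w p = 0.
  move=> nb; have := K (m := 1) (phi := fun=> w) (psi := fun=> w) (fun=> sw) (fun=> sw) _ _ nb.
  rewrite big_ord1 lw mulr0 addr0; apply.
  - by move=> q _; rewrite big_ord1 lw mulr0 addr0 grad_prod_ge0.
  - by move=> q bq; rewrite big_ord1 w0// mul0r.
have [pb bb] := v_static_boundary hM => p.
by rewrite (grad0_const sw conM g0 pb p) w0.
Qed.

Variable pb : M.
Hypothesis bb : boundary M pb.
Let a := Num.sqrt (grad_prod f f pb).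
Let c : R := n%:R * kappa / (n%:R - 1).

Let a_gt0 : 0 < a.
Proof. by rewrite sqrtr_gt0; exact: (grad_boundary_gt0 n2 hM kappa0 bb). Qed.

Let c_neq0 : c != 0.
Proof.
by rewrite mulf_neq0 ?invr_eq0// mulf_neq0// pnatr_eq0 -lt0n ltnW.
Qed.

Let grad_normal u p : boundary M p -> grad_prod f u p = - (a * normal_derivative u p).
Proof.
move=> bp; rewrite (grad_prod_normal n2 hM kappa0 _ bp).
by rewrite (grad_boundary_const n2 hM hconn bb bp).
Qed.

Let grad_ff p : boundary M p -> grad_prod f f p = a ^+ 2.
Proof.
move=> bp; rewrite (grad_boundary_const n2 hM hconn bb bp) sqr_sqrtr//.
exact: grad_prod_ge0.
Qed.

Let bound_eq p : boundary M p -> n%:R / (n%:R - 1) * mean_curvature p = c / a.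
Proof.
move=> bp; rewrite (mean_curvature_boundary n2 hM kappa0 bp).
rewrite (grad_boundary_const n2 hM hconn bb bp) -/a /c.
by field; rewrite n1 gt_eqF.
Qed.

Let lap_f p : - laplacian f p - c = f p * scalar_curvature p / (n%:R - 1).
Proof.
have := v_static_trace hM (domain_chart_at p).
rewrite -/(scalar_curvature p) /c => h; apply: (mulIf n1).
rewrite mulrBl divfK// divfK// -h; ring.
Qed.

(* With h = Lap u, the field h grad u - u grad h has divergence h^2. *)
Lemma steklov_eigenvalue_gt0 (q : R) u : steklov_eigenfunction q u -> 0 < q.
Proof.
move=> hu; have su := steklov_smooth hu; rewrite ltNge; apply/negP => q0.
pose h := laplacian u; have sh : smooth h by exact: smooth_laplacian.
(* The shape 0 + s * v is the one [grad_prod_affine] rewrites. *)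
pose phi (k : 'I_2) := nth h [:: h; fun p => 0 + (-1) * u p] k.
pose psi (k : 'I_2) := nth h [:: u; h] k.
have sphi k : smooth (phi k).
  case: k => [[|[|k]] hk] //=; apply: smoothD; first exact: smooth_cst.
  by apply: smoothM => //; exact: smooth_cst.
have spsi k : smooth (psi k) by case: k => [[|[|k]] hk].
have dE p : \sum_k (grad_prod (phi k) (psi k) p + phi k p * laplacian (psi k) p) = h p ^+ 2.
  rewrite !big_ord_recl big_ord0 /phi /psi /= grad_prod_affine; last exact: smooth_C1_at (domain_chart_at p) su.
  by rewrite (steklov_biharmonic hu) (grad_prodC u) -/h; ring.
have h0 p : ~ boundary M p -> h p = 0.
  move=> nb; have := K sphi spsi _ _ nb; rewrite dE => hz.
  apply/eqP; rewrite -sqrf_eq0; apply/eqP; apply: hz.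
    by move=> q' _; rewrite dE sqr_ge0.
  move=> q' bq; rewrite !big_ord_recl big_ord0 /phi /psi /= (steklov_dirichlet hu bq) !(mulr0, addr0, mul0r).
  rewrite grad_normal// /h (steklov_boundary hu bq).
  have -> : q * normal_derivative u q' * - (a * normal_derivative u q') =
    (- q) * (a * normal_derivative u q' ^+ 2) by ring.
  by rewrite mulr_ge0 ?oppr_ge0// mulr_ge0 ?sqr_ge0// ltW.
have hz : h =1 (fun=> 0).
  by apply: interior_dense => //; [exact: smooth_continuous|exact: cst_continuous].
have [p /eqP] := steklov_nontrivial hu; apply.
exact: (dirichlet_unique su hz (steklov_dirichlet hu)).
Qed.

(* With h = Lap u, the field
     - h^2 grad f + 2 f h grad h - c h grad u + c u grad h
   has divergence h^2 f R / (n - 1) + 2 f |grad h|^2, and its product with grad f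
   on the boundary is a h^2 (c / q - a). *)
Lemma steklov_rigidity (q : R) u : steklov_eigenfunction q u -> q <= c / a ->
  [/\ q = c / a, forall p, scalar_curvature p = 0 &
      exists2 t : R, t != 0 & forall p, u p = t * f p].
Proof.
move=> hu qle; have su := steklov_smooth hu; have q0 := steklov_eigenvalue_gt0 hu.
pose h := laplacian u; have sh : smooth h by exact: smooth_laplacian.
pose phi (k : 'I_4) := nth h [:: fun p => 0 + (-1) * (h p * h p); fun p => 0 + 2 * (f p * h p);
  fun p => 0 + (- c) * h p; fun p => 0 + c * u p] k.
pose psi (k : 'I_4) := nth h [:: f; h; u; h] k.
have saff (s : R) v : smooth v -> smooth (fun p => 0 + s * v p).
  by move=> sv; apply: smoothD; [exact: smooth_cst|apply: smoothM => //; exact: smooth_cst].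
have shh : smooth (fun p => h p * h p) by exact: smoothM.
have sfh : smooth (fun p => f p * h p) by exact: smoothM.
have sphi k : smooth (phi k) by case: k => [[|[|[|[|k]]]] hk] //=; exact: saff.
have spsi k : smooth (psi k) by case: k => [[|[|[|[|k]]]] hk].
have dE p : \sum_k (grad_prod (phi k) (psi k) p + phi k p * laplacian (psi k) p) =
    h p ^+ 2 * (f p * scalar_curvature p / (n%:R - 1)) + 2 * f p * grad_prod h h p.
  have at_ v : smooth v -> C1_at (chart_at p) p v by exact: smooth_C1_at (domain_chart_at p).
  rewrite !big_ord_recl big_ord0 /phi /psi /= !grad_prod_affine; try exact: at_.
  rewrite !grad_prodM; try exact: at_.
  rewrite (steklov_biharmonic hu) -lap_f (grad_prodC u h) (grad_prodC f h) -/(h p); ring.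
have d0 p : ~ boundary M p -> h p ^+ 2 * (f p * scalar_curvature p / (n%:R - 1)) = 0 /\ grad_prod h h p = 0.
  move=> nb; have := K sphi spsi _ _ nb; rewrite dE => hz.
  have A q' : ~ boundary M q' -> 0 <= h q' ^+ 2 * (f q' * scalar_curvature q' / (n%:R - 1)).
    by move=> /fpos fq; rewrite mulr_ge0 ?sqr_ge0// divr_ge0 ?(ltW n1_gt0)// mulr_ge0// ltW.
  have B q' : ~ boundary M q' -> 0 <= 2 * f q' * grad_prod h h q'.
    by move=> /fpos fq; rewrite mulr_ge0 ?grad_prod_ge0// mulr_ge0// ltW.
  have : h p ^+ 2 * (f p * scalar_curvature p / (n%:R - 1)) + 2 * f p * grad_prod h h p = 0.
    apply: hz => q' bq; first by rewrite dE addr_ge0 ?A ?B.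
    rewrite !big_ord_recl big_ord0 /phi /psi /= (steklov_dirichlet hu bq) (f0 bq) grad_ff//.
    rewrite !grad_normal//; have hq : h q' = q * normal_derivative u q' := steklov_boundary hu bq.
    have nE : normal_derivative u q' = h q' / q by rewrite hq mulrC mulKf// gt_eqF.
    rewrite nE.
    have -> : (0 + -1 * (h q' * h q')) * a ^+ 2 + ((0 + 2 * (0 * h q')) * - (a * normal_derivative h q') +
       ((0 + - c * h q') * - (a * (h q' / q)) + ((0 + c * 0) * - (a * normal_derivative h q') + 0))) =
       a * h q' ^+ 2 * (c / q - a) by ring.
    (* q > 0 turns q <= c / a into a <= c / q. *)
    apply: mulr_ge0; first by rewrite mulr_ge0 ?sqr_ge0// ltW.
    by rewrite subr_ge0 ler_pdivlMr// mulrC -ler_pdivlMr.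
  move=> /eqP; rewrite paddr_eq0 ?A ?B// => /andP[/eqP -> /eqP e]; split => //.
  have fp := fpos nb; move/eqP: e; rewrite mulf_eq0 => /orP[|/eqP//].
  by rewrite gt_eqF// mulr_gt0.
have hconst := grad0_const sh conM (fun p nb => (d0 p nb).2).
pose k := h pb; have hk p : h p = k by exact: hconst.
have k0 : k != 0.
  (* Otherwise u is harmonic with zero boundary values, hence zero. *)
  apply/eqP => kz; have [p /eqP] := steklov_nontrivial hu; apply.
  by apply: (dirichlet_unique su) (steklov_dirichlet hu) p => p; rewrite -/(h p) hk.
have R0 p : ~ boundary M p -> scalar_curvature p = 0.
  move=> nb; have [/eqP + _] := d0 p nb; rewrite hk mulf_eq0 sqrf_eq0 (negPf k0) /=.
  by rewrite mulf_eq0 invr_eq0 (negPf n1) orbF mulf_eq0 gt_eqF ?fpos//= => /eqP.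
have lfi p : ~ boundary M p -> laplacian f p = - c.
  by move=> nb; have := lap_f p; rewrite R0// mulr0 mul0r => /eqP; rewrite subr_eq0 => /eqP <-; rewrite opprK.
have lf : laplacian f =1 (fun=> - c).
  apply: interior_dense lfi; last exact: cst_continuous.
  by apply: smooth_continuous; exact: smooth_laplacian.
(* Lap u = k and Lap f = - c, so u + (k / c) f is harmonic and vanishes on the boundary. *)
have uE p : u p = - (k / c) * f p.
  have sw : smooth (fun q => u q + (k / c) * f q).
    by apply: smoothD => //; apply: smoothM => //; exact: smooth_cst.
  have := dirichlet_unique sw _ _ p; rewrite mulNr => w0; apply/eqP; rewrite -addr_eq0; apply/eqP/w0.
    by move=> p'; rewrite laplacianD// lf -/(h p') hk mulrN divfK// subrr.
  by move=> p' bp'; rewrite (steklov_dirichlet hu bp') f0// mulr0 addr0.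
split.
- have e1 := steklov_boundary hu bb; have e2 := grad_normal u bb.
  have e3 : grad_prod f u pb = - (k / c) * a ^+ 2.
    have uF : u = fun q => 0 + - (k / c) * f q by apply/funext => p; rewrite add0r.
    rewrite grad_prodC -(grad_ff bb) -(grad_prod_affine 0 _ _ (smooth_C1_at (domain_chart_at pb) sf)).
    by rewrite -uF.
  have nE : normal_derivative u pb = k / c * a.
    by apply: (mulfI (lt0r_neq0 a_gt0)); apply: oppr_inj; rewrite -e2 e3; ring.
  move: e1; rewrite nE -/(h pb) hk => e1.
  by apply: (mulIf k0); rewrite {2}e1; field; rewrite c_neq0 gt_eqF.
- move=> p; have [bp|] := pselect (boundary M p); last exact: R0.
  have ip : dom (chart_at p) p by exact: domain_chart_at.
  rewrite /scalar_curvature; set i := chart_at p in ip *; rewrite /ricci -/(cc i p).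
  (* At a boundary point f = 0 hides the curvature, and [scalar_curvature] switches charts from
     point to point. Hence continuity in the fixed chart i; at interior points S = 0 follows from
     [v_static_trace], which holds in any chart. *)
  pose S x := metric_trace (metric M i) (coord_ricci (metric M i) x) x.
  have sS : smooth_within (rng i) S.
    rewrite /S /metric_trace /mxtrace; apply: smooth_within_sum => b.
    apply: (@smooth_within_ext _ _ _
      (fun x => \sum_d invmx (metric M i x) b d * coord_ricci (metric M i) x d b)) => [x _|].
      by rewrite mxE.
    apply: smooth_within_sum => d; apply: smooth_withinM; first exact: (smooth_gi (metric_chart i)).
    exact: smooth_coord_ricci (metric_chart i).
  have nI := relopen_approach (relopen_rng i) (cc_rng ip).
  have cS : S (cc i p + t *: const_mx 1) @[t --> (0 : R)^'+] --> S (cc i p).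
    move=> B /(smooth_within_cvg sS (cc_rng ip)) /(@shift_cvg0 R n (cc i p) (const_mx 1)).
    by apply: filterS2 nI => t [At _]; exact.
  apply: (cvg_unique (@norm_hausdorff _ _) cS); apply: (cvg_trans _ (cvg_cst (0 : R) (F := (0 : R)^'+))).
  apply: near_eq_cvg; apply: filterS nI => t At; have [it nbt] := inner_rng_pp At.
  have := v_static_trace hM it; rewrite lf (rng_pp At.1).2 /ricci -/(cc i _) (rng_pp At.1).2 -/(S _) /c => e.
  have : f (pp i (cc i p + t *: const_mx 1)) * S (cc i p + t *: const_mx 1) = 0.
    have e' : (1 - n%:R) * - (n%:R * kappa / (n%:R - 1)) = n%:R * kappa by field.
    by move: e; rewrite e' => /eqP; rewrite subr_eq addrC -subr_eq subrr eq_sym => /eqP.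
  by move=> /eqP; rewrite mulf_eq0 gt_eqF ?fpos//= => /eqP.
- by exists (- (k / c)) => //; rewrite oppr_eq0 mulf_neq0// invr_eq0.
Qed.

Lemma potential_eigenfunction : (forall p, scalar_curvature p = 0) -> steklov_eigenfunction (c / a) f.
Proof.
move=> R0; have lf p : laplacian f p = - c.
  by have := lap_f p; rewrite R0 mulr0 mul0r => /eqP; rewrite subr_eq0 => /eqP <-; rewrite opprK.
split => //.
- have [p [q pq]] := v_static_nonconstant hM; apply: contrapT => h; move/eqP: pq; apply.
  have fz r : f r = 0 by apply/eqP; apply: contrapT => /negP fr; apply: h; exists r.
  by rewrite !fz.
- by move=> p; rewrite (_ : laplacian f = fun=> - c) ?laplacian_cst//; apply/funext.
- move=> p bp; rewrite lf; have := grad_normal f bp; rewrite grad_ff// expr2 -mulrN.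
  move=> /(mulfI (lt0r_neq0 a_gt0)) h; have -> : normal_derivative f p = - a by rewrite h opprK.
  by rewrite mulrN divfK// gt_eqF.
Qed.

Lemma steklov_first (q1 : R) : first_steklov_eigenvalue M q1 ->
  let bound := n%:R / (n%:R - 1) * mean_curvature pb in
  [/\ bound <= q1, q1 = bound <-> (forall p, scalar_curvature p = 0) &
      q1 = bound -> forall u, steklov_eigenfunction q1 u ->
        exists2 t : R, t != 0 & forall p, u p = t * f p].
Proof.
(* If q1 were smaller than c / a, the rigidity statement would force q1 = c / a. *)
rewrite /= bound_eq// => -[[u hu] qmin]; have le1 : c / a <= q1.
  by rewrite leNgt; apply/negP => /[dup] /ltW /(steklov_rigidity hu)[-> _ _]; rewrite ltxx.
split => //; first split.
- move=> e; have le2 : q1 <= c / a by rewrite e.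
  by have [] := steklov_rigidity hu le2.
- move=> /potential_eigenfunction hf; apply/eqP; rewrite eq_le le1 andbT; apply: qmin.
  by exists f.
- move=> e v hv; have le2 : q1 <= c / a by rewrite e.
  by have [] := steklov_rigidity hv le2.
Qed.

End Steklov.

Theorem theorem2 (R : realType) (n : nat) (hn : (3 <= n)%N)
    (M : riemannian R n) (f : M -> R) (kappa : R)
    (hM : compact_v_static f kappa)
    (hconn : connected (boundary M))
    (hkappa : kappa != 0)
    (hR : forall p : M, 0 <= scalar_curvature p)
    (q1 : R) (hq1 : first_steklov_eigenvalue M q1) :
  forall p : M, boundary M p ->
    let bound := n%:R / (n%:R - 1) * mean_curvature p in
    [/\ bound <= q1,
        q1 = bound <-> (forall x : M, scalar_curvature x = 0) &
        q1 = bound ->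
          forall u : M -> R, steklov_eigenfunction q1 u ->
            exists2 c : R, c != 0 & forall x : M, u x = c * f x].
Proof.
move=> p bp; exact: (steklov_first (ltnW hn) hM hconn hkappa hR bp hq1).
Qed.
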